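(* Let $\beta\in(0,\infty)$ and $\lambda\in[0,\infty)$. The quantum random graph $Q_n^{\beta,\lambda}$ is an instance of the general inhomogeneous random graph $G^{\mathcal V}(n,\kappa)$ (in its Poisson multigraph version), as follows. Let $\mathcal S$ be the metric space of open intervals of the circle $\mathbb S_\beta$ and $\mu$ the measure on $\mathcal S$, both defined in the context; let $\mathbf x_n=(x_1,\dots,x_{N_n})$ be the collection of all intervals $I_i^k$ ($1\le i\le n$, $1\le k\le M_i^*$), in some order, regarded as elements of $\mathcal S$, so that $N_n=\sum_{i=1}^n M_i^*$; and let $\kappa(I,J)=|I\cap J|$ for $I,J\in\mathcal S$. Then $\mathcal V=(\mathcal S,\mu,(\mathbf x_n)_{n\ge1})$ and $\kappa$ satisfy all of the conditions (i)–(vii) listed in the context, and, conditionally on $\mathbf x_n$, the numbers of edges of $Q_n^{\beta,\lambda}$ (counted with multiplicity) between the different pairs of vertices $x_i,x_j$, $i<j$, are independent with distributions $\mathrm{Po}(\kappa(x_i,x_j)/n)$.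
   Context: Definition of the quantum random graph $Q_n^{\beta,\lambda}$. Let $\mathbb S_\beta$ be a circle of length $\beta$, i.e. the interval $[0,\beta]$ with endpoints identified, and take $n$ disjoint copies $\mathbb S_\beta^1,\dots,\mathbb S_\beta^n$. On each circle $\mathbb S_\beta^i$ there is a Poisson process of ''holes'' with intensity $\lambda$; these processes are independent for different $i$. Let $M_i\sim\mathrm{Po}(\lambda\beta)$ be the number of holes on $\mathbb S_\beta^i$ and $M_i^*:=\max\{M_i,1\}$. The holes split $\mathbb S_\beta^i$ into open intervals $I_i^k$, $k=1,\dots,M_i^*$ (if $M_i=0$, the entire circle is regarded as a single interval). The vertex set of $Q_n^{\beta,\lambda}$ is $\{I_i^k:1\le i\le n,\ 1\le k\le M_i^*\}$. For each unordered pair $\{i,j\}$ of distinct indices there is a Poisson process $L_{ij}$ on $\mathbb S_\beta$ with intensity $1/n$, independent of everything else; for each point $x$ of $L_{ij}$, an edge is added between the interval $I_i^k$ containing the copy of $x$ in $\mathbb S_\beta^i$ and the interval $I_j^l$ containing the copy of $x$ in $\mathbb S_\beta^j$. This gives a multigraph. The space $\mathcal S$. All intervals of full length $\beta$ (the circle $\mathbb S_\beta$ itself, and the circle minus one point) are identified. Let $\mathcal S=\mathcal S_1\cup\mathcal S_2$, where $\mathcal S_1=\{\mathbb S_\beta\}$ is a singleton and $\mathcal S_2$ is the set of all open intervals (arcs) in $\mathbb S_\beta$ of length less than $\beta$, identified with $\{(x,\ell):x\in\mathbb S_\beta,\ 0<\ell<\beta\}$ with $x$ the left endpoint and $\ell$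 the length. $\mathcal S_2$ has the product topology, and both $\mathcal S_1$ and $\mathcal S_2$ are open in $\mathcal S$ (with any corresponding metric). $|\cdot|$ denotes length (Lebesgue measure on $\mathbb S_\beta$). The measure $\mu$. Consider a Poisson process of holes of intensity $\lambda$ on a single circle $\mathbb S_\beta$, let $M\sim\mathrm{Po}(\lambda\beta)$ be the number of holes and $M^*:=\max\{M,1\}$, and let $I_1,\dots,I_{M^*}$ be the random open intervals into which the holes split $\mathbb S_\beta$ (if $M=0$, the entire circle is regarded as a single interval), regarded as elements of $\mathcal S$. For Borel $A\subseteq\mathcal S$, $\mu(A):=\mathbb E\,\#\{i\le M^*:I_i\in A\}$. General inhomogeneous random graph. Given $\mathcal V=(\mathcal S,\mu,(\mathbf x_n)_{n\ge1})$ and a symmetric non-negative Borel measurable function $\kappa$ on $\mathcal S\times\mathcal S$, the (Poisson multigraph version of the) random graph $G^{\mathcal V}(n,\kappa)$ has vertices $1,\dots,N_n$ and, given $\mathbf x_n=(x_1,\dots,x_{N_n})$, a $\mathrm{Po}(\kappa(x_i,x_j)/n)$ number of edges between $i$ and $j$, independently for all pairs $i<j$. The conditions required are: (i) $\mathcal S$ is a separable metric space; (ii) $\mu$ is a positive Borel measure on $\mathcal S$ with $0<\mu(\mathcal S)<\infty$; (iii) for each $n$, $\mathbf x_n$ is a random sequence $(x_1,\dots,x_{N_n})$ of $N_n$ points of $\mathcal S$ ($N_n$ may be deterministic or random); (iv) with $\mu_n:=\frac1n\sum_{i=1}^{N_n}\delta_{x_i}$, where $\delta_x$ is the Dirac measure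 at $x$, $\mu_n\to\mu$ in probability as $n\to\infty$, as random elements of the space of finite positive Borel measures on $\mathcal S$ with the weak topology (tested against bounded continuous functions); equivalently, $\mu_n(A)\to\mu(A)$ in probability for every Borel set $A$ with $\mu(\partial A)=0$; (v) $\kappa$ is continuous a.e. on $\mathcal S\times\mathcal S$ (with respect to $\mu\times\mu$); (vi) $\kappa\in L^1(\mathcal S\times\mathcal S,\mu\times\mu)$; (vii) $\frac1n\mathbb E\,e(G^{\mathcal V}(n,\kappa))\to\frac12\iint_{\mathcal S^2}\kappa(x,y)\,d\mu(x)\,d\mu(y)$ as $n\to\infty$, where $e(\cdot)$ denotes the number of edges. *)

(* Defs.v *)
From HB Require Import structures.
From mathcomp Require Import all_boot all_order all_algebra.
From mathcomp Require Import finmap.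
From mathcomp Require Import ring lra.
From mathcomp Require Import all_classical all_reals all_analysis.

Set Implicit Arguments.
Unset Strict Implicit.
Unset Printing Implicit Defensive.

Import Order.TTheory GRing.Theory Num.Theory.
Import numFieldNormedType.Exports.

Local Open Scope classical_set_scope.
Local Open Scope ring_scope.

(** * Probability *)

(* The second argument of [poisson_prob] is ignored; for rate 0 the
   distribution is the Dirac mass at 0. *)
Definition Po {R : realType} (rate : R) : probability nat R :=
  poisson_prob rate 0%N.

Section independence.
Context {R : realType} {d} {T : measurableType d} (P : probability T R).

(* The events of [F i], i in [D], are mutually independent (the [F i] will be
   sigma-algebras). *)
Definition mutual_indep (I : finType) (D : {set I}) (F : I -> set (set T)) :=
  forall (J : {set I}) (E : I -> set T), J \subset D ->
    (forall i, i \in J -> F i (E i)) ->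
    P (\bigcap_(i in [set` J]) E i) = (\prod_(i in J) P (E i))%E.

End independence.

(* The spaces may differ with n, the limit l being deterministic. *)
Definition cvg_in_prob {R : realType} {d : nat -> measure_display}
    {T : forall n, measurableType (d n)} (P : forall n, probability (T n) R)
    (X : forall n, T n -> R) (l : R) :=
  forall eps : R, 0 < eps ->
    P n [set w | eps <= `|X n w - l|] @[n --> \oo] --> 0%E.

(** * Pointed metric spaces and their Borel sigma-algebra *)

#[short(type="pmetricType")]
HB.structure Definition PMetric (R : numDomainType) :=
  { M of Metric R M & Pointed M }.

Definition borel {R : numDomainType} (S : pmetricType R) :=
  g_sigma_algebraType (@open S).

Definition separable (S : topologicalType) :=
  exists2 D : set S, countable D & dense D.

Definition boundary {S : topologicalType} (A : set S) := closure A `\` A°.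

(** * The general inhomogeneous random graph *)

Section random_sequence.
Context {R : realType} {S : pmetricType R} {d} {T : measurableType d}.

Definition random_seq (x : T -> seq S) :=
  measurable_fun setT (fun w => size (x w)) /\
  forall i, measurable_fun [set w | (i < size (x w))%N]
              (fun w => nth point (x w) i : borel S).

Definition sigma_seq (x : T -> seq S) : set (set T) :=
  <<s [set E | (exists N, E = [set w | size (x w) = N]) \/
               (exists i (A : set (borel S)), measurable A /\
                E = [set w | (i < size (x w))%N /\ A (nth point (x w) i)])] >>.

(* [E w i j], for i < j < size (x w), is the number of edges between the
   vertices i and j.  The displayed identity says that the conditional joint
   law of these numbers given x is the product of the laws
   Po (kappa (x_i, x_j) / n). *)
Definition is_GV (P : probability T R) (x : T -> seq S) (n : nat)
    (kappa : S * S -> R) (E : T -> nat -> nat -> nat) :=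
  (forall i j k,
     measurable [set w | (i < j < size (x w))%N /\ E w i j = k]) /\
  forall (B : set T) (N : nat) (m : nat -> nat -> nat), sigma_seq x B ->
    P (B `&` [set w | size (x w) = N /\
                forall i j, (i < j < N)%N -> E w i j = m i j]) =
    (\int[P]_(w in B `&` [set w | size (x w) = N])
       \prod_(i < N) \prod_(j < N | (i < j)%N)
         Po (kappa (nth point (x w) i, nth point (x w) j) / n%:R)
            [set m i j])%E.

End random_sequence.

Definition num_edges (N : nat) (E : nat -> nat -> nat) : nat :=
  \sum_(i < N) \sum_(j < N | (i < j)%N) E i j.

Definition empirical {R : realType} {S : pmetricType R} (n : nat) (x : seq S) :
    {measure set (borel S) -> \bar R} :=
  mscale (n%:R^-1)%:nng
    (msum (fun i => \d_(nth point x i : borel S)) (size x)).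

Section conditions.
Context {R : realType} {S : pmetricType R}.
Variable mu : {finite_measure set (borel S) -> \bar R}.
Context {d : nat -> measure_display} {T : forall n, measurableType (d n)}.
Variables (P : forall n, probability (T n) R) (x : forall n, T n -> seq S).
Variable kappa : S * S -> R.

(* Convergence in probability for the weak topology: the finite families [f]
   give the basic neighbourhoods of [mu]. *)
Definition empirical_cvg_weak :=
  forall (m : nat) (f : 'I_m -> S -> R) (eps : R),
    (forall i, continuous (f i)) ->
    (forall i, exists C, forall s, `|f i s| <= C) -> 0 < eps ->
    P n [set w | exists i, eps <= `| \int[empirical n (x w)]_s f i s
                                     - \int[mu]_s f i s |]
      @[n --> \oo] --> 0%E.

(* The same convergence in terms of mu-continuity sets. *)
Definition empirical_cvg_sets :=
  forall A : set (borel S), measurable A -> mu (boundary (A : set S)) = 0%E ->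
    cvg_in_prob P (fun n w => fine (empirical n (x w) A)) (fine (mu A)).

Record GV_conditions : Prop := {
  kappa_sym : forall s t, kappa (s, t) = kappa (t, s) ;
  kappa_ge0 : forall p, 0 <= kappa p ;
  kappa_borel : measurable_fun [set: borel S * borel S] kappa ;
  GV_separable : separable S ;
  GV_mu : (0 < mu setT < +oo)%E ;
  GV_random : forall n, (0 < n)%N -> random_seq (@x n) ;
  GV_cvg : empirical_cvg_weak ;
  GV_cvg_sets : empirical_cvg_sets ;
  GV_kappa_ae : {ae (mu \x mu)%E, forall p : borel S * borel S,
                  {for (p : S * S), continuous kappa}} ;
  GV_kappa_L1 : (mu \x mu)%E.-integrable setT (EFin \o kappa) ;
  (* for every realization E_n of the edges of the graphs *)
  GV_edges : forall E : forall n, T n -> nat -> nat -> nat,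
    (forall n, (0 < n)%N -> is_GV (P n) (@x n) n kappa (E n)) ->
    ((n%:R^-1)%:E *
       'E_(P n)[fun w => (num_edges (size (x w)) (E n w))%:R])%E
      @[n --> \oo] -->
    ((2^-1)%:E * \int[mu \x mu]_p (kappa p)%:E)%E
}.

End conditions.

(** * The circle of length beta *)

(* A point is represented by its coordinate in [0, beta[. *)
Record circle (R : realType) (beta : {posnum R}) :=
  Circle { circle_val :> R ; _ : 0 <= circle_val < beta%:num }.

Section circle.
Context {R : realType} {beta : {posnum R}}.
Local Notation b := (beta%:num).

HB.instance Definition _ := [isSub for @circle_val R beta].
HB.instance Definition _ := [Choice of circle beta by <:].

Lemma circle0_subproof : 0 <= (0 : R) < b.
Proof. by rewrite lexx /=. Qed.

HB.instance Definition _ := isPointed.Build (circle beta)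
  (Circle circle0_subproof).

Lemma circle_bounds (x : circle beta) : 0 <= (x : R) /\ (x : R) < b.
Proof. by case: x => x /= /andP[]. Qed.

Definition circle_dist (x y : circle beta) : R :=
  Num.min `|(x : R) - (y : R)| (b - `|(x : R) - (y : R)|).

Lemma circle_distxx x : circle_dist x x = 0.
Proof. by rewrite /circle_dist subrr normr0 subr0 min_l. Qed.

Lemma circle_dist_eq0 x y : circle_dist x y = 0 -> x = y.
Proof.
move=> xy; apply/val_inj => /=.
have [x0 xb] := circle_bounds x; have [y0 yb] := circle_bounds y.
move: xy; rewrite /circle_dist minEle; case: ifPn => [_ /normr0_eq0|_].
  lra.
by case: (lerP (y : R) (x : R)) => ?; lra.
Qed.

Lemma circle_distC x y : circle_dist x y = circle_dist y x.
Proof. by rewrite /circle_dist distrC. Qed.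

Lemma circle_dist_triangle y x z :
  circle_dist x z <= circle_dist x y + circle_dist y z.
Proof.
have [x0 xb] := circle_bounds x; have [y0 yb] := circle_bounds y.
have [z0 zb] := circle_bounds z.
have xyz := ler_distD (y : R) (x : R) (z : R).
have xzy := ler_distD (z : R) (x : R) (y : R).
have yxz := ler_distD (x : R) (y : R) (z : R).
rewrite (distrC (z : R)) in xzy; rewrite (distrC (y : R) (x : R)) in yxz.
have per : `|(x : R) - (z : R)| + `|(x : R) - (y : R)| + `|(y : R) - (z : R)|
    <= 2 * b.
  by case: (lerP (z : R) (x : R)) => ?; case: (lerP (y : R) (x : R)) => ?;
     case: (lerP (z : R) (y : R)) => ?; lra.
rewrite /circle_dist; move: xyz xzy yxz per.
move: `|(x : R) - (z : R)| `|(x : R) - (y : R)| `|(y : R) - (z : R)| => p q r *.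
by rewrite !minEle; do 3 (case: ifPn; rewrite -?ltNge => ?); lra.
Qed.

HB.instance Definition _ := isMetric.Build R (circle beta)
  circle_distxx circle_dist_eq0 circle_distC circle_dist_triangle.

(* |A|, for A Borel. *)
Definition circle_length (A : set (circle beta)) : R :=
  fine (lebesgue_measure (@circle_val R beta @` A)).

(* Clockwise distance from x to y, in ]0, beta]; it is beta for y = x. *)
Definition cw_dist (x y : circle beta) : R :=
  if (x : R) < (y : R) then (y : R) - (x : R) else (y : R) - (x : R) + b.

End circle.

(** * Poisson processes on the circle *)

Section poisson_process.
Context {R : realType} {beta : {posnum R}} {d} {T : measurableType d}.

Definition npts (A : set (circle beta)) : nat := #|` fset_set A|.

Definition sigma_process (X : T -> set (circle beta)) : set (set T) :=
  <<s [set E | exists (A : set (borel (circle beta))) k, measurable A /\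
                 E = [set w | npts (X w `&` A) = k]] >>.

(* The process is identified with its set of points: its intensity being
   diffuse, it has no multiple points. *)
Definition poisson_process (P : probability T R) (c : R)
    (X : T -> set (circle beta)) :=
  [/\ forall w, finite_set (X w),
      forall A : set (borel (circle beta)), measurable A ->
        measurable_fun setT (fun w => npts (X w `&` A)),
      forall (A : set (borel (circle beta))) k, measurable A ->
        P [set w | npts (X w `&` A) = k] = Po (c * circle_length A) [set k]
    & forall (m : nat) (A : 'I_m -> set (borel (circle beta)))
        (k : 'I_m -> nat),
        (forall i, measurable (A i)) -> trivIset setT A ->
        P [set w | forall i, npts (X w `&` A i) = k i] =
        (\prod_(i < m) P [set w | npts (X w `&` A i) = k i])%E].

End poisson_process.

(** * The space of open intervals of the circle *)

Record arc_len (R : realType) (beta : {posnum R}) :=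
  ArcLen { arc_len_val :> R ; _ : 0 < arc_len_val < beta%:num }.

HB.instance Definition _ (R : realType) (beta : {posnum R}) :=
  [isSub for @arc_len_val R beta].
HB.instance Definition _ (R : realType) (beta : {posnum R}) :=
  [Choice of arc_len beta by <:].

(* [None] is the class of the intervals of full length; [Some (x, l)] is the
   open arc with left endpoint x and length l < beta. *)
Definition arc_space (R : realType) (beta : {posnum R}) : Type :=
  option (circle beta * arc_len beta).

Section arc.
Context {R : realType} {beta : {posnum R}}.
Local Notation b := (beta%:num).

HB.instance Definition _ := Choice.copy (arc_space beta)
  (option (circle beta * arc_len beta)).
HB.instance Definition _ := isPointed.Build (arc_space beta) None.

(* The maximum metric of the product on the arcs of length < beta, which are
   all at distance beta from the full circle. *)
Definition arc_dist (I J : arc_space beta) : R :=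
  match I, J with
  | None, None => 0
  | Some (x, l), Some (y, m) => Num.max (circle_dist x y) `|(l : R) - (m : R)|
  | _, _ => b
  end.

Lemma arc_len_bounds (l : arc_len beta) : 0 < (l : R) /\ (l : R) < b.
Proof. by case: l => l /= /andP[]. Qed.

Lemma circle_dist_bounds (x y : circle beta) :
  0 <= circle_dist x y /\ circle_dist x y <= b.
Proof.
have [x0 xb] := circle_bounds x; have [y0 yb] := circle_bounds y.
rewrite /circle_dist minEle.
by case: (lerP (y : R) (x : R)) => ?; case: ifPn; rewrite -?ltNge => ?; lra.
Qed.

Lemma arc_distxx I : arc_dist I I = 0.
Proof.
by case: I => [[x l]|] //=; rewrite circle_distxx subrr normr0 maxxx.
Qed.

Lemma arc_dist_eq0 I J : arc_dist I J = 0 -> I = J.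
Proof.
have bn0 : b != 0 by [].
case: I J => [[x l]|] [[y m]|] //=; [|by move/eqP; rewrite (negPf bn0)..].
have [xy0 _] := circle_dist_bounds x y => /eqP.
rewrite eq_le ge_max => /andP[/andP[xy lm] _].
have -> : x = y by apply: circle_dist_eq0; apply/eqP; rewrite eq_le xy.
move: lm; rewrite normr_le0 subr_eq0 => /eqP lm.
by have -> : l = m by exact/val_inj.
Qed.

Lemma arc_distC I J : arc_dist I J = arc_dist J I.
Proof.
by case: I J => [[x l]|] [[y m]|] //=; rewrite circle_distC distrC.
Qed.

Lemma arc_dist_triangle J I K : arc_dist I K <= arc_dist I J + arc_dist J K.
Proof.
have b0 : 0 < b by [].
have max_ge0 x y (l m : arc_len beta) :
    0 <= Num.max (circle_dist x y) `|(l : R) - (m : R)|.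
  by rewrite le_max normr_ge0 orbT.
case: I J K => [[x l]|] [[y m]|] [[z k]|] //=; rewrite ?addr0 ?add0r //.
- rewrite ge_max; apply/andP; split.
  + by rewrite (le_trans (circle_dist_triangle y x z))// lerD// le_max lexx.
  + by rewrite (le_trans (ler_distD (m : R) _ _))// lerD// le_max lexx orbT.
- by rewrite lerDr.
- have [_ ?] := circle_dist_bounds x z.
  have [? ?] := arc_len_bounds l; have [? ?] := arc_len_bounds k.
  by rewrite ge_max; apply/andP; split; [lra|rewrite ler_norml; lra].
- by rewrite lerDl.
Qed.

HB.instance Definition _ := isMetric.Build R (arc_space beta)
  arc_distxx arc_dist_eq0 arc_distC arc_dist_triangle.

Definition arc_set (I : arc_space beta) : set (circle beta) :=
  if I is Some (x, l) then [set y | cw_dist x y < (l : R)] else setT.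

Definition kappa (p : arc_space beta * arc_space beta) : R :=
  circle_length (arc_set p.1 `&` arc_set p.2).

(* The open interval of length l with left endpoint x; full for l = beta. *)
Definition mk_arc (x : circle beta) (l : R) : arc_space beta :=
  omap (pair x) (insub l).

(* Clockwise distance from x to the next hole (beta if x is the only hole). *)
Definition gap (H : set (circle beta)) (x : circle beta) : R :=
  \big[Num.min/b]_(y <- fset_set H) cw_dist x y.

(* The intervals into which a finite set H of holes splits the circle, by
   increasing coordinate of their left endpoints. *)
Definition intervals (H : set (circle beta)) : seq (arc_space beta) :=
  if fset_set H == fset0 then [:: None]
  else [seq mk_arc x (gap H x) |
         x <- sort (fun x y : circle beta => (x : R) <= (y : R)) (fset_set H)].

End arc.

(** * The quantum random graph *)

Section quantum_graph.
Context {R : realType} {beta : {posnum R}} {d} {T : measurableType d}.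
Variables (P : probability T R) (lambda : R) (n : nat).
(* The unordered pairs {i, j} are the sets of cardinality 2. *)
Variables (H : 'I_n -> T -> set (circle beta)).
Variables (L : {set 'I_n} -> T -> set (circle beta)).

Definition quantum_processes :=
  [/\ forall i, poisson_process P lambda (H i),
      forall e : {set 'I_n}, #|e| = 2%N -> poisson_process P (n%:R^-1) (L e)
    & mutual_indep P
        [set z : 'I_n + {set 'I_n} | if z is inr e then #|e| == 2%N else true]
        (fun z => match z with
                  | inl i => sigma_process (H i)
                  | inr e => sigma_process (L e)
                  end)].

Definition vertices (w : T) : seq ('I_n * arc_space beta) :=
  [seq (i, J) | i <- enum 'I_n, J <- intervals (H i w)].

Definition vertex_types (w : T) : seq (arc_space beta) :=
  [seq v.2 | v <- vertices w].

(* The interval as a set of points of the circle i: when there is exactly one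
   hole, it is the circle minus that hole, although its class is [None]. *)
Definition vertex_set (w : T) (v : 'I_n * arc_space beta) : set (circle beta) :=
  arc_set v.2 `\` H v.1 w.

Definition edges_between (w : T) (u v : 'I_n * arc_space beta) : nat :=
  if u.1 == v.1 then 0%N
  else npts (L [set u.1; v.1]%SET w `&` vertex_set w u `&` vertex_set w v).

(* Number of edges between the vertices of ranks k and l. *)
Definition quantum_edges (w : T) (k l : nat) : nat :=
  match onth (vertices w) k, onth (vertices w) l with
  | Some u, Some v => edges_between w u v
  | _, _ => 0%N
  end.

End quantum_graph.

(* Main.v *)
(** The law of a Poisson process on the circle, as a random element of the space
    of finite sets with the sigma-algebra generated by the counts, is determined
    by its finite-dimensional laws, so all the circles carry i.i.d. copies of the
    holes that define mu.  The interval of a given rank is a measurable function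
    of the holes, and so is the number of intervals M*, with E M*^2 < oo.

    For f bounded and measurable, n mu_n(f) is the sum over the circles of the
    i.i.d. variables sum_J f(J), where J runs over the intervals of the circle;
    their mean is mu(f) and their variance is finite, so Chebyshev's inequality
    gives both forms of mu_n -> mu.

    kappa is Lipschitz, hence continuous: a point of one arc but not of another
    one lies near an end of the first.  The intervals of a circle partition it up
    to a finite set, so sum_J kappa(I, J) = |I| over the intervals J of each
    circle.  Hence the integral of kappa is beta, and the sum of kappa over the
    pairs of vertices is the constant beta n(n-1)/2, which gives the expected
    number of edges.

    For fixed holes, the numbers of edges between the vertices of the circles i
    and j count the points of L_ij in disjoint sets of lengths kappa(x_k, x_l).
    Since the links are independent of the holes, Fubini's theorem turns this into
    the conditional law given the holes. *)

From HB Require Import structures.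
Require Import Defs.
From mathcomp Require Import all_boot all_order all_algebra.
From mathcomp Require Import finmap.
From mathcomp Require Import ring lra.
From mathcomp Require Import all_classical all_reals all_analysis.
From mathcomp Require Import measurable_realfun.

Set Implicit Arguments.
Unset Strict Implicit.
Unset Printing Implicit Defensive.

Import Order.TTheory GRing.Theory Num.Theory.
Import numFieldNormedType.Exports.

Local Open Scope classical_set_scope.
Local Open Scope ring_scope.

(** The main obstacle is measurability: the number of intervals is random, and an interval of given
    rank jumps when holes cross the origin of coordinates. Everything is therefore cut along a
    countably valued map, the number of holes or the vector of the numbers of intervals of the
    circles, on each fibre of which ranks, gaps and endpoints have one fixed formula. Positions are
    reached from counts through order statistics: the hole of rank k lies below t iff more than k
    holes do.

    The probability spaces may change with n, so the convergences rest on explicit bounds for each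
    fixed n. The limit of the expected number of edges is required for every realization of the
    edges with the prescribed conditional law, not only for the quantum graph. It is hence derived
    from that law alone, which gives the joint law of the counts of all pairs of vertices at a given
    size; a single pair is isolated by summing out the others. *)

Definition pushm {d d'} {T : measurableType d} {T' : measurableType d'}
    {R : realFieldType} (m : {measure set T -> \bar R}) (f : T -> T')
    (mf : measurable_fun setT f) : {measure set T' -> \bar R} :=
  measure_function_pushforward__canonical__measure_function_Measure m mf.

Lemma pushmE {d d'} {T : measurableType d} {T' : measurableType d'}
    {R : realFieldType} (m : {measure set T -> \bar R}) (f : T -> T')
    (mf : measurable_fun setT f) (A : set T') : pushm m mf A = m (f @^-1` A).
Proof. by []. Qed.

Lemma integral_pushm {d d'} {T : measurableType d} {T' : measurableType d'}
    {R : realType} (m : {measure set T -> \bar R}) (f : T -> T')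
    (mf : measurable_fun setT f) (g : T' -> \bar R) :
  measurable_fun setT g -> (forall x, 0 <= g x)%E ->
  (\int[pushm m mf]_x g x = \int[m]_x g (f x))%E.
Proof. by move=> mg g0; rewrite ge0_integral_pushforward //= preimage_setT. Qed.

(** * Measurability along countable decompositions *)

Lemma countable_bigcup_measurable {d} {T : measurableType d} {U : Type}
    (D : set U) (F : U -> set T) :
  countable D -> (forall i, D i -> measurable (F i)) ->
  measurable (\bigcup_(i in D) F i).
Proof.
move=> /pfcard_geP[->|[f]] mF; first by rewrite bigcup_set0.
rewrite (_ : \bigcup_(i in D) F i = \bigcup_n F (f n)).
  by apply: bigcupT_measurable => n; apply: mF; exact: funS.
apply/seteqP; split => [x [i Di Fi]|x [n _ Fn]].
  by have [n _ fn] := @surj _ _ _ _ f i Di; exists n => //; rewrite fn.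
by exists (f n) => //; exact: funS.
Qed.

(** This handles objects of random size: on a fibre of [f], typically the number of holes or of
    vertices, the size is a constant and a single formula describes the set. *)
Lemma measurable_countable_split {d} {T : measurableType d} {C : countType}
    (f : T -> C) (A : set T) :
  (forall c, measurable (f @^-1` [set c] `&` A)) -> measurable A.
Proof.
move=> mA; rewrite (_ : A = \bigcup_(c in [set: C]) (f @^-1` [set c] `&` A)).
  by apply: countable_bigcupT_measurable => // [|c]; exact: countableP.
by apply/seteqP; split=> [w Aw|w [c _ []]//]; exists (f w).
Qed.

Lemma measurable_fun_lt {d} {T : measurableType d} {R : realType} (f : T -> R) :
  (forall r, measurable [set w | f w < r]) -> measurable_fun setT f.
Proof.
move=> mf; apply: (measurability _ (RGenInftyO.measurableE R)).
move=> _ [_ [r ->] <-]; rewrite setTI.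
by rewrite (_ : _ @^-1` _ = [set w | f w < r]) //; apply/seteqP; split => w /=;
  rewrite in_itv.
Qed.

Lemma measurable_fun_natP {d} {T : measurableType d} (f : T -> nat) :
  (forall k, measurable (f @^-1` [set k])) -> measurable_fun setT f.
Proof.
move=> mf _ Y _; rewrite setTI; apply: (measurable_countable_split (f := f)) => c.
have [Yc|Yc] := pselect (Y c).
  rewrite (_ : _ `&` _ = f @^-1` [set c]) //.
  by apply/seteqP; split => [w []//|w /= fw]; split=> //=; rewrite fw.
rewrite (_ : _ `&` _ = set0) //.
by apply/seteqP; split => // w [/= ->].
Qed.

Lemma metric_ball_open {R : realType} {S : metricType R} (x : S) (r : R) :
  open (ball x r).
Proof.
rewrite openE => y; rewrite {1}ballEmdist /= => xy.
apply/nbhs_ballP; exists (r - mdist x y) => /=; first by rewrite subr_gt0.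
move=> z; rewrite !ballEmdist /= => yz.
by rewrite (le_lt_trans (metric_triangle x y z))// -ltrBrDl.
Qed.

(** * Measurability in separable metric spaces *)

Section separable_metric.
Context {R : realType} {S : pmetricType R} (D : set S).
Hypotheses (cD : countable D) (dD : dense D).

Lemma open_bigcup_balls (U : set S) : open U ->
  U = \bigcup_(p in [set p : S * rat | D p.1 /\
        ball p.1 (ratr p.2 : R) `<=` U]) ball p.1 (ratr p.2 : R).
Proof.
move=> oU; apply/seteqP; split => [x Ux|x [p [_ pU]] px]; last exact: pU.
have /nbhs_ballP[e /= e0 xU] := open_nbhs_nbhs (conj oU Ux).
have [q] := @rat_in_itvoo R 0 (e / 2) (divr_gt0 e0 (ltr0Sn _ _)).
rewrite in_itv /= => /andP[q0 qe].
have [y [xy Dy]] : ball x (ratr q : R) `&` D !=set0.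
  by apply: dD; [exists x; exact: ballxx|exact: metric_ball_open].
exists (y, q) => /=; last exact: ball_sym.
split=> // z yz; apply: xU; apply: le_ball (ball_triangle xy yz).
by rewrite (splitr e) lerD // ltW.
Qed.

(** An open set is a countable union of balls centred in [D], so it is enough to test distances to
    the points of [D]. For points and arcs of the circle these distances are explicit functions of
    real coordinates. *)
Lemma measurable_fun_borel {d} {T : measurableType d} (f : T -> borel S) :
  (forall s r, D s -> measurable [set w | mdist s (f w) < r]) ->
  measurable_fun setT f.
Proof.
move=> mf; apply: (measurability (@open S : set (set (borel S)))) => //.
move=> _ [U oU <-]; rewrite setTI (open_bigcup_balls oU) preimage_bigcup.
apply: countable_bigcup_measurable => [|[s q] [/= Ds _]].
  apply: (@sub_countable _ _ _ (D `*` [set: rat])).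
    by apply: subset_card_le => p [].
  by apply: countableX => //; exact: countableP.
by rewrite ballEmdist; exact: mf.
Qed.

Lemma mdist_measurable (s : S) : measurable_fun setT (mdist s : borel S -> R).
Proof.
apply: measurable_fun_lt => r; apply: sub_sigma_algebra.
have -> : [set w | mdist s w < r] = ball s r by rewrite ballEmdist.
exact: metric_ball_open.
Qed.

Lemma continuous_measurable_borel (f : S -> R) : continuous f ->
  measurable_fun setT (f : borel S -> R).
Proof.
move=> /continuousP cf; apply: measurable_fun_lt => r; apply: sub_sigma_algebra.
have -> : [set w | f w < r] = f @^-1` [set x | x < r] by [].
exact/cf/open_lt.
Qed.

(* A Lipschitz function is the countable infimum of k(d, t) + C dist(s, d). *)
Lemma lipschitz_measurable (C : R) (k : S * S -> R) : 0 <= C ->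
  (forall s s' t, k (s, t) <= k (s', t) + C * mdist s s') ->
  (forall s, measurable_fun setT (fun t : borel S => k (s, t))) ->
  measurable_fun [set: borel S * borel S] k.
Proof.
move=> C0 kC mk; apply: measurable_fun_lt => r.
rewrite (_ : [set w | _] = \bigcup_(s in D)
  [set w : borel S * borel S | k (s, w.2) + C * mdist s w.1 < r]).
  apply: countable_bigcup_measurable => // s _.
  have mf : measurable_fun [set: borel S * borel S]
      (fun w => k (s, w.2) + C * mdist s w.1).
    apply: measurable_funD; first exact: (measurableT_comp (mk s) measurable_snd).
    apply: measurable_funM => //.
    exact: (measurableT_comp (mdist_measurable s) measurable_fst).
  rewrite (_ : [set w | _] = setT `&` (fun w : borel S * borel S =>
    k (s, w.2) + C * mdist s w.1) @^-1` [set` `]-oo, r[ ]); first exact: mf.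
  by rewrite setTI; apply/seteqP; split=> w /=; rewrite in_itv.
apply/seteqP; split => [[s t] /= kr|[s t] [s' _] /= kr]; last first.
  by apply: le_lt_trans kr; rewrite metric_sym; exact: kC.
(* Replacing [s] by a point at distance less than [e] costs [C * e] twice, once in [k] and once in
   the penalty term; the added 1 keeps the divisor positive when [C] is 0. *)
pose e := (r - k (s, t)) / (2 * C + 1).
have C1 : 0 < 2 * C + 1 by lra.
have e0 : 0 < e by rewrite divr_gt0 ?subr_gt0.
have [s' [ss' Ds']] : ball s e `&` D !=set0.
  by apply: dD; [exists s; exact: ballxx|exact: metric_ball_open].
exists s' => //=; move: ss'; rewrite ballEmdist /= => ss'.
have := kC s' s t; rewrite (metric_sym s' s) => ks'.
have : (2 * C + 1) * e = r - k (s, t) by rewrite mulrC divfK // gt_eqF.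
have : C * mdist s s' <= C * e by rewrite ler_wpM2l // ltW.
lra.
Qed.

End separable_metric.

(** * Lengths of arcs *)

Section circle_measure.
Context {R : realType} {beta : {posnum R}}.
Local Notation b := (beta%:num).

(** Inverse of the coordinate map, made total by sending every real outside [[0, beta[] to the point
    of coordinate 0. *)
Definition to_circle (x : R) : circle beta := insubd (point : circle beta) x.

Lemma circle_valK : cancel (@circle_val R beta) to_circle.
Proof. by move=> x; exact: valKd. Qed.

Lemma to_circleK (x : R) : 0 <= x -> x < b -> (to_circle x : R) = x.
Proof. by move=> x0 xb; rewrite [LHS]insubdK // -topredE /= x0. Qed.

Lemma circle_dense : exists2 D : set (circle beta), countable D & dense D.
Proof.
exists (to_circle @` (@ratr R @` setT)).
  by do 2 apply: (sub_countable (card_image_le _ _)); exact: countableP.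
move=> U [y Uy] oU; pose x : circle beta := y; have Ux : U x := Uy.
have /nbhs_ballP[e /= e0 xU] := open_nbhs_nbhs (conj oU Ux).
have [x0 xb] := circle_bounds x.
(* The rational is sought to the right of [x] and below beta: there is always room for it, and it is
   then the coordinate of a point. *)
have xe : (x : R) < Num.min b ((x : R) + e) by rewrite lt_min xb ltrDl.
have [q] := rat_in_itvoo xe.
rewrite in_itv /= lt_min => /andP[xq /andP[qb qe]].
exists (to_circle (ratr q)); split; last by exists (ratr q) => //; exists q.
apply: xU; rewrite ballEmdist /=.
suff: circle_dist x (to_circle (ratr q)) < e by [].
rewrite /circle_dist to_circleK //; last by lra.
by rewrite gt_min ltr_norml; apply/orP; left; lra.
Qed.

(** The coordinate jumps at 0, so it is not continuous for the circle metric. It is still a Borel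
    function of two distances: the one to beta/2 determines [x] up to the reflection exchanging [x]
    and [beta - x], and the one to beta/4 tells which half contains [x]. *)
Lemma circle_val_measurable :
  measurable_fun setT (@circle_val R beta : borel (circle beta) -> R).
Proof.
have b0 : 0 < b by [].
have qb : 0 <= b / 4 < b by lra.
have hb : 0 <= b / 2 < b by lra.
pose d4 : borel (circle beta) -> R := mdist (Circle qb).
pose d2 : borel (circle beta) -> R := mdist (Circle hb).
have m4 : measurable_fun setT d4 by exact: mdist_measurable.
have m2 : measurable_fun setT d2 by exact: mdist_measurable.
(* A coordinate is recovered from the distances to b/4 and b/2. *)
rewrite (_ : @circle_val R beta =
    fun x => if d4 x <= b / 4 then b / 2 - d2 x else b / 2 + d2 x).
  by apply: measurable_fun_ifT; [exact: measurable_fun_ler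
    |exact: measurable_funB|exact: measurable_funD].
apply/funext => x.
have -> : d4 x = circle_dist (Circle qb) x by [].
have -> : d2 x = circle_dist (Circle hb) x by [].
have [x0 xb] := circle_bounds x.
have mc (p q : R) : (Num.min p q = p /\ p <= q) \/ (Num.min p q = q /\ q <= p).
  by case: (lerP p q) => pq; [left|right]; split => //; exact: ltW.
rewrite /circle_dist /=.
by case: (lerP (x : R) (b / 4)) => ?; case: (lerP (x : R) (b / 2)) => ?;
  match goal with |- context [Num.min ?p ?q <= _] => case: (mc p q) => -[-> ?] end;
  match goal with |- context [Num.min ?p ?q] => case: (mc p q) => -[-> ?] end;
  case: ifPn; rewrite -?ltNge => ?; lra.
Qed.

Lemma to_circle_measurable :
  measurable_fun setT (to_circle : R -> borel (circle beta)).
Proof.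
have [D cD dD] := circle_dense.
apply: (measurable_fun_borel cD dD) => s r _.
pose c (x : R) := if (0 <= x) && (x < b) then x else 0.
have cE x : to_circle x = c x :> R.
  rewrite /c; case: ifPn => [/andP[? ?]|xb]; first exact: to_circleK.
  by rewrite /to_circle /insubd insubN.
have mc : measurable_fun setT c.
  by apply: measurable_fun_ifT => //; apply: measurable_and;
    [exact: measurable_fun_ler|exact: measurable_fun_ltr].
have mf : measurable_fun setT (fun x => Num.min `|(s : R) - c x| (b - `|(s : R) - c x|)).
  by apply: measurable_minr; [|apply: measurable_funB => //];
   apply: measurableT_comp => //; exact: measurable_funB.
rewrite (_ : [set w | _] = setT `&` (fun x => Num.min `|(s : R) - c x| (b - `|(s : R) - c x|)) @^-1` [set` `]-oo, r[ ]); first exact: mf.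
rewrite setTI; apply/seteqP; split=> w /=; rewrite in_itv /= -cE //.
Qed.

(** Realizes [circle_length] as a measure: Lebesgue measure on [[0, beta[] is carried to the circle,
    so that additivity and monotonicity come for free. *)
Definition circle_measure : {measure set (borel (circle beta)) -> \bar R} :=
  pushm (mrestr lebesgue_measure (measurable_itv `[0 : R, b[))
    (to_circle_measurable :
       measurable_fun setT (to_circle : measurableTypeR R -> borel (circle beta))).

Lemma circle_measureE (A : set (circle beta)) :
  circle_measure A = lebesgue_measure (@circle_val R beta @` A).
Proof.
rewrite pushmE /mrestr; congr (lebesgue_measure _); apply/seteqP; split.
  move=> x [/= Ax]; rewrite in_itv /= => /andP[x0 xb].
  by exists (to_circle x) => //; exact: to_circleK.
move=> _ [x Ax <-]; have [x0 xb] := circle_bounds x.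
by split => /=; rewrite ?circle_valK // in_itv /= x0.
Qed.

Lemma circle_lengthE (A : set (circle beta)) :
  circle_length A = fine (circle_measure A).
Proof. by rewrite circle_measureE. Qed.

Lemma circle_measureT : circle_measure setT = b%:E.
Proof.
rewrite circle_measureE (_ : _ @` _ = `[0 : R, b[%classic).
  by rewrite lebesgue_measure_itv /= lte_fin ifT // sube0.
apply/seteqP; split=> [_ [x _ <-] /=|x /=]; rewrite in_itv /=.
  by have [-> ->] := circle_bounds x.
by move=> /andP[x0 xb]; exists (to_circle x) => //; exact: to_circleK.
Qed.

Lemma circle_measure_le (A B : set (borel (circle beta))) :
  measurable A -> measurable B -> A `<=` B ->
  (circle_measure A <= circle_measure B)%E.
Proof. by move=> mA mB AB; apply: le_measure; rewrite ?inE. Qed.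

Lemma circle_measure_fin (A : set (borel (circle beta))) :
  measurable A -> circle_measure A \is a fin_num.
Proof.
move=> mA; rewrite ge0_fin_numE //.
by rewrite (le_lt_trans (circle_measure_le mA measurableT (@subsetT _ _))) //
  circle_measureT ltry.
Qed.

Lemma EFin_circle_length (A : set (borel (circle beta))) : measurable A ->
  (circle_length A)%:E = circle_measure A.
Proof. by move=> mA; rewrite circle_lengthE fineK // circle_measure_fin. Qed.

Lemma measurable_circle1 (x : circle beta) :
  measurable ([set x] : set (borel (circle beta))).
Proof.
rewrite (_ : [set x] = setT `&` (@circle_val R beta : borel (circle beta) -> R) @^-1` [set (x : R)]).
  exact: circle_val_measurable.
by rewrite setTI; apply/seteqP; split=> [y ->//|y /= yx]; exact/val_inj.
Qed.

Lemma finite_circle_measurable (A : set (circle beta)) : finite_set A ->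
  measurable (A : set (borel (circle beta))).
Proof.
by move=> fA; apply: countable_measurable; [exact: measurable_circle1
  |exact: finite_set_countable].
Qed.

Lemma finite_circle_measure0 (A : set (circle beta)) : finite_set A ->
  circle_measure A = 0%E.
Proof.
move=> fA; rewrite circle_measureE; apply: countable_lebesgue_measure0.
exact/finite_set_countable/finite_image.
Qed.

Lemma circle_measureD_finite (A H : set (borel (circle beta))) :
  measurable A -> finite_set H -> circle_measure (A `\` H) = circle_measure A.
Proof.
move=> mA fH; have mH := finite_circle_measurable fH.
rewrite [RHS](measureDI _ mA mH) [X in (_ + X)%E]finite_circle_measure0 ?adde0 //.
exact: (sub_finite_set (@subIsetr _ A H)).
Qed.

Lemma cw_dist_measurable {d} {T : measurableType d} (f g : T -> R) :
  measurable_fun setT f -> measurable_fun setT g ->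
  measurable_fun setT (fun w => if f w < g w then g w - f w else g w - f w + b).
Proof.
move=> mf mg; apply: measurable_fun_ifT; first exact: measurable_fun_ltr.
  exact: measurable_funB.
by apply: measurable_funD => //; exact: measurable_funB.
Qed.

Lemma arc_set_measurable (I : arc_space beta) :
  measurable (arc_set I : set (borel (circle beta))).
Proof.
case: I => [[x l]|] /=; last exact: measurableT.
have mx : measurable_fun [set: borel (circle beta)] (fun _ => circle_val x) by [].
have := cw_dist_measurable mx circle_val_measurable.
move=> /(_ measurableT [set` `]-oo, arc_len_val l[ ] (measurable_itv _)).
rewrite setTI; congr measurable; apply/seteqP; split => y /=;
  rewrite in_itv //=.
Qed.

Lemma kappaE (p : arc_space beta * arc_space beta) :
  (kappa p)%:E = circle_measure (arc_set p.1 `&` arc_set p.2).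
Proof.
by rewrite EFin_circle_length //; apply: measurableI; exact: arc_set_measurable.
Qed.

Lemma kappaC (s t : arc_space beta) : kappa (s, t) = kappa (t, s).
Proof. by rewrite /kappa /= setIC. Qed.

Lemma kappa_nonneg (p : arc_space beta * arc_space beta) : 0 <= kappa p.
Proof. by rewrite -lee_fin kappaE. Qed.

(** If the left endpoint moves by at most [r] without passing over [y], the clockwise distance to
    [y] changes by at most [r]; since the lengths differ by at most [r], [y] is then within [2 * r]
    of the right end. If it passes over [y], then [y] is within [r] of an end. The four reals are
    the two ends and their translates by -beta, because [y] is represented in [[0, beta[] and lies
    clockwise after [x]. *)
Lemma arcD_near_end (x x' y : circle beta) (l l' : arc_len beta) (r : R) :
  circle_dist x x' <= r -> `|(l : R) - (l' : R)| <= r ->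
  cw_dist x y < (l : R) -> (l' : R) <= cw_dist x' y ->
  exists2 p : R, p \in [:: (x : R) - b; (x : R);
      (x : R) + (l : R); (x : R) + (l : R) - b] & `|(y : R) - p| <= 2 * r.
Proof.
have [x0 xb] := circle_bounds x; have [y0 yb] := circle_bounds y.
have [z0 zb] := circle_bounds x'; have [l0 lb] := arc_len_bounds l.
have [m0 mb] := arc_len_bounds l'.
move: x0 xb y0 yb z0 zb l0 lb m0 mb.
rewrite /circle_dist /cw_dist.
move: (x : R) (x' : R) (y : R) (l : R) (l' : R) => {}x {}x' {}y {}l {}l'.
move=> x0 xb y0 yb z0 zb l0 lb m0 mb.
have near p : - (2 * r) <= y - p -> y - p <= 2 * r ->
    p \in [:: x - b; x; x + l; x + l - b] ->
    exists2 p : R, p \in [:: x - b; x; x + l; x + l - b] & `|y - p| <= 2 * r.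
  by move=> p1 p2 pin; exists p => //; rewrite ler_norml p1.
rewrite ge_min ler_norml => /orP xx'; rewrite ler_norml => /andP[ll1 ll2].
have {xx'} : [\/ - r <= x - x' /\ x - x' <= r, b - r <= x - x' | b - r <= x' - x].
  case: xx' => [/andP[? ?]|xx']; first by constructor 1.
  by move: xx'; case: (lerP x' x) => ? ?; [constructor 2|constructor 3]; lra.
have near1 := near (x - b); have near2 := near x.
have near4 := near (x + l); have near5 := near (x + l - b).
move: near1 near2 near4 near5; rewrite !inE !eqxx ?orbT /=.
move=> near1 near2 near4 near5.
case=> xx'; case: ifPn; rewrite -?leNgt => xy; case: ifPn; rewrite -?leNgt => x'y cx cx'.
- by apply: near4 => //; lra.
- by apply: near2 => //; lra.
- by apply: near1 => //; lra.
- by apply: near5 => //; lra.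
- by apply: near2 => //; lra.
- by apply: near1 => //; lra.
- by apply: near5 => //; lra.
- by apply: near1 => //; lra.
- by apply: near2 => //; lra.
- by apply: near4 => //; lra.
- by apply: near1 => //; lra.
- by apply: near1 => //; lra.
Qed.

End circle_measure.

(** * Lipschitz continuity of the overlap length *)

Section kappa.
Context {R : realType} {beta : {posnum R}}.
Local Notation b := (beta%:num).
Local Notation circle_measure := (@circle_measure R beta).

Lemma circle_measure_near (p r : R) : 0 <= r ->
  (circle_measure [set y | (`|(y : R) - p| <= r)%R] <= (2 * r)%:E)%E.
Proof.
move=> r0; rewrite circle_measureE.
apply: (@le_trans _ _ (lebesgue_measure (`[p - r, p + r]%classic : set R))).
  apply: le_outer_measure => _ /= [y yp <-].
  by rewrite in_itv /=; move: yp; rewrite ler_distl.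
rewrite lebesgue_measure_itv /= lte_fin; case: ifPn => _; rewrite -?EFinB lee_fin; lra.
Qed.

Lemma near_measurable (p r : R) :
  measurable ([set y | `|(y : R) - p| <= r] : set (borel (circle beta))).
Proof.
have mf : measurable_fun setT (fun y : borel (circle beta) => `|circle_val y - p|).
  apply: measurableT_comp => //; apply: measurable_funB => //.
  exact: circle_val_measurable.
have := mf measurableT [set` `]-oo, r] ] (measurable_itv _).
by rewrite setTI; congr measurable; apply/seteqP; split => y /=; rewrite in_itv.
Qed.

(** The constant 16 is 4 times 4: four representatives of the ends, each with a neighbourhood of
    radius [2 * r] and hence of length at most [4 * r]. If exactly one of the arcs is the full
    circle, the distance is beta and the total length of the circle is a sufficient bound. *)
Lemma circle_measure_arcD (I I' : arc_space beta) :
  (circle_measure (arc_set I `\` arc_set I') <= (16 * mdist I I')%:E)%E.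
Proof.
have mD : measurable (arc_set I `\` arc_set I' : set (borel (circle beta))).
  by apply: measurableD; exact: arc_set_measurable.
have b0 : 0 < b by [].
have far : mdist I I' = b ->
    (circle_measure (arc_set I `\` arc_set I') <= (16 * mdist I I')%:E)%E.
  move=> ->; apply: le_trans (circle_measure_le mD measurableT (@subsetT _ _)) _.
  by rewrite circle_measureT lee_fin; lra.
case: I I' => [[x l]|] [[x' l']|] in mD far *; try exact: far.
  rewrite -[mdist _ _]/(Num.max (circle_dist x x') `|(l : R) - (l' : R)|).
  set r := Num.max _ _.
  have r0 : 0 <= r by rewrite le_max normr_ge0 orbT.
  pose ends := [:: (x : R) - b; (x : R); (x : R) + (l : R); (x : R) + (l : R) - b].
  pose J (p : R) : set (borel (circle beta)) := [set y | `|(y : R) - p| <= 2 * r].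
  apply: (@le_trans _ _ (circle_measure (\big[setU/set0]_(i < 4) J (nth 0 ends i)))).
    apply: circle_measure_le => //.
      by apply: bigsetU_measurable => p _; exact: near_measurable.
    move=> y [/= yx /negP]; rewrite -leNgt => yx'.
    have [||p pin yp] := arcD_near_end (r := r) _ _ yx yx'.
    - by rewrite le_max lexx.
    - by rewrite le_max lexx orbT.
    have i4 : (index p ends < 4)%N by move: pin; rewrite -index_mem.
    rewrite -bigcup_mkord_ord; exists (index p ends) => //=.
    by rewrite inordK // nth_index.
  have -> : 16 * r = \sum_(i < 4) (2 * (2 * r)) by rewrite !big_ord_recl big_ord0; lra.
  apply: (le_trans (@Boole_inequality _ _ _ circle_measure (fun i => J (nth 0 ends i)) 4 _)).
    by move=> i _; exact: near_measurable.
  rewrite -sumEFin; apply: lee_sum => p _.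
  by apply: circle_measure_near; lra.
rewrite setDv measure0 lee_fin.
by rewrite -[mdist _ _]/(0 : R) mulr0.
Qed.

Lemma kappa_lipschitz (s s' t : arc_space beta) :
  kappa (s, t) <= kappa (s', t) + 16 * mdist s s'.
Proof.
rewrite -lee_fin EFinD !kappaE /=.
have mA := arc_set_measurable.
apply: (@le_trans _ _ (circle_measure ((arc_set s' `&` arc_set t) `|`
    (arc_set s `\` arc_set s')))).
  apply: circle_measure_le; first by apply: measurableI.
    by apply: measurableU; [exact: measurableI|exact: measurableD].
  move=> y [sy ty]; have [s'y|s'y] := pselect (arc_set s' y); first by left.
  by right.
apply: le_trans (measureU2 _ _ _) _.
- exact: measurableI.
- exact: measurableD.
- by rewrite leeD2l // circle_measure_arcD.
Qed.

Lemma kappa_lipschitz2 (p q : arc_space beta * arc_space beta) :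
  `|kappa p - kappa q| <= 16 * mdist p.1 q.1 + 16 * mdist p.2 q.2.
Proof.
case: p q => [s t] [s' t'] /=.
have := kappa_lipschitz s s' t; have := kappa_lipschitz t t' s'.
have := kappa_lipschitz s' s t'; have := kappa_lipschitz t' t s.
rewrite !(kappaC _ s) !(kappaC _ s') (metric_sym s' s) (metric_sym t' t).
by rewrite ler_norml; lra.
Qed.

Lemma kappa_continuous : continuous (@kappa R beta).
Proof.
move=> p; apply/cvgrPdist_lt => e e0.
have d0 : 0 < e / 32 by lra.
exists (ball p.1 (e / 32), ball p.2 (e / 32)); first by split; exact: nbhsx_ballx.
move=> q [/=]; rewrite !ballEmdist /= => p1 p2.
by apply: le_lt_trans (kappa_lipschitz2 p q) _; lra.
Qed.

Lemma arc_dense : exists2 D : set (arc_space beta), countable D & dense D.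
Proof.
pose mk (p : rat * rat) := mk_arc (to_circle (ratr p.1)) (ratr p.2 : R) : arc_space beta.
exists (None |` (mk @` setT)).
  rewrite -bigcup2E; apply: bigcup_countable => // -[|[|n]] _ /=.
  - exact: countable1.
  - by apply: (sub_countable (card_image_le _ _)); exact: countableP.
  - exact: countable0.
move=> U [y Uy] oU; pose I : arc_space beta := y; have UI : U I := Uy.
have /nbhs_ballP[e /= e0 IU] := open_nbhs_nbhs (conj oU UI).
case: I UI IU => [[x l]|] UI IU; last by exists None; split; [|left].
have [x0 xb] := circle_bounds x; have [l0 lb] := arc_len_bounds l.
have xe : (x : R) < Num.min b ((x : R) + e) by rewrite lt_min xb ltrDl.
have le : (l : R) < Num.min b ((l : R) + e) by rewrite lt_min lb ltrDl.
have [q] := rat_in_itvoo xe; have [q'] := rat_in_itvoo le.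
rewrite !in_itv /= !lt_min => /and3P[lq qb' qe'] /and3P[xq qb qe].
have q'b : 0 < (ratr q' : R) < b by rewrite (lt_trans l0 lq).
exists (mk (q, q')); split; last by right; exists (q, q').
apply: IU; rewrite ballEmdist /= /mk /mk_arc (insubT (fun l => 0 < l < b) q'b) /=.
rewrite -[mdist _ _]/(Num.max (circle_dist x (to_circle (ratr q))) `|(l : R) - ratr q'|).
rewrite gt_max /circle_dist to_circleK ?(le_trans x0 (ltW xq)) //.
by rewrite gt_min !ltr_norml; apply/andP; split; [apply/orP; left|]; lra.
Qed.

End kappa.

(** * The intervals between finitely many holes *)

Section arcs.
Context {R : realType} {beta : {posnum R}}.
Local Notation b := (beta%:num).
Local Notation circle_measure := (@circle_measure R beta).
Implicit Types (H : set (circle beta)) (x y z : circle beta).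

Lemma lt_bigmin_seq (T : eqType) (s : seq T) (f : T -> R) (c t : R) :
  (t < \big[Num.min/c]_(i <- s) f i) = (t < c) && all (fun i => t < f i) s.
Proof.
elim: s => [|i s IHs]; first by rewrite big_nil andbT.
by rewrite big_cons lt_min IHs /= andbCA.
Qed.

Lemma seq_argmin (T : eqType) (s : seq T) (x0 : T) (f : T -> R) : x0 \in s ->
  exists2 t : T, t \in s & forall u : T, u \in s -> f t <= f u.
Proof.
elim: s x0 => // i s IHs x0 _; case: s IHs => [_|j s IHs].
  by exists i; rewrite ?inE // => z; rewrite inE => /eqP ->.
have [x xs xmin] := IHs j (mem_head _ _).
have [ix|xi] := leP (f i) (f x).
  exists i; rewrite ?mem_head // => z; rewrite inE => /predU1P[->//|zs].
  exact: le_trans (xmin z zs).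
exists x => [|z]; rewrite inE ?xs ?orbT // => /predU1P[->|]; last exact: xmin.
exact: ltW.
Qed.

Lemma lt_gap H x (t : R) : finite_set H ->
  t < gap H x <-> t < b /\ forall z, H z -> t < cw_dist x z.
Proof.
move=> fH; rewrite /gap lt_bigmin_seq; split.
  move=> /andP[-> /allP tH]; split => // z Hz; apply: tH.
  by rewrite in_fset_set // inE.
by move=> [-> tH]; apply/allP => z; rewrite in_fset_set // inE; exact: tH.
Qed.

Lemma cw_dist_bounds x y : 0 < cw_dist x y /\ cw_dist x y <= b.
Proof.
have [x0 xb] := circle_bounds x; have [y0 yb] := circle_bounds y.
by rewrite /cw_dist; case: ifPn; rewrite -?leNgt => ?; lra.
Qed.

Lemma cw_dist_lt x y : x <> y -> cw_dist x y < b.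
Proof.
move=> xy; have [x0 xb] := circle_bounds x; have [y0 yb] := circle_bounds y.
rewrite /cw_dist; case: ifPn; rewrite -?leNgt => yx; first lra.
have : (y : R) != (x : R) by apply/eqP => /val_inj yx'; exact/xy/esym.
by rewrite neq_lt => /orP[]; lra.
Qed.

Lemma gap_gt0 H x : finite_set H -> 0 < gap H x.
Proof.
by move=> fH; apply/lt_gap => //; split=> // z _; case: (cw_dist_bounds x z).
Qed.

Lemma gap_le H x : gap H x <= b.
Proof.
rewrite leNgt /gap lt_bigmin_seq ltxx //.
Qed.

(** When [l] is beta the arc is the class of full length, whose point set contains [x] itself
    although [cw_dist x x] is beta; this is why [x <> y] is assumed. *)
Lemma arc_set_mk x y (l : R) : 0 < l <= b -> x <> y ->
  arc_set (mk_arc x l) y <-> cw_dist x y < l.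
Proof.
move=> /andP[l0]; rewrite le_eqVlt => /orP[/eqP ->|lb] xy.
  rewrite /mk_arc insubF ?ltxx ?andbF //=.
  by split => // _; exact: cw_dist_lt.
have lp : 0 < l < b by rewrite l0.
by rewrite /mk_arc (insubT (fun l => 0 < l < b) lp).
Qed.

Lemma arc_gap H x y : finite_set H -> H x -> ~ H y ->
  arc_set (mk_arc x (gap H x)) y <-> cw_dist x y < gap H x.
Proof.
move=> fH Hx Hy; apply: arc_set_mk; first by rewrite gap_gt0 // gap_le.
by move=> xy; rewrite -xy in Hy.
Qed.

(** If [x] and [x'] were distinct, [y] would lie both on the arc from [x] to [x'] and on the
    complementary arc from [x'] to [x]. *)
Lemma arc_gap_inj H x x' y : finite_set H -> H x -> H x' -> ~ H y ->
  cw_dist x y < gap H x -> cw_dist x' y < gap H x' -> x = x'.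
Proof.
move=> fH Hx Hx' Hy /lt_gap[]// xb /(_ x' Hx') xx' /lt_gap[]// xb' /(_ x Hx).
have [x0 xb0] := circle_bounds x; have [y0 yb0] := circle_bounds y.
have [z0 zb0] := circle_bounds x'.
move: xx'; rewrite /cw_dist => xx' x'x; apply/val_inj => /=; apply/eqP.
apply/negPn; rewrite neq_lt; apply/negP => /orP[] xlt.
  have xlt' : ((x' : R) < (x : R)) = false by apply/negbTE; rewrite -leNgt ltW.
  by move: xx' x'x; rewrite xlt xlt'; case: ifPn; case: ifPn;
    rewrite -?leNgt => ? ?; lra.
have xlt' : ((x : R) < (x' : R)) = false by apply/negbTE; rewrite -leNgt ltW.
by move: xx' x'x; rewrite xlt xlt'; case: ifPn; case: ifPn;
  rewrite -?leNgt => ? ?; lra.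
Qed.

(** The left endpoint is the last hole before [y], found by minimizing [cw_dist x y]: a hole met
    between [x] and [y] would be closer to [y]. *)
Lemma arc_gap_cover H y : finite_set H -> H !=set0 -> ~ H y ->
  exists2 x, H x & cw_dist x y < gap H x.
Proof.
move=> fH [x0 Hx0] Hy.
have [x xin xmin] : exists2 x, x \in fset_set H &
    forall z, z \in fset_set H -> cw_dist x y <= cw_dist z y.
  apply: (@seq_argmin _ _ x0); by rewrite in_fset_set // inE.
have Hx : H x by move: xin; rewrite in_fset_set // inE.
have {}xmin z : H z -> cw_dist x y <= cw_dist z y.
  by move=> Hz; apply: xmin; rewrite in_fset_set // inE.
exists x => //; apply/lt_gap => //.
have xy : x <> y by move=> xy; apply: Hy; rewrite -xy.
split => [|z Hz]; first exact: cw_dist_lt.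
have := xmin z Hz; have := cw_dist_lt xy.
have zy : (z : R) != (y : R) by apply/eqP => /val_inj zy; apply: Hy; rewrite -zy.
have [x1 xb1] := circle_bounds x; have [y1 yb1] := circle_bounds y.
have [z1 zb1] := circle_bounds z.
rewrite /cw_dist; move: zy; rewrite neq_lt.
by case: ifPn; case: ifPn; case: ifPn; rewrite -?leNgt => ? ? ? /orP[]; lra.
Qed.

Lemma size_intervals H : finite_set H ->
  size (intervals H) = maxn (npts H) 1.
Proof.
move=> fH; rewrite /intervals /npts; case: ifPn => [/eqP ->|].
  by rewrite cardfs0.
by rewrite -cardfs_gt0 => H0; rewrite size_map size_sort (maxn_idPl _).
Qed.

Definition holes H : seq (circle beta) :=
  sort (fun x y : circle beta => (x : R) <= (y : R)) (fset_set H).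

Lemma mem_holes H x : finite_set H -> x \in holes H <-> H x.
Proof. by move=> fH; rewrite mem_sort in_fset_set // inE. Qed.

Lemma holes_uniq H : uniq (holes H).
Proof. by rewrite sort_uniq fset_uniq. Qed.

Lemma nth_intervals H k : fset_set H != fset0 -> (k < size (intervals H))%N ->
  nth None (intervals H) k = mk_arc (nth point (holes H) k) (gap H (nth point (holes H) k)).
Proof.
rewrite /intervals => /negPf ->; rewrite size_map => kH.
by rewrite (nth_map point).
Qed.

Lemma intervals_disjoint H k l y : finite_set H -> ~ H y ->
  (k < size (intervals H))%N -> (l < size (intervals H))%N ->
  arc_set (nth None (intervals H) k) y -> arc_set (nth None (intervals H) l) y ->
  k = l.
Proof.
move=> fH Hy kH lH; have [H0|H0] := eqVneq (fset_set H) fset0.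
  by move: kH lH; rewrite /intervals H0 eqxx /= !ltnS !leqn0 => /eqP -> /eqP ->.
rewrite !nth_intervals //.
have sz : size (intervals H) = size (holes H).
  by rewrite /intervals (negPf H0) size_map.
have Hk : H (nth point (holes H) k) by apply/mem_holes => //; rewrite mem_nth // -sz.
have Hl : H (nth point (holes H) l) by apply/mem_holes => //; rewrite mem_nth // -sz.
move=> /arc_gap hk /arc_gap hl.
have := arc_gap_inj fH Hk Hl Hy (hk fH Hk Hy) (hl fH Hl Hy).
by move/eqP; rewrite nth_uniq ?holes_uniq -?sz // => /eqP.
Qed.

Lemma intervals_cover H y : finite_set H -> ~ H y ->
  exists2 k, (k < size (intervals H))%N & arc_set (nth None (intervals H) k) y.
Proof.
move=> fH Hy; have [H0|H0] := eqVneq (fset_set H) fset0.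
  by exists 0%N; rewrite /intervals H0 eqxx.
have [x Hx xy] : exists2 x, H x & cw_dist x y < gap H x.
  apply: arc_gap_cover => //; apply/set0P/eqP => H0'.
  by move: H0; rewrite H0' fset_set0 eqxx.
have sz : size (intervals H) = size (holes H).
  by rewrite /intervals (negPf H0) size_map.
have xh : x \in holes H by apply/mem_holes.
exists (index x (holes H)); first by rewrite sz index_mem.
by rewrite nth_intervals ?sz ?index_mem // nth_index //; apply/arc_gap.
Qed.

Lemma sum_circle_measure_intervals H (J : set (borel (circle beta))) :
  finite_set H -> measurable J ->
  (\sum_(k < size (intervals H))
     circle_measure (arc_set (nth None (intervals H) k) `&` J) =
   circle_measure J)%E.
Proof.
move=> fH mJ; have mH := finite_circle_measurable fH.
(* Removing [H] makes the pieces an exact partition of the complement of [H] in [J]; with a single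
   hole, the class of full length would otherwise contain that hole. *)
pose B k := (arc_set (nth None (intervals H) k) `&` J) `\` H.
have mB k : measurable (B k : set (borel (circle beta))).
  apply: measurableD => //; apply: measurableI => //; exact: arc_set_measurable.
rewrite -[RHS](circle_measureD_finite mJ fH).
have -> : J `\` H = \big[setU/set0]_(k < size (intervals H)) B k.
  rewrite -bigcup_mkord; apply/seteqP; split => [y [Jy Hy]|y [k _ [[]]]//].
  by have [k kH yk] := intervals_cover fH Hy; exists k.
rewrite measure_semi_additive_ord_I //.
- apply: eq_bigr => k _; rewrite -[RHS]/(circle_measure (B k)) /B circle_measureD_finite //.
  by apply: measurableI => //; exact: arc_set_measurable.
- move=> k l /= kH lH [y [[[yk _] Hy] [[yl _] _]]].
  exact: (intervals_disjoint fH Hy).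
- by apply: bigsetU_measurable.
Qed.

Lemma sum_kappa_intervals H (J : arc_space beta) : finite_set H ->
  \sum_(I <- intervals H) kappa (I, J) = kappa (None, J).
Proof.
move=> fH; apply/EFin_inj; rewrite (big_nth None) big_mkord -sumEFin.
rewrite kappaE /= setTI -(sum_circle_measure_intervals fH (arc_set_measurable J)).
by apply: eq_bigr => k _; rewrite kappaE.
Qed.

Lemma kappaTT : kappa (None : arc_space beta, None : arc_space beta) = b.
Proof.
by apply/EFin_inj; rewrite kappaE /= setTI circle_measureT.
Qed.

Lemma sum_kappaT_intervals H : finite_set H ->
  \sum_(I <- intervals H) kappa (None, I) = b.
Proof.
move=> fH; rewrite -kappaTT -(sum_kappa_intervals None fH).
by apply: eq_bigr => I _; exact: kappaC.
Qed.

End arcs.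

Lemma measurable_fun_split {d d'} {T : measurableType d} {T' : measurableType d'}
    {C : countType} (f : T -> C) (g : T -> T') (h : C -> T -> T') :
  (forall c, measurable (f @^-1` [set c])) ->
  (forall c, measurable_fun setT (h c)) ->
  (forall w, g w = h (f w) w) -> measurable_fun setT g.
Proof.
move=> mf mh gh _ Y mY; rewrite setTI; apply: (measurable_countable_split (f := f)) => c.
rewrite (_ : _ `&` _ = f @^-1` [set c] `&` (h c @^-1` Y)).
  by apply: measurableI => //; rewrite -[X in measurable X]setTI; exact: mh.
by apply/seteqP; split=> w [/= fw]; rewrite gh fw.
Qed.

(** Order statistics expressed by counts: this turns the measurability of numbers of points into
    that of the position of the point of rank [k]. Thanks to [t <= b], the default value [b] is
    never below [t]. *)
Lemma nth_lt_count {R : realType} (s : seq R) (b t : R) (k : nat) :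
  sorted <=%R s -> t <= b ->
  (nth b s k < t) = (k < count (fun x => (x < t)%R) s)%N.
Proof.
move=> + tb; elim: s k => [k _|x s IHs k /= xs]; first by rewrite nth_nil ltNge tb ltn0.
have ss := path_sorted xs.
have [xt|tx] := ltP x t; first by case: k => [|k] //=; rewrite IHs.
have c0 : count (fun x => x < t) s = 0%N.
  apply/eqP; rewrite eqn0Ngt -has_count -all_predC.
  apply: sub_all (order_path_min le_trans xs) => y /= xy.
  by rewrite -leNgt (le_trans tx).
case: k => [|k] /=; first by rewrite c0 ltNge tx.
by rewrite IHs // c0 addn0 !ltn0.
Qed.

Lemma eq_bigmin_seq {R : realType} (T : eqType) (s s' : seq T) (f : T -> R) (c : R) :
  s =i s' -> \big[Num.min/c]_(i <- s) f i = \big[Num.min/c]_(i <- s') f i.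
Proof.
move=> ss'; suff lt_eq t : (t < \big[Num.min/c]_(i <- s) f i) =
    (t < \big[Num.min/c]_(i <- s') f i).
  apply/eqP; rewrite eq_le; apply/andP; split; rewrite leNgt.
    by rewrite lt_eq ltxx.
  by rewrite -lt_eq ltxx.
by rewrite !lt_bigmin_seq (eq_all_r ss').
Qed.

(** * Configurations of holes *)

Section configurations.
Context {R : realType} {beta : {posnum R}}.
Local Notation b := (beta%:num).

Definition cfg : Type := {fset circle beta}.
HB.instance Definition _ := Choice.on cfg.
HB.instance Definition _ := isPointed.Build cfg fset0.

Definition cfg_events : set (set cfg) :=
  [set E | exists (A : set (borel (circle beta))) k, measurable A /\
             E = [set h : cfg | npts ([set` (h : {fset circle beta})] `&` A) = k]].

Definition cfgT := g_sigma_algebraType cfg_events.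

Definition pts (h : cfgT) : set (circle beta) := [set` (h : {fset circle beta})].

Lemma pts_finite h : finite_set (pts h).
Proof. exact: finite_fset. Qed.

Lemma npts_measurable (A : set (borel (circle beta))) : measurable A ->
  measurable_fun setT (fun h => npts (pts h `&` A)).
Proof.
move=> mA; apply: measurable_fun_natP => k.
by apply: sub_sigma_algebra; exists A, k.
Qed.

(** The default value beta exceeds every coordinate, so for [t <= beta] the inequality
    [hole_coord k h < t] says exactly that more than [k] holes have a coordinate below [t]. *)
Definition hole_coord (k : nat) (h : cfgT) : R :=
  nth b [seq circle_val x | x <- holes (pts h)] k.

Lemma npts_count (h : cfgT) (A : set (circle beta)) :
  npts (pts h `&` A) = count (fun x => `[< A x >]) (holes (pts h)).
Proof.
rewrite count_sort /npts -size_filter; apply: perm_size; apply: uniq_perm.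
- exact: fset_uniq.
- by rewrite filter_uniq ?fset_uniq.
move=> x; have fh := pts_finite h.
rewrite mem_filter !in_fset_set //; last exact: finite_setIl.
by rewrite in_setI andbC.
Qed.

Lemma size_holes (h : cfgT) : size (holes (pts h)) = npts (pts h `&` setT).
Proof.
by rewrite npts_count (eq_count (a2 := predT)) ?count_predT // => x; rewrite asboolT.
Qed.

Lemma hole_coord_measurable k : measurable_fun setT (hole_coord k).
Proof.
apply: measurable_fun_lt => t.
have [tb|bt] := leP t b; last first.
  rewrite (_ : [set _ | _] = setT); first exact: measurableT.
  apply/seteqP; split => // h _ /=; rewrite /hole_coord.
  have [kh|hk] := ltnP k (size (holes (pts h))).
    rewrite (nth_map point) //; apply: lt_trans bt.
    by have [_] := circle_bounds (nth point (holes (pts h)) k).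
  by rewrite nth_default // size_map.
have mA : measurable ([set x | circle_val x < t] : set (borel (circle beta))).
  have := @circle_val_measurable R beta measurableT _ (measurable_itv `]-oo, t[).
  by rewrite setTI; congr measurable; apply/seteqP; split=> x /=; rewrite in_itv.
rewrite (_ : [set _ | _] = setT `&` (fun h => npts (pts h `&` [set x | circle_val x < t])) @^-1` [set n | (k < n)%N]).
  exact: npts_measurable.
have srt (h : cfgT) : sorted <=%R [seq circle_val x | x <- holes (pts h)].
  by rewrite sorted_map; apply: sort_sorted => x y; exact: le_total.
have cnt (h : cfgT) : count (fun x => (x < t)%R) [seq circle_val x | x <- holes (pts h)] =
    npts (pts h `&` [set x | circle_val x < t]).
  by rewrite npts_count count_map; apply: eq_count => x; rewrite /= asboolb.
rewrite setTI; apply/seteqP; split=> h /=; rewrite /hole_coord nth_lt_count // cnt //.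
Qed.

Lemma mk_arc_measurable {d} {T : measurableType d} (f g : T -> R) :
  measurable_fun setT f -> measurable_fun setT g ->
  measurable_fun setT
    (fun w => mk_arc (to_circle (f w) : circle beta) (g w) : borel (arc_space beta)).
Proof.
move=> mf mg; have [D cD dD] := @arc_dense R beta.
apply: (measurable_fun_borel cD dD) => s r _.
pose F w := if (0 < g w) && (g w < b) then
   (if s is Some (y, m) then Num.max (mdist y (to_circle (f w) : circle beta))
      `|(m : R) - g w| else b)
   else mdist s None.
have mF : measurable_fun setT F.
  apply: measurable_fun_ifT => //.
    by apply: measurable_and; exact: measurable_fun_ltr.
  case: (s) => [[y m]|] //; apply: measurable_maxr.
    apply: (measurableT_comp (mdist_measurable y)).
    exact: (measurableT_comp to_circle_measurable).
  by apply: measurableT_comp => //; exact: measurable_funB.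
have FE w : mdist s (mk_arc (to_circle (f w)) (g w)) = F w.
  rewrite /F; case: ifPn => gb; last by rewrite /mk_arc insubN.
  by rewrite /mk_arc (insubT (fun l => 0 < l < b) gb); case: (s) => [[y m]|].
have := mF measurableT _ (measurable_itv `]-oo, r[).
by rewrite setTI; congr measurable; apply/seteqP; split=> w /=; rewrite in_itv /= FE.
Qed.

Definition ivl (h : cfgT) : seq (arc_space beta) := intervals (pts h).

(** This is [gap] at the hole of rank [k] among [n] holes, with [cw_dist] unfolded on coordinates.
    With [n] fixed it is a finite minimum of measurable functions; the index [j = k] contributes
    beta. *)
Definition gap_coord (n k : nat) (h : cfgT) : R :=
  \big[Num.min/b]_(0 <= j < n) (if hole_coord k h < hole_coord j h
     then hole_coord j h - hole_coord k h
     else hole_coord j h - hole_coord k h + b).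

Lemma gap_coord_measurable n k : measurable_fun setT (gap_coord n k).
Proof.
rewrite /gap_coord; elim: (index_iota 0 n) => [|j s IHs].
  by rewrite (_ : (fun _ => _) = cst b) //; apply/funext => h; rewrite big_nil.
under eq_fun do rewrite big_cons.
apply: measurable_minr => //.
by apply: cw_dist_measurable; exact: hole_coord_measurable.
Qed.

Lemma gap_coordE (h : cfgT) n k : size (holes (pts h)) = n -> (k < n)%N ->
  gap (pts h) (nth point (holes (pts h)) k) = gap_coord n k h.
Proof.
move=> hn kn; rewrite /gap /gap_coord (eq_bigmin_seq _ _ (s' := holes (pts h))); last first.
  by move=> x; rewrite mem_sort.
rewrite (big_nth point) hn big_nat [RHS]big_nat; apply: eq_bigr => j /andP[_ jn].
by rewrite /cw_dist /hole_coord !(nth_map point) ?hn.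
Qed.

Lemma nth_ivl (h : cfgT) n k : size (holes (pts h)) = n ->
  nth None (ivl h) k =
  if (k < n)%N then mk_arc (to_circle (hole_coord k h)) (gap_coord n k h) else None.
Proof.
move=> hn; case: ifPn => kn; last first.
  rewrite /ivl /intervals; case: ifPn => [_|h0]; first by case: k kn => [|[|k]].
  by rewrite nth_default // size_map -[size _]/(size (holes (pts h))) hn leqNgt.
have h0 : fset_set (pts h) != fset0.
  apply/eqP => h0; have := size_holes h; rewrite hn setIT /npts h0 cardfs0 => n0.
  by rewrite n0 in kn.
rewrite /ivl nth_intervals //.
  by rewrite (gap_coordE hn kn) /hole_coord (nth_map point) ?hn // circle_valK.
by rewrite /intervals (negPf h0) size_map -[size _]/(size (holes (pts h))) hn.
Qed.

Lemma size_holes_measurable n :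
  measurable ((fun h : cfgT => size (holes (pts h))) @^-1` [set n]).
Proof.
rewrite (_ : _ @^-1` _ = setT `&` (fun h => npts (pts h `&` setT)) @^-1` [set n]).
  exact: npts_measurable.
by rewrite setTI; apply/seteqP; split=> h /=; rewrite size_holes.
Qed.

Lemma nth_ivl_measurable k :
  measurable_fun setT (fun h => nth None (ivl h) k : borel (arc_space beta)).
Proof.
apply: (measurable_fun_split (h := fun n h => (if (k < n)%N then
   mk_arc (to_circle (hole_coord k h)) (gap_coord n k h) else None) : borel (arc_space beta))
   size_holes_measurable) => [n|h]; last exact: nth_ivl.
case: (k < n)%N => //; apply: mk_arc_measurable; first exact: hole_coord_measurable.
exact: gap_coord_measurable.
Qed.

Lemma size_ivl_measurable : measurable_fun setT (fun h => size (ivl h)).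
Proof.
apply: (measurable_fun_split (h := fun n h => maxn n 1) size_holes_measurable) => // h.
by rewrite /ivl size_intervals ?size_holes ?setIT //; exact: pts_finite.
Qed.

End configurations.

(** * The law of a Poisson process *)

(** Countable additivity over the fibres of [f], indexed by the codes of the values so that the sum
    is a series over [nat]; a number that codes no value contributes the empty set. *)
Lemma measure_pickle {d} {T : measurableType d} {R : realType} {C : countType}
    (f : T -> C) (m : {measure set T -> \bar R}) (A : set T) :
  (forall c, measurable (f @^-1` [set c] `&` A)) ->
  m A = (\sum_(0 <= n <oo) m ([set w | choice.pickle (f w) = n] `&` A))%E.
Proof.
move=> mA.
have mn n : measurable ([set w | choice.pickle (f w) = n] `&` A).
  have [[c cn]|nc] := pselect (exists c : C, choice.pickle c = n).
    rewrite (_ : _ `&` _ = f @^-1` [set c] `&` A) //.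
    apply/seteqP; split => w [/= fw Aw]; split => //=; last by rewrite fw.
    by apply: (pcan_inj choice.pickleK); rewrite fw cn.
  rewrite (_ : _ `&` _ = set0) //; apply/seteqP; split => // w [/= fw _].
  by apply: nc; exists (f w).
rewrite -measure_semi_bigcup //.
- by congr (m _); apply/seteqP; split => [w Aw|w [n _ []]//]; exists (choice.pickle (f w)).
- by move=> i j _ _ [w [[/= <- _] [/= <-]]].
- exact: bigcupT_measurable.
Qed.

Lemma eq_measure_split {d} {T : measurableType d} {R : realType} {C : countType}
    (f : T -> C) (m m' : {measure set T -> \bar R}) (A : set T) :
  (forall c, measurable (f @^-1` [set c] `&` A)) ->
  (forall c, m (f @^-1` [set c] `&` A) = m' (f @^-1` [set c] `&` A)) ->
  m A = m' A.
Proof.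
move=> mA mm'; rewrite !(measure_pickle _ mA); apply: eq_eseriesr => n _.
have [[c cn]|nc] := pselect (exists c : C, choice.pickle c = n).
  rewrite (_ : _ `&` _ = f @^-1` [set c] `&` A) //.
  apply/seteqP; split => w [/= fw Aw]; split => //=; last by rewrite fw.
  by apply: (pcan_inj choice.pickleK); rewrite fw cn.
rewrite (_ : _ `&` _ = set0) ?measure0 //; apply/seteqP; split => // w [/= fw _].
by apply: nc; exists (f w).
Qed.

Section laws.
Context {R : realType} {beta : {posnum R}}.
Local Notation b := (beta%:num).
Local Notation cfgT := (@cfgT R beta).

Definition cfg_of {T : Type} (X : T -> set (circle beta)) (w : T) : cfgT :=
  fset_set (X w).

Lemma pts_cfg_of {T : Type} (X : T -> set (circle beta)) w :
  finite_set (X w) -> pts (cfg_of X w) = X w.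
Proof. exact: fset_setK. Qed.

Lemma cfg_of_measurable {d} {T : measurableType d} (X : T -> set (circle beta)) :
  (forall w, finite_set (X w)) ->
  (forall A : set (borel (circle beta)), measurable A ->
     measurable_fun setT (fun w => npts (X w `&` A))) ->
  measurable_fun setT (cfg_of X).
Proof.
move=> fX mX; apply: (measurability (@cfg_events R beta : set (set cfgT))) => //.
move=> _ [_ [A [k [mA ->]]] <-]; rewrite setTI.
have := mX A mA measurableT [set k] I.
rewrite setTI; congr measurable; apply/seteqP; split=> w /=;
  by rewrite -/(pts (cfg_of X w)) pts_cfg_of.
Qed.

(** This is [cfg_of_measurable] applied to [T] equipped with the sigma-algebra generated by the
    counts of [X] alone. *)
Lemma sigma_process_preimage {d} {T : measurableType d} (X : T -> set (circle beta))
    (E : set cfgT) : (forall w, finite_set (X w)) -> measurable E ->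
  sigma_process X (cfg_of X @^-1` E).
Proof.
move=> fX mE.
pose G := [set E | exists (A : set (borel (circle beta))) k, measurable A /\
                 E = [set w | npts (X w `&` A) = k]].
have mX : measurable_fun setT (cfg_of X : g_sigma_algebraType G -> cfgT).
  apply: cfg_of_measurable => // A mA; apply: measurable_fun_natP => k.
  by apply: sub_sigma_algebra; exists A, k.
by rewrite -[X in sigma_process _ X]setTI; exact: mX.
Qed.

Lemma npts_partition (h : cfgT) (F : finType) (a : circle beta -> F) (p : pred F) :
  npts (pts h `&` [set x | p (a x)]) =
  (\sum_(f | p f) npts (pts h `&` a @^-1` [set f]))%N.
Proof.
rewrite npts_count; under eq_bigr do rewrite npts_count.
elim: (holes (pts h)) => [|x s IHs] /=; first by rewrite big1.
rewrite big_split /= -IHs; congr addn.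
rewrite asboolb (eq_bigr (fun f => (a x == f) : nat)); last first.
  by move=> f _; congr nat_of_bool; apply/asboolP/eqP.
rewrite big_mkcond (bigD1 (a x)) //= eqxx big1 => [|f fa]; first by case: (p _).
by rewrite eq_sym (negPf fa) if_same.
Qed.

Section uniqueness.
Variables Q Q' : {measure set cfgT -> \bar R}.
Hypothesis Qfin : (Q setT < +oo)%E.
Hypothesis QQ' : forall (m : nat) (A : 'I_m -> set (borel (circle beta))) (k : 'I_m -> nat),
  (forall i, measurable (A i)) -> trivIset setT A ->
  Q [set h | forall i, npts (pts h `&` A i) = k i] =
  Q' [set h | forall i, npts (pts h `&` A i) = k i].

Lemma counts_measurable m (A : 'I_m -> set (borel (circle beta))) (k : 'I_m -> nat) :
  (forall i, measurable (A i)) ->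
  measurable [set h : cfgT | forall i, npts (pts h `&` A i) = k i].
Proof.
move=> mA; rewrite (_ : [set _ | _] = \bigcap_i (fun h => npts (pts h `&` A i)) @^-1` [set k i]).
  apply: fin_bigcap_measurable => [|i _]; first exact: finite_finset.
  rewrite -[X in measurable X]setTI.
  exact: npts_measurable.
by apply/seteqP; split => h /= hk => [i _|i]; exact: hk.
Qed.

(** Extends the hypothesis from disjoint to overlapping sets. The count of each [A i] is a sum of
    counts of atoms, so the event is a countable disjoint union of events that prescribe the counts
    of all atoms; the atoms are disjoint. *)
Lemma counts_eq m (A : 'I_m -> set (borel (circle beta))) (k : 'I_m -> nat) :
  (forall i, measurable (A i)) ->
  Q [set h | forall i, npts (pts h `&` A i) = k i] =
  Q' [set h | forall i, npts (pts h `&` A i) = k i].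
Proof.
move=> mA.
(* The fibers of a are the atoms of the algebra generated by the sets A i. *)
pose F : finType := {ffun 'I_m -> bool}.
pose a (x : circle beta) : F := [ffun i => `[< A i x >]].
have mB (f : F) : measurable (a @^-1` [set f] : set (borel (circle beta))).
  rewrite (_ : a @^-1` [set f] = \bigcap_i (if f i then A i else ~` A i)).
    apply: fin_bigcap_measurable => [|i _]; first exact: finite_finset.
    case: ifP => _ //.
    exact: measurableC.
  apply/seteqP; split => x /=.
    by move=> <- i _; rewrite ffunE; case: ifPn => /asboolP.
  move=> xf; apply/ffunP => i; rewrite ffunE; have := xf i Logic.I.
  by case: (f i) => Aix; apply/asboolP.
pose V (h : cfgT) : {ffun F -> nat} := [ffun f => npts (pts h `&` a @^-1` [set f])].
pose B (i : 'I_#|F|) := a @^-1` [set enum_val i].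
have VE v : V @^-1` [set v] = [set h | forall i, npts (pts h `&` B i) = v (enum_val i)].
  apply/seteqP; split => h /=; first by move=> <- i; rewrite ffunE.
  by move=> hv; apply/ffunP => f; rewrite ffunE -[f]enum_rankK -hv.
have mE := counts_measurable k mA.
set E := [set h | _] in mE *.
(* [E] is a union of fibres of [V], since the counts of the atoms determine those of the sets
   [A i]. *)
have E_V v : V @^-1` [set v] `&` E = V @^-1` [set v] \/ V @^-1` [set v] `&` E = set0.
  have [vk|vk] := pselect (forall i, (\sum_(f : F | f i) v f)%N = k i).
    left; apply/seteqP; split => [h []//|h /= hv]; split => //= i.
    rewrite -vk -hv (_ : A i = [set x | a x i]).
      by rewrite (npts_partition h a (fun f : {ffun _} => f i)); apply: eq_bigr => f _; rewrite ffunE.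
    by apply/seteqP; split => x /=; rewrite ffunE => /asboolP.
  right; apply/seteqP; split => // h [/= hv Eh]; apply: vk => i.
  rewrite -hv -Eh (_ : A i = [set x | a x i]).
    by rewrite (npts_partition h a (fun f : {ffun _} => f i)); apply: eq_bigr => f _; rewrite ffunE.
  by apply/seteqP; split => x /=; rewrite ffunE => /asboolP.
have mV v : measurable (V @^-1` [set v] `&` E).
  by apply: measurableI => //; rewrite VE; apply: counts_measurable => i; exact: mB.
apply: (eq_measure_split (f := V)) => // v.
have [->|->] := E_V v; last by rewrite !measure0.
rewrite VE; apply: QQ' => [i|i j _ _ [x [/= ai aj]]]; first exact: mB.
by apply: enum_val_inj; rewrite -ai -aj.
Qed.

(** Uniqueness of finite measures on a pi-system. The families of sets must be allowed to overlap:
    intersecting two events concatenates their families, and two disjoint families together need not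
    be disjoint. *)
Lemma law_unique (E : set cfgT) : measurable E -> Q E = Q' E.
Proof.
pose G : set (set cfgT) := [set E | exists m (A : 'I_m -> set (borel (circle beta))) k,
  (forall i, measurable (A i)) /\ E = [set h | forall i, npts (pts h `&` A i) = k i]].
have mG : measurable = <<s G >> :> set (set cfgT).
  apply/seteqP; split.
    apply: sub_smallest2r; first exact: smallest_sigma_algebra.
    move=> _ [A [k [mA ->]]]; exists 1%N, (fun=> A), (fun=> k); split => //.
    by apply/seteqP; split => h /= hk //; exact: (hk ord0).
  apply: smallest_sub; first exact: sigma_algebra_measurable.
  by move=> _ [m [A [k [mA ->]]]]; exact: counts_measurable.
apply: (measure_unique G (fun=> setT)) => //.
- move=> _ _ [m [A [k [mA ->]]]] [m' [A' [k' [mA' ->]]]].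
  exists (m + m')%N, (fun i => match fintype.split i with inl i => A i | inr i => A' i end),
    (fun i => match fintype.split i with inl i => k i | inr i => k' i end); split.
    by move=> i; case: (fintype.split i).
  apply/seteqP; split => [h [/= hk hk'] i|h /= hk]; first by case: (fintype.split i).
  split => i.
    by have := hk (unsplit (inl i)); rewrite unsplitK.
  by have := hk (unsplit (inr i)); rewrite unsplitK.
- move=> _; exists 0%N, (fun=> set0), (fun=> 0%N); split; first by case.
  by apply/seteqP; split => // h _ [].
- by rewrite bigcup_const.
- by move=> _ [m [A [k [mA ->]]]]; exact: counts_eq.
Qed.

End uniqueness.

Lemma poisson_process_law {d} {T : measurableType d} (P : probability T R)
    {d'} {T' : measurableType d'} (P' : probability T' R) (c : R)
    (X : T -> set (circle beta)) (X' : T' -> set (circle beta)) (E : set cfgT) :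
  poisson_process P c X -> poisson_process P' c X' -> measurable E ->
  P (cfg_of X @^-1` E) = P' (cfg_of X' @^-1` E).
Proof.
move=> [fX mX PX iX] [fX' mX' PX' iX'] mE.
have mx := cfg_of_measurable fX mX; have mx' := cfg_of_measurable fX' mX'.
apply: (@law_unique (pushm P mx) (pushm P' mx')) => //.
  by rewrite pushmE preimage_setT (le_lt_trans (probability_le1 _ _)) ?ltry.
move=> m A k mA tA; rewrite !pushmE.
have -> : cfg_of X @^-1` [set h | forall i, npts (pts h `&` A i) = k i] =
    [set w | forall i, npts (X w `&` A i) = k i].
  by apply/seteqP; split => w /= h i; have := h i; rewrite pts_cfg_of.
have -> : cfg_of X' @^-1` [set h | forall i, npts (pts h `&` A i) = k i] =
    [set w | forall i, npts (X' w `&` A i) = k i].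
  by apply/seteqP; split => w /= h i; have := h i; rewrite pts_cfg_of.
apply: (etrans (iX m A k mA tA)); apply/esym/(etrans (iX' m A k mA tA)).
by apply: eq_bigr => i _; rewrite PX // PX'.
Qed.

End laws.

Definition law {d d'} {T : measurableType d} {T' : measurableType d'}
    {R : realType} (P : probability T R) (X : T -> T')
    (mX : measurable_fun setT X) : probability T' R :=
  distribution P (mfun_Sub (mem_set mX)).

Lemma lawE {d d'} {T : measurableType d} {T' : measurableType d'}
    {R : realType} (P : probability T R) (X : T -> T')
    (mX : measurable_fun setT X) (A : set T') : law P mX A = P (X @^-1` A).
Proof. by []. Qed.

Lemma ge0_integral_law {d d'} {T : measurableType d} {T' : measurableType d'}
    {R : realType} (P : probability T R) (X : T -> T')
    (mX : measurable_fun setT X) (f : T' -> \bar R) :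
  measurable_fun setT f -> (forall x, 0 <= f x)%E ->
  (\int[law P mX]_x f x = \int[P]_w f (X w))%E.
Proof. by move=> mf f0; rewrite ge0_integral_distribution. Qed.

(** * Independence *)

Section indep_pi.
Context {d} {T : measurableType d} {R : realType} (P : probability T R).

(** With [B] fixed, both sides are finite measures in [A]: [P] restricted to [B], and [P] scaled by
    the number [P B]. They agree on the pi-system [G], which contains the whole space. *)
Lemma indep_gen (G : set (set T)) (B : set T) :
  G `<=` measurable -> setI_closed G -> G setT -> measurable B ->
  (forall A, G A -> P (A `&` B) = (P A * P B)%E) ->
  forall A, <<s G >> A -> P (A `&` B) = (P A * P B)%E.
Proof.
move=> mG GI GT mB GB A sA.
have PB0 : 0 <= fine (P B) by rewrite fine_ge0.
have PBE : (fine (P B))%:E = P B by rewrite fineK ?fin_num_measure.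
transitivity (mscale (NngNum PB0) P A); last by rewrite /mscale /= PBE muleC.
apply: (@g_sigma_algebra_measure_unique _ _ _ G mG (fun=> setT) (fun=> GT) _
  (mrestr P mB)) => //.
- by rewrite bigcup_const.
- by move=> C GC; rewrite /= /mrestr /mscale /= PBE muleC; exact: GB.
- move=> _; rewrite /= /mrestr setTI.
  by rewrite (le_lt_trans (probability_le1 P mB)) ?ltry.
Qed.

Lemma indep_gen2 (G1 G2 : set (set T)) :
  G1 `<=` measurable -> setI_closed G1 -> G1 setT ->
  G2 `<=` measurable -> setI_closed G2 -> G2 setT ->
  (forall A B, G1 A -> G2 B -> P (A `&` B) = (P A * P B)%E) ->
  forall A B, <<s G1 >> A -> <<s G2 >> B -> P (A `&` B) = (P A * P B)%E.
Proof.
move=> mG1 G1I G1T mG2 G2I G2T G12 A B sA sB.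
have sG1 : <<s G1 >> `<=` measurable.
  by apply: smallest_sub => //; exact: sigma_algebra_measurable.
have sG2 : <<s G2 >> `<=` measurable.
  by apply: smallest_sub => //; exact: sigma_algebra_measurable.
apply: (indep_gen mG1 G1I G1T) => // [|A' G1A']; first exact: sG2.
rewrite setIC muleC; apply: (indep_gen mG2 G2I G2T) => // [|B' G2B'].
  exact: mG1.
by rewrite setIC muleC; exact: G12.
Qed.

(** When each [F i] is stable under intersection these events form a pi-system, which serves to
    generate the sigma-algebra of the whole block [J]. *)
Definition block_events {I : finType} (F : I -> set (set T)) (J : {set I}) : set (set T) :=
  [set A | exists2 E : I -> set T, (forall i, i \in J -> F i (E i)) &
     A = \bigcap_(i in [set` J]) E i].

(** On the generating pi-systems the claim is the product formula for the union of the two disjoint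
    blocks, once the two choices of events are merged into the single family [EE]. *)
Lemma indep_blocks {I : finType} (D J1 J2 : {set I}) (F : I -> set (set T)) :
  mutual_indep P D F -> J1 \subset D -> J2 \subset D -> (forall i, i \in J1 -> i \notin J2) ->
  (forall i, i \in D -> F i `<=` measurable) ->
  (forall i, setI_closed (F i)) -> (forall i, F i setT) ->
  forall A B, <<s block_events F J1 >> A -> <<s block_events F J2 >> B ->
  P (A `&` B) = (P A * P B)%E.
Proof.
move=> indep J1D J2D J12 mF FI FT.
have bm (J : {set I}) : J \subset D -> block_events F J `<=` measurable.
  move=> JD _ [E FE ->]; apply: fin_bigcap_measurable => [|i /= iJ].
    exact: finite_finset.
  by apply: mF (FE i iJ); exact: (fintype.subsetP JD).
have bI (J : {set I}) : setI_closed (block_events F J).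
  move=> _ _ [E FE ->] [E' FE' ->]; exists (fun i => E i `&` E' i).
    by move=> i iJ; apply: FI; [exact: FE|exact: FE'].
  by rewrite bigcapI.
have bT (J : {set I}) : block_events F J setT.
  by exists (fun=> setT) => //; rewrite bigcapT.
apply: indep_gen2; try by [apply: bm|apply: bI|apply: bT].
move=> _ _ [E FE ->] [E' FE' ->].
pose EE i := if i \in J1 then E i else E' i.
have EE1 : \bigcap_(i in [set` J1]) E i = \bigcap_(i in [set` J1]) EE i.
  by apply: eq_bigcapr => i /= iJ; rewrite /EE iJ.
have EE2 : \bigcap_(i in [set` J2]) E' i = \bigcap_(i in [set` J2]) EE i.
  by apply: eq_bigcapr => i /= iJ; rewrite /EE; case: ifPn => // /J12; rewrite iJ.
have FEE i : i \in (J1 :|: J2)%SET -> F i (EE i).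
  rewrite inE /EE; case: ifPn => [iJ _|_ /=]; [exact: FE|exact: FE'].
have -> : \bigcap_(i in [set` J1]) E i `&` \bigcap_(i in [set` J2]) E' i =
    \bigcap_(i in [set` (J1 :|: J2)%SET]) EE i.
  rewrite EE1 EE2; apply/seteqP; split => w /=.
    by move=> [h1 h2] i /=; rewrite inE => /orP[]; [exact: h1|exact: h2].
  by move=> h; split => i /= iJ; apply: h; rewrite /= inE iJ ?orbT.
rewrite EE1 EE2 !indep //; last 3 first.
- by move=> i iJ; apply: FEE; rewrite inE iJ orbT.
- by move=> i iJ; apply: FEE; rewrite inE iJ.
- by rewrite finset.subUset J1D.
rewrite (big_setID J1) /=; congr (_ * _)%E; apply: eq_bigl => i; rewrite !inE.
  by case: (i \in J1); rewrite ?andbF.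
by case: (boolP (i \in J1)) => // /J12 /negPf ->.
Qed.

End indep_pi.

Section joint_law.
Context {d d1 d2} {T : measurableType d} {T1 : measurableType d1}
  {T2 : measurableType d2} {R : realType} (P : probability T R).
Variables (X : T -> T1) (Y : T -> T2).
Hypotheses (mX : measurable_fun setT X) (mY : measurable_fun setT Y).
Hypothesis indep : forall A B, measurable A -> measurable B ->
  P (X @^-1` A `&` Y @^-1` B) = (P (X @^-1` A) * P (Y @^-1` B))%E.

Let mXY : measurable_fun setT (fun w => (X w, Y w)).
Proof. exact: measurable_fun_pair. Qed.

Lemma joint_law (Z : set (T1 * T2)) : measurable Z ->
  P [set w | Z (X w, Y w)] = (law P mX \x law P mY)%E Z.
Proof.
move=> mZ; apply/esym.
have := @product_measure_unique _ _ _ _ R (law P mX) (law P mY) (law P mXY) _ Z mZ.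
by apply=> A B mA mB; exact: indep.
Qed.

Lemma joint_ge0_integral (f : T1 * T2 -> \bar R) :
  measurable_fun setT f -> (forall x, 0 <= f x)%E ->
  (\int[P]_w f (X w, Y w) = \int[law P mX]_x \int[law P mY]_y f (x, y))%E.
Proof.
move=> mf f0.
transitivity (\int[(law P mX \x law P mY)%E]_z f z)%E; last exact: fubini_tonelli1.
rewrite -(ge0_integral_law P mXY) //.
by apply: eq_measure_integral => /= Z mZ _; exact: joint_law.
Qed.

(** Under the product law, Tonelli applied to absolute values gives the integrability of the
    product, and Fubini then factors the integral. *)
Lemma indep_integralM (f : T1 -> R) (g : T2 -> R) :
  measurable_fun setT f -> measurable_fun setT g ->
  P.-integrable setT (EFin \o f \o X) -> P.-integrable setT (EFin \o g \o Y) ->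
  P.-integrable setT (fun w => (f (X w) * g (Y w))%:E) /\
  (\int[P]_w (f (X w) * g (Y w))%:E =
     \int[P]_w (f (X w))%:E * \int[P]_w (g (Y w))%:E)%E.
Proof.
move=> mf mg iX iY.
have ifX : (law P mX).-integrable setT (EFin \o f).
  by apply: (integrable_pushforward mX) => //; exact/measurable_EFinP.
have igY : (law P mY).-integrable setT (EFin \o g).
  by apply: (integrable_pushforward mY) => //; exact/measurable_EFinP.
pose h (p : T1 * T2) : \bar R := (f p.1 * g p.2)%:E.
have mh : measurable_fun setT h.
  apply/measurable_EFinP; apply: measurable_funM.
    exact: (measurableT_comp mf measurable_fst).
  exact: (measurableT_comp mg measurable_snd).
have ih : (law P mX \x law P mY)%E.-integrable setT h.
  apply/integrable12ltyP => //.
  under eq_integral.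
    move=> x _; under eq_integral do rewrite /h /= normrM EFinM.
    rewrite ge0_integralZl //; last first.
    - by apply/measurable_EFinP; exact: measurableT_comp.
    over.
  rewrite ge0_integralZr //; last first.
  - exact: integral_ge0.
  - by apply/measurable_EFinP; exact: measurableT_comp.
  have [_ fi] := integrableP _ _ _ ifX; have [_ gi] := integrableP _ _ _ igY.
  apply: lte_mul_pinfty => //; first exact: integral_ge0.
  by rewrite ge0_fin_numE ?integral_ge0.
have iP : P.-integrable setT (fun w => h (X w, Y w)).
  apply/integrableP; split; first exact: (measurableT_comp mh mXY).
  rewrite (joint_ge0_integral (f := fun p => `|h p|%E)) //; last exact: measurableT_comp.
  by apply/integrable12ltyP.
split => //.
transitivity (\int[law P mXY]_z h z)%E.
  by rewrite integral_distribution.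
transitivity (\int[(law P mX \x law P mY)%E]_z h z)%E.
  by apply: eq_measure_integral => /= Z mZ _; exact: joint_law.
rewrite -integral12_prod_meas1 // /fubini_F.
have gfin := integrable_fin_num measurableT igY.
under eq_integral.
  move=> x _; rewrite /h /=.
  under eq_integral do rewrite EFinM.
  rewrite integralZl //.
  over.
rewrite /= -(fineK gfin) integralZr // fineK //.
congr (_ * _)%E.
  by rewrite integral_distribution //; exact/measurable_EFinP.
by rewrite integral_distribution //; exact/measurable_EFinP.
Qed.

End joint_law.

Lemma ge0_integral_mrestr {d} {T : measurableType d} {R : realType}
    (m : {measure set T -> \bar R}) (D : set T) (mD : measurable D) (f : T -> \bar R) :
  measurable_fun setT f -> (forall x, 0 <= f x)%E ->
  (\int[mrestr m mD]_x f x = \int[m]_(x in D) f x)%E.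
Proof.
move=> mf f0; rewrite -(setUv D) ge0_integral_setU //; last 3 first.
- exact: measurableC.
- by rewrite setUv.
- by apply/disj_setPS => x [].
rewrite (eq_measure_integral m) => [|A mA AD]; last by rewrite /= /mrestr setIidl.
rewrite [X in (_ + X)%E](eq_measure_integral mzero) ?integral_measure_zero ?adde0 //.
move=> A mA AD /=; rewrite /mrestr (_ : _ `&` _ = set0) ?measure0 //.
by apply/seteqP; split => // x [/AD].
Qed.

Lemma ge0_integral_nat {d} {T : measurableType d} {R : realType}
    (m : {measure set T -> \bar R}) (A : set T) (N : T -> nat) (g : nat -> \bar R) :
  measurable A -> (forall k, measurable (A `&` [set w | N w = k])) ->
  (forall k, 0 <= g k)%E ->
  (\int[m]_(w in A) g (N w) = \sum_(0 <= k <oo) g k * m (A `&` [set w | N w = k]))%E.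
Proof.
move=> mA mN g0.
have AE : A = \bigcup_k (A `&` [set w | N w = k]).
  by apply/seteqP; split => [w Aw|w [k _ []]//]; exists (N w).
rewrite [X in (\int[_]_(_ in X) _)%E]AE ge0_integral_bigcup //; last 2 first.
- rewrite -AE => _ Y mY.
  rewrite (_ : _ `&` _ = \bigcup_(k in [set k | Y (g k)]) (A `&` [set w | N w = k])).
    by apply: bigcup_measurable.
  by apply/seteqP; split => [w [Aw Yw]|w [k /= Yk [Aw Nw]]]; [exists (N w)|rewrite Nw].
- by move=> i j _ _ [w [[_ /= Ni] [_ /= Nj]]]; rewrite -Ni -Nj.
apply: eq_eseriesr => k _.
rewrite -integral_cst //; by apply: eq_integral => w; rewrite inE => -[_ /= Nw]; rewrite /= Nw.
Qed.

(** * Moments of the Poisson distribution *)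

Section poisson.
Context {R : realType}.
Implicit Type r : R.

(** The rate 0, where the law is defined separately as a Dirac mass, obeys the same formula because
    [0 ^+ 0] is 1. *)
Lemma PoE r k : 0 <= r -> Po r [set k] = (r ^+ k / k`!%:R * expR (- r))%:E.
Proof.
rewrite le_eqVlt -[Po r _]/(poisson_prob r 0%N [set k]) /poisson_prob => /orP[/eqP <-|r0].
  rewrite ltxx oppr0 expR0 mulr1 /= diracE; case: k => [|k].
    by rewrite mem_set // expr0 fact0 divr1.
  by rewrite memNset // expr0n mul0r.
by rewrite r0 esum_set1 ?lee_fin ?poisson_pmf_ge0 // /poisson_pmf r0.
Qed.

Lemma sum_Po r : (\sum_(0 <= k <oo) Po r [set k] = 1)%E.
Proof.
rewrite -(probability_setT (Po r)) -measure_semi_bigcup //.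
- by congr (Po r _); apply/seteqP; split => // k _; exists k.
- by move=> i j _ _ [k [/= -> ->]].
Qed.

(** Termwise, [a ^+ k] times the weight of [k] under [Po r] is [expR ((a - 1) * r)] times its weight
    under [Po (a * r)], and the latter weights sum to 1. *)
Lemma Po_exp_moment (a r : R) : 0 <= a -> 0 <= r ->
  (\sum_(0 <= k <oo) (a ^+ k)%:E * Po r [set k] = (expR ((a - 1) * r))%:E)%E.
Proof.
move=> a0 r0; rewrite -[RHS]mule1 -(sum_Po (a * r)) -nneseriesZl //.
apply: eq_eseriesr => k _; rewrite !PoE ?mulr_ge0 // -!EFinM; congr EFin.
have -> : expR (- r) = expR ((a - 1) * r) * expR (- (a * r)).
  by rewrite -expRD; congr expR; ring.
by rewrite exprMn; ring.
Qed.

(** The weights of [Po r] satisfy [k * p_k = r * p_(k-1)] for positive [k], and the term of index 0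
    vanishes. *)
Lemma Po_mean r : 0 <= r -> (\sum_(0 <= k <oo) k%:R%:E * Po r [set k] = r%:E)%E.
Proof.
move=> r0.
have ge0 k : (0 <= k%:R%:E * Po r [set k])%E by rewrite mule_ge0 // lee_fin.
rewrite nneseries_recl // mul0e add0e.
rewrite -[RHS]mule1 -(sum_Po r) -nneseriesZl // -(nneseries_addn 1) //.
apply: eq_eseriesr => k _; rewrite addn1 !PoE // -!EFinM; congr EFin.
rewrite exprS factS natrM invfM.
have : (k.+1%:R : R) != 0 by [].
have : (k`!%:R : R) != 0 by rewrite pnatr_eq0 -lt0n fact_gt0.
by move=> ? ?; field; apply/andP.
Qed.

End poisson.

(** * The intensity measure of the intervals *)

Section interval_measure.
Context {R : realType} {beta : {posnum R}}.
Local Notation b := (beta%:num).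
Local Notation cfgT := (@cfgT R beta).
Local Notation S := (borel (arc_space beta)).

Lemma size_ivl_gt_measurable k : measurable [set h : cfgT | (k < size (ivl h))%N].
Proof.
have := @size_ivl_measurable R beta measurableT [set n | (k < n)%N] I.
by rewrite setTI.
Qed.

Lemma nneseries_nth (T : Type) (x0 : T) (s : seq T) (f : T -> \bar R) :
  (forall x, 0 <= f x)%E ->
  (\sum_(0 <= k <oo) (if (k < size s)%N then f (nth x0 s k) else 0) =
   \sum_(x <- s) f x)%E.
Proof.
move=> f0; rewrite (nneseries_split 0 (size s)) => [|k _]; last by case: ifP.
rewrite add0n eseries0 ?adde0 => [|k /= sk _]; last by rewrite ltnNge sk.
by rewrite (big_nth x0) !big_mkord; apply: eq_bigr => k _; rewrite ltn_ord.
Qed.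

Lemma sum_ivl_measurable (f : S -> \bar R) :
  measurable_fun setT f ->
  measurable_fun setT (fun h : cfgT => (\sum_(I <- ivl h) f I)%E).
Proof.
move=> mf; apply: (measurable_fun_split (f := fun h : cfgT => size (ivl h))
  (h := fun n (h : cfgT) => (\sum_(k < n) f (nth None (ivl h) k))%E)).
- move=> c; rewrite -[X in measurable X]setTI.
  exact: size_ivl_measurable.
- move=> n; apply: emeasurable_sum => k.
  exact: (measurableT_comp mf (nth_ivl_measurable k)).
- by move=> h; rewrite (big_nth None) big_mkord.
Qed.

(** The expected number of intervals of a given kind, written as a sum over ranks [k] of the image
    of [Q] by the interval of rank [k], on the event that there is one. In this form it is a measure
    by construction. *)
Definition ivl_measure (Q : {measure set cfgT -> \bar R}) : {measure set S -> \bar R} :=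
  mseries (fun k => pushm (mrestr Q (size_ivl_gt_measurable k))
    (nth_ivl_measurable (beta := beta) k)) 0.

Variable Q : {measure set cfgT -> \bar R}.

Lemma ge0_integral_ivl_measure (f : S -> \bar R) :
  measurable_fun setT f -> (forall x, 0 <= f x)%E ->
  (\int[ivl_measure Q]_x f x = \int[Q]_h \sum_(I <- ivl h) f I)%E.
Proof.
move=> mf f0; rewrite /= ge0_integral_measure_series //.
under [RHS]eq_integral do rewrite -(nneseries_nth None) //.
rewrite integral_nneseries //; last 2 first.
- move=> k; apply: measurable_fun_ifT => //.
    move=> _ Y _; exact: (@size_ivl_measurable R beta measurableT [set n | Y (k < n)%N] I).
  exact: (measurableT_comp mf (nth_ivl_measurable k)).
- by move=> k h _; case: ifP.
apply: eq_eseriesr => k _.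
have mk : measurable_fun setT (fun h : cfgT => f (nth None (ivl h) k)).
  exact: (measurableT_comp mf (nth_ivl_measurable k)).
rewrite integral_pushm // ge0_integral_mrestr // integral_mkcond.
apply: eq_integral => h _; rewrite patchE; case: ifPn.
  by rewrite inE /= => ->.
by move/negP; rewrite inE /= => /negP/negPf ->.
Qed.

Lemma ivl_measureE (A : set S) : measurable A ->
  (ivl_measure Q A = \int[Q]_h ((count (fun J => J \in A) (ivl h))%:R)%:E)%E.
Proof.
move=> mA; transitivity (\int[ivl_measure Q]_x (\1_A x)%:E)%E.
  by rewrite integral_indic // setIT.
rewrite ge0_integral_ivl_measure //.
  apply: eq_integral => h _; rewrite sumEFin; congr EFin.
  elim: (ivl h) => [|I s IHs]; first by rewrite big_nil.
  by rewrite big_cons IHs /= natrD indicE.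
by apply/measurable_EFinP; exact: measurable_indic.
Qed.

End interval_measure.

(** * Convergence of the empirical measures *)

Section weak_law.
Context {d d'} {T : measurableType d} {T' : measurableType d'} {R : realType}.
Variables (P : probability T R) (Q : probability T' R) (n : nat).
Variable Y : 'I_n -> T -> T'.
Hypothesis mY : forall i, measurable_fun setT (Y i).
Hypothesis lawY : forall i E, measurable E -> P (Y i @^-1` E) = Q E.
Hypothesis indepY : forall i j, i != j -> forall A B, measurable A -> measurable B ->
  P (Y i @^-1` A `&` Y j @^-1` B) = (P (Y i @^-1` A) * P (Y j @^-1` B))%E.

Lemma integrable_law (f : T' -> \bar R) i : Q.-integrable setT f ->
  P.-integrable setT (f \o Y i).
Proof.
move=> fQ; have mf := measurable_int _ fQ.
apply/integrableP; split; first exact: measurableT_comp.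
rewrite -(ge0_integral_law P (mY i) (f := fun x => `|f x|%E)) //; last exact: measurableT_comp.
rewrite (eq_measure_integral Q); first by have [] := integrableP _ _ _ fQ.
by move=> A mA _; exact: lawY.
Qed.

Lemma integral_law (f : T' -> \bar R) i : Q.-integrable setT f ->
  (\int[P]_w f (Y i w) = \int[Q]_x f x)%E.
Proof.
move=> fQ; have mf := measurable_int _ fQ.
transitivity (\int[law P (mY i)]_x f x)%E.
  by rewrite integral_distribution //; exact: integrable_law.
by apply: eq_measure_integral => A mA _; exact: lawY.
Qed.

Variable z : T' -> R.
Hypothesis mz : measurable_fun setT z.
Hypothesis z2_int : Q.-integrable setT (fun x => (z x ^+ 2)%:E).
Hypothesis z_mean : (\int[Q]_x (z x)%:E = 0)%E.

(** On a probability space square integrability suffices: |z| is at most z^2 + 1. *)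
Let z_int : Q.-integrable setT (EFin \o z).
Proof.
have i1 : Q.-integrable setT (fun x => (z x ^+ 2)%:E + (1 : R)%:E)%E.
  apply: integrableD => //; exact: finite_measure_integrable_cst.
apply: le_integrable i1 => //; first exact/measurable_EFinP.
move=> x _; rewrite -EFinD !abse_EFin lee_fin.
rewrite [leRHS]ger0_norm ?addr_ge0 ?sqr_ge0 //.
have := sqr_ge0 (`|z x| - 1); rewrite sqrrB1 -normrX (ger0_norm (sqr_ge0 _)).
by have := normr_ge0 (z x); lra.
Qed.

(** The cross terms vanish by pairwise independence and the zero mean, and each of the [n] diagonal
    terms has the law of [z ^+ 2] under [Q]. *)
Lemma sum_second_moment :
  (\int[P]_w ((\sum_i z (Y i w)) ^+ 2)%:E =
   n%:R%:E * \int[Q]_x (z x ^+ 2)%:E)%E.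
Proof.
have zz i j : P.-integrable setT (fun w => (z (Y i w) * z (Y j w))%:E) /\
    (\int[P]_w (z (Y i w) * z (Y j w))%:E =
      if i == j then \int[Q]_x (z x ^+ 2)%:E else 0)%E.
  have [<-|ij] := eqVneq i j; first split.
  - exact: (integrable_law i z2_int).
  - by rewrite -(integral_law i z2_int).
  have [zi ->] := indep_integralM (mY i) (mY j) (indepY ij) mz mz
    (integrable_law i z_int) (integrable_law j z_int).
  by split=> //; rewrite (integral_law i z_int) z_mean mul0e.
under eq_integral.
  move=> w _; rewrite expr2 big_distrlr /= -sumEFin.
  under eq_bigr do rewrite -sumEFin.
  over.
rewrite (integral_sum measurableT) //; last first.
  by move=> i; apply: integrable_sum => // j _; case: (zz i j).
transitivity (\sum_(i < n) \int[Q]_x (z x ^+ 2)%:E)%E.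
  apply: eq_bigr => i _; rewrite (integral_sum measurableT) //; last by move=> j; case: (zz i j).
  rewrite (bigD1 i) //= big1 ?adde0; first by rewrite (zz i i).2 eqxx.
  by move=> j ji; rewrite (zz i j).2 eq_sym (negPf ji).
rewrite -(fineK (integrable_fin_num measurableT z2_int)) sumEFin sumr_const card_ord.
by rewrite -EFinM mulr_natl.
Qed.

(** Chebyshev's inequality for a single [n]. The bound mentions only [Q], [n] and [eps], so it can
    be used along a sequence of different probability spaces. *)
Lemma weak_law (eps : R) : (0 < n)%N -> 0 < eps ->
  (P [set w | (eps <= `|n%:R^-1 * \sum_i z (Y i w)|)%R] <=
   (fine (\int[Q]_x (z x ^+ 2)%:E) / (n%:R * eps ^+ 2))%:E)%E.
Proof.
move=> n0 e0; set A := [set w | _].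
have n0' : (0 : R) < n%:R by rewrite ltr0n.
pose S w := \sum_i z (Y i w).
have mS : measurable_fun setT S.
  by apply: measurable_sum => i; exact: measurableT_comp.
have mS2 : measurable_fun setT (fun w => (S w ^+ 2)%:E).
  by apply/measurable_EFinP; exact: measurable_funX.
have mA : measurable A.
  have mf : measurable_fun setT (fun w => `|n%:R^-1 * S w|).
    by apply: measurableT_comp => //; exact: measurable_funM.
  have := mf measurableT _ (measurable_itv `[eps, +oo[).
  by rewrite setTI; congr measurable; apply/seteqP; split => w /=; rewrite in_itv /= andbT.
have V0 : (0 <= \int[Q]_x (z x ^+ 2)%:E)%E.
  by apply: integral_ge0 => x _; rewrite lee_fin sqr_ge0.
have Vfin : (\int[Q]_x (z x ^+ 2)%:E)%E \is a fin_num by exact: integrable_fin_num.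
have : (((n%:R * eps) ^+ 2)%:E * P A <= n%:R%:E * \int[Q]_x (z x ^+ 2)%:E)%E.
  rewrite -sum_second_moment -integral_cst //.
  apply: (@le_trans _ _ (\int[P]_(w in A) (S w ^+ 2)%:E)%E); last first.
    by apply: ge0_subset_integral => // w _; rewrite lee_fin sqr_ge0.
  apply: ge0_le_integral => //.
  - by move=> w _; rewrite lee_fin sqr_ge0.
  - exact: measurable_funTS.
  move=> w Aw; rewrite lee_fin -[S w ^+ 2]ger0_norm ?sqr_ge0 // normrX.
  have nS : n%:R * eps <= `|S w|.
    by move: Aw; rewrite /A /= normrM [ `|n%:R^-1| ]gtr0_norm ?invr_gt0 // ler_pdivlMl.
  by rewrite ler_pXn2r // nnegrE // mulr_ge0 ?ltW.
have PAfin : P A \is a fin_num by rewrite fin_num_measure.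
rewrite -(fineK Vfin) -(fineK PAfin) -!EFinM !lee_fin.
set V := fine _; set p := fine _ => h.
rewrite ler_pdivlMr ?mulr_gt0 ?exprn_gt0 //.
rewrite -(ler_pM2l n0'); apply: le_trans h.
by rewrite le_eqVlt; apply/orP; left; apply/eqP; ring.
Qed.

End weak_law.

Section sigma_process.
Context {R : realType} {beta : {posnum R}} {d} {T : measurableType d}.
Variable X : T -> set (circle beta).

Lemma sigma_process_setI : setI_closed (sigma_process X).
Proof.
move=> A B sA sB; rewrite /sigma_process; set G := (X in <<s X >>).
exact: (@measurableI _ (g_sigma_algebraType G)).
Qed.

Lemma sigma_process_setT : sigma_process X setT.
Proof.
rewrite /sigma_process; set G := (X in <<s X >>).
exact: (@measurableT _ (g_sigma_algebraType G)).
Qed.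

Lemma sigma_process_measurable :
  (forall A : set (borel (circle beta)), measurable A ->
     measurable_fun setT (fun w => npts (X w `&` A))) ->
  sigma_process X `<=` measurable.
Proof.
move=> mX; apply: smallest_sub; first exact: sigma_algebra_measurable.
move=> _ [A [k [mA ->]]].
by have := mX A mA measurableT [set k] I; rewrite setTI.
Qed.

End sigma_process.

(** * Holes and links of the quantum graph *)

Section quantum.
Context {R : realType} {beta : {posnum R}} {d} {T : measurableType d}.
Variables (P : probability T R) (lambda : R) (n : nat).
Variables (H : 'I_n -> T -> set (circle beta)).
Variables (L : {set 'I_n} -> T -> set (circle beta)).
Hypothesis HL : quantum_processes P lambda H L.

Local Notation index := ('I_n + {set 'I_n})%type.

Definition process_algebra (z : index) : set (set T) :=
  match z with inl i => sigma_process (H i) | inr e => sigma_process (L e) end.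

Definition process_index : {set index} :=
  [set z : index | if z is inr e then #|e| == 2%N else true].

Let HP i : poisson_process P lambda (H i). Proof. by case: HL. Qed.

Let LP (e : {set 'I_n}) : #|e| = 2%N -> poisson_process P n%:R^-1 (L e).
Proof. by case: HL => _ + _; exact. Qed.

Lemma holes_finite i w : finite_set (H i w).
Proof. by case: (HP i). Qed.

Lemma cfg_holes_measurable i : measurable_fun setT (cfg_of (H i)).
Proof. by case: (HP i) => fH mH _ _; exact: cfg_of_measurable. Qed.

Lemma process_blocks_indep (J1 J2 : {set index}) (A B : set T) :
  J1 \subset process_index -> J2 \subset process_index ->
  (forall i, i \in J1 -> i \notin J2) ->
  <<s block_events process_algebra J1 >> A -> <<s block_events process_algebra J2 >> B ->
  P (A `&` B) = (P A * P B)%E.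
Proof.
move=> J1D J2D J12; case: HL => _ _ indep.
apply: (indep_blocks indep J1D J2D J12).
- move=> [i|e]; rewrite inE => ie; apply: sigma_process_measurable.
    by case: (HP i).
  by case: (LP (eqP ie)).
- by case=> [i|e]; exact: sigma_process_setI.
- by case=> [i|e]; exact: sigma_process_setT.
Qed.

Lemma block_event1 (J : {set index}) (z : index) (A : set T) :
  z \in J -> process_algebra z A -> block_events process_algebra J A.
Proof.
move=> zJ zA; exists (fun z' => if z' == z then A else setT).
  move=> z' _; case: eqP => [->//|_].
  by case: z' => ?; exact: sigma_process_setT.
apply/seteqP; split => [w Aw z' _|w /(_ z zJ)]; last by rewrite eqxx.
by case: ifP.
Qed.

Lemma cfg_holes_indep i j (A B : set (@cfgT R beta)) : i != j ->
  measurable A -> measurable B ->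
  P (cfg_of (H i) @^-1` A `&` cfg_of (H j) @^-1` B) =
  (P (cfg_of (H i) @^-1` A) * P (cfg_of (H j) @^-1` B))%E.
Proof.
move=> ij mA mB.
apply: (@process_blocks_indep [set inl i] [set inl j]).
- by apply/fintype.subsetP => z; rewrite !inE => /eqP ->.
- by apply/fintype.subsetP => z; rewrite !inE => /eqP ->.
- by move=> z; rewrite !inE => /eqP ->; apply: contra ij => /eqP[->].
- apply: sub_sigma_algebra; apply: (@block_event1 _ (inl i)); rewrite ?inE //.
  by apply: sigma_process_preimage => // w; exact: holes_finite.
- apply: sub_sigma_algebra; apply: (@block_event1 _ (inl j)); rewrite ?inE //.
  by apply: sigma_process_preimage => // w; exact: holes_finite.
Qed.

Lemma intervals_cfg i w : intervals (H i w) = ivl (cfg_of (H i) w).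
Proof. by rewrite /ivl pts_cfg_of //; exact: holes_finite. Qed.

Lemma big_vertex_types (V : nmodType) (f : arc_space beta -> V) w :
  \sum_(I <- vertex_types H w) f I = \sum_i \sum_(I <- ivl (cfg_of (H i) w)) f I.
Proof.
rewrite /vertex_types /vertices big_map big_allpairs_dep /= big_enum /=.
by apply: eq_bigr => i _; rewrite intervals_cfg.
Qed.

Lemma size_vertex_types w :
  size (vertex_types H w) = (\sum_i maxn (npts (H i w)) 1)%N.
Proof.
rewrite -sum1_size big_vertex_types; apply: eq_bigr => i _.
by rewrite sum1_size -intervals_cfg size_intervals //; exact: holes_finite.
Qed.

End quantum.

(** * Sums of a bounded function over the intervals of one circle *)

Section interval_statistics.
Context {R : realType} {beta : {posnum R}}.
Local Notation b := (beta%:num).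
Local Notation cfgT := (@cfgT R beta).
Local Notation S := (borel (arc_space beta)).
Variables (Q : probability cfgT R).
Hypothesis Q_size2 : (\int[Q]_h ((size (ivl h))%:R ^+ 2)%:E < +oo)%E.

Lemma ivl_size_measurable :
  measurable_fun setT (fun h : cfgT => (size (ivl h))%:R : R).
Proof. exact: (measurableT_comp _ size_ivl_measurable). Qed.

Lemma ivl_size2_integrable :
  Q.-integrable setT (fun h : cfgT => ((size (ivl h))%:R ^+ 2)%:E).
Proof.
apply/integrableP; split.
  by apply/measurable_EFinP; apply: measurable_funX; exact: ivl_size_measurable.
under eq_integral do rewrite abse_EFin ger0_norm ?sqr_ge0 //.
exact: Q_size2.
Qed.

Lemma ivl_measureT : (ivl_measure Q setT = \int[Q]_h ((size (ivl h))%:R)%:E)%E.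
Proof.
rewrite ivl_measureE //; apply: eq_integral => h _.
by rewrite (eq_count (a2 := predT)) ?count_predT // => I; rewrite in_setT.
Qed.

Lemma ivl_size_gt0 (h : cfgT) : (0 < size (ivl h))%N.
Proof. by rewrite size_intervals ?leq_max ?orbT //; exact: pts_finite. Qed.

Lemma ivl_measureT_fin : (0 < ivl_measure Q setT < +oo)%E.
Proof.
have m1 : measurable_fun setT (fun h : cfgT => ((size (ivl h))%:R : R)%:E).
  by apply/measurable_EFinP; exact: ivl_size_measurable.
rewrite ivl_measureT; apply/andP; split.
  apply: (@lt_le_trans _ _ (\int[Q]_h (cst 1%:E h))%E).
    rewrite integral_cst //= mul1e; by have -> : Q setT = 1%E by exact: probability_setT.
  apply: ge0_le_integral => //.
  by move=> h _; rewrite lee_fin ler1n ivl_size_gt0.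
apply: le_lt_trans Q_size2; apply: ge0_le_integral => //.
- by apply/measurable_EFinP; apply: measurable_funX; exact: ivl_size_measurable.
- move=> h _; rewrite lee_fin expr2 ler_peMl //.
  by rewrite ler1n ivl_size_gt0.
Qed.

Definition ivl_sum (f : S -> R) (h : cfgT) : R := \sum_(I <- ivl h) f I.

Variables (f : S -> R) (C : R).
Hypotheses (mf : measurable_fun setT f) (fC : forall I, `|f I| <= C).

Let C0 : 0 <= C. Proof. exact: le_trans (normr_ge0 _) (fC None). Qed.

Lemma ivl_sum_measurable : measurable_fun setT (ivl_sum f).
Proof.
apply/measurable_EFinP.
rewrite (_ : EFin \o _ = fun h => (\sum_(I <- ivl h) (f I)%:E)%E); last first.
  by apply/funext => h /=; rewrite sumEFin.
by apply: sum_ivl_measurable; exact/measurable_EFinP.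
Qed.

Lemma ivl_sum_le h : `|ivl_sum f h| <= C * (size (ivl h))%:R.
Proof.
rewrite /ivl_sum (le_trans (ler_norm_sum _ _ _)) //.
apply: (le_trans (ler_sum _ (fun I _ => fC I))).
by rewrite big_const_seq count_predT iter_addr_0 mulr_natr.
Qed.

Lemma ivl_measure_integrable : (ivl_measure Q).-integrable setT (EFin \o f).
Proof.
have /andP[_ fin] := ivl_measureT_fin.
apply: measurable_bounded_integrable => //.
exists C; split; first exact: ger0_real.
by move=> M CM I _; exact: le_trans (fC I) (ltW CM).
Qed.

Lemma ivl_size_integrable : Q.-integrable setT (fun h : cfgT => ((size (ivl h))%:R)%:E).
Proof.
apply: le_integrable ivl_size2_integrable => //.
  by apply/measurable_EFinP; exact: ivl_size_measurable.
move=> h _; rewrite !abse_EFin lee_fin !ger0_norm // expr2 ler_peMl //.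
by rewrite ler1n ivl_size_gt0.
Qed.

Lemma ivl_sum_integrable : Q.-integrable setT (EFin \o ivl_sum f).
Proof.
have iC := integrableZl measurableT C ivl_size_integrable.
apply: le_integrable iC => //; first by apply/measurable_EFinP; exact: ivl_sum_measurable.
move=> h _; rewrite /= lee_fin; apply: le_trans (ivl_sum_le h) _; exact: ler_norm.
Qed.

(** The nonnegative case applies to [f + C]; subtracting [C] times the total mass, which is finite,
    gives the signed case. *)
Lemma integral_ivl_sum :
  (\int[ivl_measure Q]_I (f I)%:E = \int[Q]_h (ivl_sum f h)%:E)%E.
Proof.
have /andP[_ fin] := ivl_measureT_fin.
have iC : (ivl_measure Q).-integrable setT (EFin \o cst C).
  apply: measurable_bounded_integrable => //.
  by exists C; split; [exact: ger0_real|move=> M CM I _ /=; rewrite ger0_norm // ltW].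
have iS := integrableZl measurableT C ivl_size_integrable.
have E1 : (\int[ivl_measure Q]_I (f I + C)%:E =
    \int[ivl_measure Q]_I (f I)%:E + C%:E * ivl_measure Q setT)%E.
  rewrite -integral_cst // -(integralD measurableT ivl_measure_integrable iC).
  by apply: eq_integral.
have E2 : (\int[ivl_measure Q]_I (f I + C)%:E =
    \int[Q]_h (ivl_sum f h)%:E + C%:E * ivl_measure Q setT)%E.
  rewrite ge0_integral_ivl_measure; last 2 first.
  - by apply/measurable_EFinP; exact: measurable_funD.
  - by move=> I; rewrite lee_fin; have := fC I; rewrite ler_norml => /andP[]; lra.
  rewrite ivl_measureT -integralZl //; last exact: ivl_size_integrable.
  rewrite -(integralD measurableT ivl_sum_integrable iS).
  apply: eq_integral => h _; rewrite sumEFin big_split /= EFinD; congr (_ + _)%E.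
  by rewrite big_const_seq count_predT iter_addr_0 -EFinM mulr_natr.
have fA := integrable_fin_num measurableT ivl_measure_integrable.
have fB := integrable_fin_num measurableT ivl_sum_integrable.
have ft : ivl_measure Q setT \is a fin_num by rewrite ge0_fin_numE.
move: E1; rewrite E2 -(fineK fA) -(fineK fB) -(fineK ft) -EFinM -!EFinD => -[].
by move=> /addIr ->.
Qed.

Definition ivl_mean : R := fine (\int[ivl_measure Q]_I (f I)%:E).

(** From (s - m)^2 <= 2 s^2 + 2 m^2, where |s| is at most [C] times the number of intervals: the
    second moment of that number is enough. *)
Lemma centered_sum2_integrable :
  Q.-integrable setT (fun h => ((ivl_sum f h - ivl_mean) ^+ 2)%:E).
Proof.
have i1 : Q.-integrable setT
    (fun h => (2 * C ^+ 2)%:E * ((size (ivl h))%:R ^+ 2)%:E + (2 * ivl_mean ^+ 2)%:E)%E.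
  apply: integrableD => //; first exact/integrableZl/ivl_size2_integrable.
  exact: finite_measure_integrable_cst.
apply: le_integrable i1 => //.
  apply/measurable_EFinP; apply: measurable_funX; apply: measurable_funB => //.
  exact: ivl_sum_measurable.
move=> h _; rewrite -EFinM -EFinD !abse_EFin lee_fin ger0_norm ?sqr_ge0 //.
apply: le_trans (ler_norm _).
have : (ivl_sum f h) ^+ 2 <= (C * (size (ivl h))%:R) ^+ 2.
  rewrite -[ivl_sum f h ^+ 2]ger0_norm ?sqr_ge0 // normrX.
  by rewrite ler_pXn2r // ?nnegrE ?mulr_ge0 // ivl_sum_le.
rewrite exprMn; move: (ivl_sum f h) => s hs.
by have := sqr_ge0 (s + ivl_mean); rewrite sqrrD sqrrB; lra.
Qed.

Lemma centered_sum_mean :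
  (\int[Q]_h (ivl_sum f h - ivl_mean)%:E = 0)%E.
Proof.
have im : Q.-integrable setT (EFin \o cst ivl_mean).
  exact: finite_measure_integrable_cst.
under eq_integral do rewrite EFinB.
rewrite (integralB measurableT ivl_sum_integrable im).
rewrite -[EFin \o cst ivl_mean]/(cst ivl_mean%:E) integral_cst //.
rewrite [X in (X - _)%E](_ : _ = \int[ivl_measure Q]_I (f I)%:E)%E; last exact/esym/integral_ivl_sum.
rewrite [X in (_ * X)%E](_ : _ = 1%E); last exact: probability_setT.
rewrite mule1 /ivl_mean fineK ?subee //;
  exact: (integrable_fin_num measurableT ivl_measure_integrable).
Qed.

End interval_statistics.

Section poisson_size.
Context {R : realType} {beta : {posnum R}} {d} {T : measurableType d}.
Variables (P : probability T R) (c : R) (X : T -> set (circle beta)).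
Hypotheses (c0 : 0 <= c) (PX : poisson_process P c X).

Lemma circle_lengthT : circle_length ([set: circle beta]) = beta%:num.
Proof. by rewrite circle_lengthE circle_measureT. Qed.

Lemma poisson_ivl_size2 (mX : measurable_fun setT (cfg_of X)) :
  (\int[law P mX]_h ((size (ivl h))%:R ^+ 2)%:E < +oo)%E.
Proof.
have [fX mN pX _] := PX.
pose N w := npts (X w `&` setT).
have mN' : measurable_fun setT N by exact: mN.
rewrite ge0_integral_law //; last first.
  by apply/measurable_EFinP; apply: measurable_funX; exact: ivl_size_measurable.
pose g k : \bar R := (4 ^+ k)%:E.
have NE w : size (ivl (cfg_of X w)) = maxn (N w) 1.
  by rewrite size_intervals ?pts_cfg_of // /N setIT.
have mNk k : measurable ([set w | N w = k]).
  by have := mN' measurableT [set k] I; rewrite setTI.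
have mg : measurable_fun setT (fun w => g (N w)).
  move=> _ Y mY; rewrite setTI; apply: (measurable_countable_split (f := N)) => k.
  have [gY|gY] := pselect (Y (g k)).
    rewrite (_ : _ `&` _ = [set w | N w = k]) //.
    by apply/seteqP; split => w /=; [case|move=> Nw; split => //; rewrite Nw].
  rewrite (_ : _ `&` _ = set0) //; apply/seteqP; split => // w [/= Nw].
  by rewrite Nw.
(* max(N, 1)^2 <= 4^N, which has finite expectation. *)
apply: (@le_lt_trans _ _ (\int[P]_w g (N w))%E).
  apply: ge0_le_integral => //.
  - apply/measurable_EFinP; apply: measurable_funX.
    exact: (measurableT_comp ivl_size_measurable mX).
  - move=> w _; rewrite lee_fin NE -!natrX ler_nat.
    (* Since 4 is the square of 2, it remains to see that max(N, 1) is at most 2^N. *)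
    rewrite -[4%N]/(2 ^ 2)%N -expnM mulnC expnM leq_exp2r //.
    by rewrite geq_max expn_gt0 ltnW // ltn_expl.
rewrite ge0_integral_nat //; last 2 first.
- by move=> k; rewrite setTI.
- by move=> k; rewrite /g lee_fin.
rewrite (eq_eseriesr (g := fun k => (4 ^+ k)%:E * Po (c * beta%:num) [set k])%E); last first.
  move=> k _; congr (_ * _)%E; rewrite setTI.
  by apply: (etrans (pX setT k measurableT)); rewrite circle_lengthT.
by rewrite Po_exp_moment ?mulr_ge0 // ltry.
Qed.

End poisson_size.

Section empirical.
Context {R : realType} {beta : {posnum R}}.
Local Notation S := (borel (arc_space beta)).

Lemma ge0_integral_empirical n (x : seq (arc_space beta)) (f : S -> \bar R) :
  measurable_fun setT f -> (forall I, 0 <= f I)%E ->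
  (\int[empirical n x]_I f I = n%:R^-1%:E * \sum_(I <- x) f I)%E.
Proof.
move=> mf f0; rewrite /empirical ge0_integral_mscale // ge0_integral_measure_sum //.
congr (_ * _)%E; rewrite (big_nth point) big_mkord; apply: eq_bigr => i _.
by rewrite integral_dirac // diracT mul1e.
Qed.

Lemma empiricalE n (x : seq (arc_space beta)) (A : set S) : measurable A ->
  (empirical n x A = (n%:R^-1 * \sum_(I <- x) \1_A I)%:E)%E.
Proof.
move=> mA; rewrite EFinM -sumEFin.
rewrite -(ge0_integral_empirical n x) //.
  by rewrite integral_indic // setIT.
by apply/measurable_EFinP; exact: measurable_indic.
Qed.

(** The integral is signed, so the function is again shifted by its bound [C] to reduce to
    nonnegative functions. *)
Lemma Rintegral_empirical n (x : seq (arc_space beta)) (f : S -> R) (C : R) :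
  measurable_fun setT f -> (forall I, `|f I| <= C) ->
  \int[empirical n x]_I f I = n%:R^-1 * \sum_(I <- x) f I.
Proof.
move=> mf fC; have C0 : 0 <= C by exact: le_trans (normr_ge0 _) (fC None).
have eT : (empirical n x setT = (n%:R^-1 * (size x)%:R)%:E)%E.
  rewrite empiricalE //; congr ((_ * _)%:E).
  by under eq_bigr do rewrite indicT; rewrite big_const_seq count_predT iter_addr_0.
have fin : (empirical n x setT < +oo)%E by rewrite eT ltry.
have ib (g : S -> R) D : measurable_fun setT g -> (forall I, `|g I| <= D) ->
    (empirical n x).-integrable setT (EFin \o g).
  move=> mg gD; apply: measurable_bounded_integrable => //.
  have D0 : 0 <= D by exact: le_trans (normr_ge0 _) (gD None).
  by exists D; split; [exact: ger0_real|move=> M DM I _ /=; exact: le_trans (gD I) (ltW DM)].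
have iF := ib f C mf fC.
have iC : (empirical n x).-integrable setT (EFin \o cst C).
  by apply: (ib _ C) => // I; rewrite ger0_norm.
have E1 : (\int[empirical n x]_I (f I + C)%:E =
    \int[empirical n x]_I (f I)%:E + C%:E * empirical n x setT)%E.
  by rewrite -integral_cst // -(integralD measurableT iF iC).
have E2 : (\int[empirical n x]_I (f I + C)%:E =
   (n%:R^-1 * \sum_(I <- x) f I)%:E + C%:E * empirical n x setT)%E.
  rewrite ge0_integral_empirical; last 2 first.
  - by apply/measurable_EFinP; exact: measurable_funD.
  - by move=> I; rewrite lee_fin; have := fC I; rewrite ler_norml => /andP[]; lra.
  rewrite eT sumEFin -!EFinM -EFinD big_split /= mulrDr; congr ((_ + _)%:E).
  by rewrite big_const_seq count_predT iter_addr_0 -mulr_natr; ring.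
have fA := integrable_fin_num measurableT iF.
move: E1; rewrite E2 eT -EFinM /Rintegral -(fineK fA) -!EFinD => -[].
by move=> /addIr ->.
Qed.

End empirical.

Section tail.
Context {R : realType} {beta : {posnum R}} {d} {T : measurableType d}.
Variables (P : probability T R) (lambda : R) (n : nat).
Variables (H : 'I_n -> T -> set (circle beta)).
Variables (L : {set 'I_n} -> T -> set (circle beta)).
Hypothesis HL : quantum_processes P lambda H L.
Local Notation S := (borel (arc_space beta)).
Variable Q : probability (@cfgT R beta) R.
Hypothesis Q_size2 : (\int[Q]_h ((size (ivl h))%:R ^+ 2)%:E < +oo)%E.
Hypothesis lawH : forall i E, measurable E -> P (cfg_of (H i) @^-1` E) = Q E.

Lemma vertex_sum_measurable (f : S -> R) : measurable_fun setT f ->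
  measurable_fun setT (fun w => \sum_(I <- vertex_types H w) f I).
Proof.
move=> mf.
rewrite (_ : (fun _ => _) = fun w => \sum_i ivl_sum f (cfg_of (H i) w)).
  apply: measurable_sum => i; apply: measurableT_comp; first exact: ivl_sum_measurable.
  exact: cfg_holes_measurable HL i.
by apply/funext => w; rewrite (big_vertex_types HL).
Qed.

Lemma vertex_sum_tail (f : S -> R) (C eps : R) :
  measurable_fun setT f -> (forall I, `|f I| <= C) -> (0 < n)%N -> 0 < eps ->
  (P [set w | (eps <= `|n%:R^-1 * (\sum_(I <- vertex_types H w) f I) - ivl_mean Q f|)%R] <=
   (fine (\int[Q]_h ((ivl_sum f h - ivl_mean Q f) ^+ 2)%:E) / (n%:R * eps ^+ 2))%:E)%E.
Proof.
move=> mf fC n0 e0.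
have := weak_law (cfg_holes_measurable HL) lawH
  (fun i j ij A B mA mB => cfg_holes_indep HL ij mA mB)
  (measurable_funB (ivl_sum_measurable mf) (measurable_cst (ivl_mean Q f)))
  (centered_sum2_integrable Q_size2 mf fC) (centered_sum_mean Q_size2 mf fC) n0 e0.
have mn : n%:R^-1 * (ivl_mean Q f *+ n) = ivl_mean Q f.
  by rewrite -[ivl_mean Q f *+ n]mulr_natl mulKf // pnatr_eq0 -lt0n.
congr (P _ <= _)%E; apply/seteqP; split => w /=;
  by rewrite (big_vertex_types HL) sumrB mulrBr sumr_const card_ord mn.
Qed.

End tail.

Lemma measure_exists_le {d} {T : measurableType d} {R : realType}
    (P : {measure set T -> \bar R}) m (E : 'I_m -> set T) :
  (forall i, measurable (E i)) ->
  (P [set w | exists i, E i w] <= \sum_i P (E i))%E.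
Proof.
case: m E => [|m] E mE.
  by rewrite (_ : [set _ | _] = set0) ?measure0 ?big_ord0 //; apply/seteqP; split => // w [[]].
rewrite (_ : [set _ | _] = \big[setU/set0]_(k < m.+1) E (inord k)).
  apply: (le_trans (@Boole_inequality _ _ _ P (fun k => E (inord k)) m.+1 _)) => //.
  by apply: lee_sum => i _; rewrite inord_val.
rewrite -(bigcup_mkord m.+1 (fun k => E (inord k))).
apply/seteqP; split => [w [i Ei]|w [k _ Ek]]; last by exists (inord k).
by exists i; rewrite /= ?inord_val.
Qed.

Lemma cvg_inv_natr {R : realType} (V e : R) : 0 < e ->
  (V / (n%:R * e))%:E @[n --> \oo] --> (0 : R)%:E.
Proof.
move=> e0; apply: cvg_EFin; first exact: nearW.
rewrite (_ : _ \o _ = fun n => V / e * n%:R^-1); last first.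
  by apply/funext => n /=; rewrite invfM; ring.
rewrite -[X in _ --> X](mulr0 (V / e)); apply: cvgMr.
apply/gtr0_cvgV0; last exact: cvgr_idn.
by exists 1%N => // n /= n0; rewrite ltr0n.
Qed.

Section convergence.
Context {R : realType} {beta : {posnum R}}.
Local Notation S := (borel (arc_space beta)).
Variables (lambda : R) (d : nat -> measure_display) (T : forall n, measurableType (d n)).
Variables (P : forall n, probability (T n) R).
Variables (H : forall n, 'I_n -> T n -> set (circle beta)).
Variables (L : forall n, {set 'I_n} -> T n -> set (circle beta)).
Hypothesis HL : forall n, (0 < n)%N -> quantum_processes (P n) lambda (@H n) (@L n).
Variable Q : probability (@cfgT R beta) R.
Hypothesis Q_size2 : (\int[Q]_h ((size (ivl h))%:R ^+ 2)%:E < +oo)%E.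
Hypothesis lawH : forall n, (0 < n)%N -> forall i E, measurable E ->
  P n (cfg_of (@H n i) @^-1` E) = Q E.
Variable mu : {finite_measure set S -> \bar R}.
Hypothesis muE : forall A, measurable A -> mu A = ivl_measure Q A.

Let mu_mean (f : S -> R) : \int[mu]_I f I = ivl_mean Q f.
Proof.
by rewrite /Rintegral /ivl_mean (eq_measure_integral (ivl_measure Q)) // => A mA _; exact: muE.
Qed.

Let tail_event_measurable n (f : S -> R) eps : (0 < n)%N -> measurable_fun setT f ->
  measurable [set w | eps <= `|n%:R^-1 * (\sum_(I <- vertex_types (@H n) w) f I) - ivl_mean Q f|].
Proof.
move=> n0 mf.
have mg : measurable_fun setT (fun w =>
    `|n%:R^-1 * (\sum_(I <- vertex_types (@H n) w) f I) - ivl_mean Q f|).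
  apply: measurableT_comp => //; apply: measurable_funB => //.
  apply: measurable_funM => //. have := vertex_sum_measurable (HL n0) mf; exact.
have := mg measurableT _ (measurable_itv `[eps, +oo[).
by rewrite setTI; congr measurable; apply/seteqP; split => w /=; rewrite in_itv /= andbT.
Qed.

(** A union bound over the finite family of test functions: each of them is bounded and Borel, hence
    contributes a variance term, and the sum of these terms divided by [n * eps ^+ 2] tends to 0. *)
Lemma empirical_weak : empirical_cvg_weak mu P (fun n => vertex_types (@H n)).
Proof.
move=> m f eps fcont fbd eps0.
have mf i : measurable_fun setT (f i : S -> R) by exact: continuous_measurable_borel.
pose V i := fine (\int[Q]_h ((ivl_sum (f i) h - ivl_mean Q (f i)) ^+ 2)%:E).
apply: (@squeeze_cvge _ _ _ _ (fun=> 0%E) _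
  (fun n => ((\sum_i V i) / (n%:R * eps ^+ 2))%:E)); first last.
- by apply: cvg_inv_natr; rewrite exprn_gt0.
- exact: cvg_cst.
exists 1%N => // n /= n0; apply/andP; split.
  exact: measure_ge0.
pose E i := [set w | eps <= `|n%:R^-1 * (\sum_(I <- vertex_types (@H n) w) f i I) - ivl_mean Q (f i)|].
rewrite (_ : [set _ | _] = [set w | exists i, E i w]); last first.
  apply/seteqP; split => w [i ei]; exists i; move: ei; have [C fC] := fbd i;
    by rewrite /E /= (Rintegral_empirical _ _ (mf i) fC) mu_mean.
apply: le_trans (measure_exists_le _ _) _.
  by move=> i; exact: tail_event_measurable.
rewrite mulr_suml -sumEFin; apply: lee_sum => i _; have [C fC] := fbd i.
exact: (vertex_sum_tail (HL n0) Q_size2 (lawH n0) (mf i) fC n0 eps0).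
Qed.

Lemma empirical_sets : empirical_cvg_sets mu P (fun n => vertex_types (@H n)).
Proof.
move=> A mA _ eps eps0.
pose f : S -> R := \1_A.
have mf : measurable_fun setT f by exact: measurable_indic.
have fC I : `|f I| <= 1 by rewrite /f indicE ger0_norm // lern1; case: (_ \in _).
pose V := fine (\int[Q]_h ((ivl_sum f h - ivl_mean Q f) ^+ 2)%:E).
apply: (@squeeze_cvge _ _ _ _ (fun=> 0%E) _ (fun n => (V / (n%:R * eps ^+ 2))%:E)); first last.
- by apply: cvg_inv_natr; rewrite exprn_gt0.
- exact: cvg_cst.
exists 1%N => // n /= n0.
rewrite (_ : [set _ | _] = [set w | eps <= `|n%:R^-1 * (\sum_(I <- vertex_types (@H n) w) f I) - ivl_mean Q f|]).
  rewrite measure_ge0 /=.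
  exact: (vertex_sum_tail (HL n0) Q_size2 (lawH n0) mf fC n0 eps0).
have -> : fine (mu A) = ivl_mean Q f.
  rewrite -mu_mean /Rintegral integral_indic // setIT //.
by apply/seteqP; split => w /=; rewrite empiricalE.
Qed.

End convergence.

(** * The law of the edges *)

Section random_points.
Context {R : realType} {beta : {posnum R}} {d} {T : measurableType d}.
Local Notation b := (beta%:num).
Local Notation cfgT := (@cfgT R beta).

Lemma arc_set_mkE (x y : circle beta) (l : R) :
  arc_set (mk_arc x l) y <-> ~~ (0 < l < b) || (cw_dist x y < l).
Proof.
case: (boolP (0 < l < b)) => lb /=; last by rewrite /mk_arc insubN.
by rewrite /mk_arc (insubT (fun l => 0 < l < b) lb).
Qed.

Lemma measurable_bool (f : T -> bool) : measurable_fun setT f ->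
  measurable [set w | f w].
Proof.
move=> mf; have := mf measurableT [set true] I.
by rewrite setTI.
Qed.

Variable h : T -> cfgT.
Hypothesis mh : measurable_fun setT h.

Lemma random_coord_measurable j : measurable_fun setT (fun w => hole_coord j (h w)).
Proof. exact: measurableT_comp (hole_coord_measurable j) mh. Qed.

Lemma random_size_measurable m :
  measurable ((fun w => size (holes (pts (h w)))) @^-1` [set m]).
Proof.
by rewrite -[X in measurable X]setTI; exact: mh (size_holes_measurable m).
Qed.

(** Both the point and the arc are random: [y] will be the position of a link, tested against an
    interval between random holes. *)
Lemma mem_arc_measurable (y : T -> borel (circle beta)) k : measurable_fun setT y ->
  measurable [set w | arc_set (nth None (ivl (h w)) k) (y w)].
Proof.
move=> my.
have mv : measurable_fun setT (fun w => circle_val (y w)).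
  exact: (measurableT_comp circle_val_measurable my).
apply: (measurable_countable_split (f := fun w => size (holes (pts (h w))))) => m.
pose g w := (gap_coord m k (h w)); pose c w := hole_coord k (h w).
have mg : measurable_fun setT g by exact: (measurableT_comp (gap_coord_measurable m k) mh).
have mc : measurable_fun setT (fun w => circle_val (to_circle (c w) : borel (circle beta))).
  apply: (measurableT_comp circle_val_measurable).
  apply: (measurableT_comp to_circle_measurable); exact: random_coord_measurable.
pose F w := ~~ ((k < m)%N) || (~~ (0 < g w < b) || (cw_dist (to_circle (c w)) (y w) < g w)).
have mF : measurable_fun setT F.
  apply: measurable_or => //; apply: measurable_or.
    by apply: measurable_neg; apply: measurable_and; exact: measurable_fun_ltr.
  by apply: measurable_fun_ltr => //; exact: cw_dist_measurable.
rewrite (_ : _ `&` _ = (fun w => size (holes (pts (h w)))) @^-1` [set m] `&` [set w | F w]).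
  by apply: measurableI; [exact: random_size_measurable|exact: measurable_bool].
apply/seteqP; split => w [/= hm]; rewrite (nth_ivl _ hm) /F; case: ifP => //= _;
  by move=> /arc_set_mkE Fw; split=> //; apply/arc_set_mkE.
Qed.

Lemma mem_pts_measurable (y : T -> borel (circle beta)) : measurable_fun setT y ->
  measurable [set w | pts (h w) (y w)].
Proof.
move=> my.
have mv : measurable_fun setT (fun w => circle_val (y w)).
  exact: (measurableT_comp circle_val_measurable my).
apply: (measurable_countable_split (f := fun w => size (holes (pts (h w))))) => m.
rewrite (_ : _ `&` _ = (fun w => size (holes (pts (h w)))) @^-1` [set m] `&`
   \bigcup_(j in `I_m) [set w | hole_coord j (h w) == circle_val (y w)]).
  apply: measurableI; first exact: random_size_measurable.
  apply: bigcup_measurable => j _; apply: measurable_bool.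
  by apply: measurable_fun_eqr => //; exact: random_coord_measurable.
apply/seteqP; split => w [/= hm].
  move=> hy; split => //.
  have yh : (y w : circle beta) \in holes (pts (h w)) by apply/mem_holes => //; exact: pts_finite.
  exists (index (y w : circle beta) (holes (pts (h w)))); first by rewrite /= -hm index_mem.
  by rewrite /= /hole_coord (nth_map point) ?index_mem // nth_index.
move=> [j /= jm /eqP]; rewrite /hole_coord (nth_map point) ?hm // => /val_inj <-.
split => //; apply/mem_holes; first exact: pts_finite.
by rewrite mem_nth // hm.
Qed.

(** Here the set [A w] varies with [w], so the measurability of the count in a fixed set does not
    apply. The points are enumerated instead as random points [y j], and each is tested for
    membership. *)
Lemma npts_random_measurable (A : T -> set (circle beta)) :
  (forall y : T -> borel (circle beta), measurable_fun setT y ->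
     measurable [set w | A w (y w)]) ->
  measurable_fun setT (fun w => npts (pts (h w) `&` A w)).
Proof.
move=> mA.
pose y j w : borel (circle beta) := to_circle (hole_coord j (h w)).
have my j : measurable_fun setT (y j).
  apply: (measurableT_comp to_circle_measurable); exact: random_coord_measurable.
apply: (measurable_fun_split (f := fun w => size (holes (pts (h w))))
  (h := fun m w => (\sum_(j < m) `[< A w (y j w) >])%N)) => [m|m|w].
- exact: random_size_measurable.
(* A second splitting, according to which of the [m] points belong to the random set. *)
- apply: (measurable_fun_split (f := fun w => [ffun j : 'I_m => `[< A w (y j w) >]])
    (h := fun v w => (\sum_(j < m) v j)%N)) => [v|v|w] //.
    rewrite (_ : _ @^-1` _ = \bigcap_(j : 'I_m) (if v j then [set w | A w (y j w)]
      else ~` [set w | A w (y j w)])).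
      apply: fin_bigcap_measurable => [|j _]; first exact: finite_finset.
      case: ifP => _; last apply: measurableC; exact: mA.
    apply/seteqP; split => w /=.
      by move=> <- j _; rewrite ffunE; case: ifPn => /asboolP.
    move=> Av; apply/ffunP => j; rewrite ffunE; have := Av j Logic.I.
    by case: (v j) => Aw; apply/asboolP.
  by apply: eq_bigr => j _; rewrite ffunE.
- rewrite npts_count -sum1_count big_mkcond (big_nth point) big_mkord.
  apply: eq_bigr => j _; rewrite /y /hole_coord (nth_map point) // circle_valK.
  by case: asboolP.
Qed.

End random_points.

(** * Vertices indexed by circle and rank *)

Section vertex_index.
Context {R : realType} {beta : {posnum R}} {d} {T : measurableType d} {n : nat}.
Local Notation S := (borel (arc_space beta)).
Variable H : 'I_n -> T -> set (circle beta).

(** The list of vertices with each interval replaced by its rank on its circle. It depends only on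
    the numbers of intervals, so on a fibre of [vertex_sizes] the vertex of rank [k] is always the
    interval of one given rank on one given circle. *)
Definition vertex_index (s : {ffun 'I_n -> nat}) : seq ('I_n * nat) :=
  [seq (i, a) | i <- enum 'I_n, a <- iota 0 (s i)].

Definition vertex_sizes (w : T) : {ffun 'I_n -> nat} :=
  [ffun i => size (intervals (H i w))].

Definition vertex_at (w : T) (p : 'I_n * nat) : 'I_n * arc_space beta :=
  (p.1, nth None (intervals (H p.1 w)) p.2).

Lemma vertices_map w :
  vertices H w = [seq vertex_at w p | p <- vertex_index (vertex_sizes w)].
Proof.
rewrite /vertices /vertex_index; elim: (enum 'I_n) => //= i s ->.
rewrite map_cat; congr cat; rewrite -map_comp ffunE.
rewrite -[in LHS](mkseq_nth None (intervals (H i w))) /mkseq -map_comp.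
exact: eq_map.
Qed.

Lemma onth_vertices w k :
  onth (vertices H w) k = omap (vertex_at w) (onth (vertex_index (vertex_sizes w)) k).
Proof. by rewrite vertices_map onth_map. Qed.

Lemma vertex_index_uniq s : uniq (vertex_index s).
Proof.
apply: allpairs_uniq_dep => [|i _|[i a] [j c] _ _ [-> ->]//].
- exact: enum_uniq.
- exact: iota_uniq.
Qed.

Lemma mem_vertex_index s p : p \in vertex_index s -> (p.2 < s p.1)%N.
Proof.
by move=> /allpairsPdep[i [a [_]]]; rewrite mem_iota add0n => /andP[_ ai] ->.
Qed.

Hypothesis fH : forall i w, finite_set (H i w).
Hypothesis mH : forall i, measurable_fun setT (cfg_of (H i)).

Lemma intervalsE i w : intervals (H i w) = ivl (cfg_of (H i) w).
Proof. by rewrite /ivl pts_cfg_of. Qed.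

Lemma vertex_sizes_measurable s : measurable (vertex_sizes @^-1` [set s]).
Proof.
rewrite (_ : _ @^-1` _ =
    \bigcap_i ((fun w => size (ivl (cfg_of (H i) w))) @^-1` [set s i])).
  apply: fin_bigcap_measurable => [|i _]; first exact: finite_finset.
  by have := measurableT_comp size_ivl_measurable (mH i) measurableT (I : measurable [set s i]);
    rewrite setTI.
apply/seteqP; split => w /=.
  by move=> <- i _; rewrite ffunE intervalsE.
by move=> hs; apply/ffunP => i; rewrite ffunE intervalsE; exact: hs.
Qed.

Lemma nth_vertex_types_measurable k :
  measurable_fun setT (fun w => nth point (vertex_types H w) k : S).
Proof.
apply: (measurable_fun_split (f := vertex_sizes)
  (h := fun s w => (if onth (vertex_index s) k is Some p
     then nth None (ivl (cfg_of (H p.1) w)) p.2 else None) : S)) => [s|s|w].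
- exact: vertex_sizes_measurable.
- case: (onth _ _) => [p|] //.
  exact: (measurableT_comp (nth_ivl_measurable p.2) (mH p.1)).
- rewrite /vertex_types -odflt_onth onth_map onth_vertices.
  by case: (onth _ _) => [p|] //=; rewrite intervalsE.
Qed.

Lemma size_vertex_types_measurable : measurable_fun setT (fun w => size (vertex_types H w)).
Proof.
apply: (measurable_fun_split (f := vertex_sizes) (h := fun s w => size (vertex_index s))) => //.
- exact: vertex_sizes_measurable.
- by move=> w; rewrite /vertex_types vertices_map !size_map.
Qed.

Lemma vertex_types_random_seq : random_seq (vertex_types H).
Proof.
split => [|i]; first exact: size_vertex_types_measurable.
exact: measurable_funTS (nth_vertex_types_measurable i).
Qed.

Variable L : {set 'I_n} -> T -> set (circle beta).
Hypothesis fL : forall e : {set 'I_n}, #|e| = 2%N -> forall w, finite_set (L e w).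
Hypothesis mL : forall e : {set 'I_n}, #|e| = 2%N -> measurable_fun setT (cfg_of (L e)).

Lemma edges_between_measurable (p q : 'I_n * nat) :
  measurable_fun setT (fun w => edges_between H L w (vertex_at w p) (vertex_at w q)).
Proof.
rewrite /edges_between /=; have [//|pq] := eqVneq p.1 q.1.
have e2 : #|[set p.1; q.1]%SET| = 2%N by rewrite cards2 pq.
rewrite (_ : (fun _ => _) = fun w => npts (pts (cfg_of (L [set p.1; q.1]%SET) w) `&`
    (vertex_set H w (vertex_at w p) `&` vertex_set H w (vertex_at w q)))); last first.
  by apply/funext => w; rewrite pts_cfg_of ?setIA //; exact: fL.
apply: npts_random_measurable; first exact: mL.
move=> y my.
have mV (r : 'I_n * nat) : measurable [set w | vertex_set H w (vertex_at w r) (y w)].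
  rewrite (_ : [set w | _] = [set w | arc_set (nth None (ivl (cfg_of (H r.1) w)) r.2) (y w)] `\`
      [set w | pts (cfg_of (H r.1) w) (y w)]).
    by apply: measurableD; [exact: mem_arc_measurable|exact: mem_pts_measurable].
  by apply/seteqP; split => w /=; rewrite pts_cfg_of // /vertex_set /= intervalsE.
exact: (measurableI _ _ (mV p) (mV q)).
Qed.

Lemma quantum_edges_measurable k l :
  measurable_fun setT (fun w => quantum_edges H L w k l).
Proof.
apply: (measurable_fun_split (f := vertex_sizes)
  (h := fun s w => match onth (vertex_index s) k, onth (vertex_index s) l with
     | Some p, Some q => edges_between H L w (vertex_at w p) (vertex_at w q)
     | _, _ => 0%N end)) => [s|s|w].
- exact: vertex_sizes_measurable.
- case: (onth _ k) (onth _ l) => [p|] [q|] //; exact: edges_between_measurable.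
- rewrite /quantum_edges !onth_vertices.
  by case: (onth _ k) (onth _ l) => [p|] [q|].
Qed.

End vertex_index.

(** A process is specified on families indexed by ordinals and disjoint throughout. Indices outside
    [D] therefore receive the empty set and the count 0, an event whose probability is 1. *)
Lemma poisson_counts {R : realType} {beta : {posnum R}} {d} {T : measurableType d}
    (P : probability T R) (c : R) (X : T -> set (circle beta)) (F : finType)
    (D : pred F) (A : F -> set (borel (circle beta))) (k : F -> nat) :
  poisson_process P c X -> (forall t, measurable (A t)) ->
  (forall t t' y, D t -> D t' -> A t y -> A t' y -> t = t') ->
  P [set w | forall t, D t -> npts (X w `&` A t) = k t] =
  (\prod_(t | D t) Po (c * circle_length (A t)) [set k t])%E.
Proof.
move=> [fX mX pX iX] mA tA.
pose A' (i : 'I_#|F|) := if D (enum_val i) then A (enum_val i) else set0.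
pose k' (i : 'I_#|F|) := if D (enum_val i) then k (enum_val i) else 0%N.
have mA' i : measurable (A' i) by rewrite /A'; case: ifP.
rewrite (_ : [set w | _] = [set w | forall i, npts (X w `&` A' i) = k' i]); last first.
  apply/seteqP; split => w /= h.
    move=> i; rewrite /A' /k'; case: ifPn => [/h//|_].
    by rewrite setI0 /npts fset_set0 cardfs0.
  by move=> t Dt; have := h (enum_rank t); rewrite /A' /k' enum_rankK Dt.
apply: (etrans (iX _ A' k' mA' _)).
  move=> i j _ _ [y []]; rewrite /A'; case: ifPn => // Di Ay; case: ifPn => // Dj Ay'.
  by apply: enum_val_inj; exact: (tA _ _ y).
have len0 : circle_length (set0 : set (circle beta)) = 0.
  by rewrite circle_lengthE measure0.
rewrite [RHS]big_mkcond [RHS](reindex _ (onW_bij _ (@enum_val_bij F))) /=.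
apply: eq_bigr => i _; apply: (etrans (pX _ _ (mA' i))).
rewrite /A' /k'; case: ifP => // _; rewrite len0 mulr0 PoE //.
by rewrite expr0 fact0 divr1 oppr0 expR0 mulr1.
Qed.

(** * Joint law of the edges for fixed holes *)

Section quantum_graph_law.
Context {R : realType} {beta : {posnum R}} {d} {T : measurableType d}.
Variables (P : probability T R) (lambda : R) (n : nat).
Variables (H : 'I_n -> T -> set (circle beta)).
Variables (L : {set 'I_n} -> T -> set (circle beta)).
Hypothesis HL : quantum_processes P lambda H L.
Hypothesis n0 : (0 < n)%N.
Local Notation index := ('I_n + {set 'I_n})%type.

Let fH i w : finite_set (H i w). Proof. exact: holes_finite HL i w. Qed.

Section fixed_holes.
Variable w1 : T.

Let N := size (vertices H w1).
Let u (k : 'I_N) : 'I_n * arc_space beta := tnth (in_tuple (vertices H w1)) k.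
Let V (k : 'I_N) : set (circle beta) := vertex_set H w1 (u k).
(** The holes are frozen at [w1] while the links vary with [w2]: this separates the two sources of
    randomness before Fubini's theorem. *)
Let E (w2 : T) (k l : 'I_N) : nat :=
  if (u k).1 == (u l).1 then 0%N
  else npts (L [set (u k).1; (u l).1]%SET w2 `&` (V k `&` V l)).

Lemma vertex_set_measurable k : measurable (V k : set (borel (circle beta))).
Proof.
apply: measurableD; first exact: arc_set_measurable.
by apply: finite_circle_measurable; exact: fH.
Qed.

Lemma vertex_set_disjoint k l y : (u k).1 = (u l).1 -> V k y -> V l y -> k = l.
Proof.
have N_idx : N = size (vertex_index (vertex_sizes H w1)).
  by rewrite /N vertices_map size_map.
pose p (j : 'I_N) := nth (Ordinal n0, 0%N) (vertex_index (vertex_sizes H w1)) j.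
have nthv a : (a < N)%N -> nth (Ordinal n0, None) (vertices H w1) a =
    vertex_at H w1 (nth (Ordinal n0, 0%N) (vertex_index (vertex_sizes H w1)) a).
  by rewrite N_idx => aN; rewrite vertices_map (nth_map (Ordinal n0, 0%N)).
have up j : u j = vertex_at H w1 (p j).
  by rewrite /u (tnth_nth (Ordinal n0, None)) /= nthv.
have pin j : p j \in vertex_index (vertex_sizes H w1) by rewrite mem_nth // -N_idx.
rewrite /V /vertex_set !up /= => kl [yk Hy] [yl _].
have := mem_vertex_index (pin k); have := mem_vertex_index (pin l).
rewrite !ffunE => sl sk.
have pkl : p k = p l.
  move: yk yl sk sl kl Hy; case: (p k) (p l) => [i a] [j a'] /= + + + + ij; subst j.
  move=> yk yl sk sl Hy; congr pair; exact: (intervals_disjoint (fH i w1) Hy sk sl yk yl).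
apply/val_inj/eqP; move/eqP: pkl; rewrite /p nth_uniq -?N_idx //.
exact: vertex_index_uniq.
Qed.

Lemma kappa_vertex_set k l :
  kappa ((u k).2, (u l).2) = circle_length (V k `&` V l).
Proof.
apply/EFin_inj; rewrite kappaE EFin_circle_length /=; last first.
  by apply: measurableI; exact: vertex_set_measurable.
rewrite -(@circle_measureD_finite _ _ _ (H (u k).1 w1 `|` H (u l).1 w1)).
- congr (circle_measure _); apply/seteqP; split => y.
    by move=> [[yk yl] /not_orP[hk hl]].
  by move=> [[yk hk] [yl hl]]; split => // -[].
- by apply: measurableI; exact: arc_set_measurable.
- by rewrite finite_setU; split; exact: fH.
Qed.

Variable m : nat -> nat -> nat.

Let D (e : {set 'I_n}) (t : 'I_N * 'I_N) : bool :=
  (t.1 < t.2)%N && ([set (u t.1).1; (u t.2).1]%SET == e).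

Let F (t : 'I_N * 'I_N) : \bar R :=
  Po (n%:R^-1 * circle_length (V t.1 `&` V t.2)) [set m t.1 t.2].

Let L_event (e : {set 'I_n}) : set T :=
  [set w2 | forall t, D e t -> npts (L e w2 `&` (V t.1 `&` V t.2)) = m t.1 t.2].

(* For a given pair of circles e, the sets V t.1 `&` V t.2 are disjoint. *)
Let D_inj e t t' y : D e t -> D e t' -> (V t.1 `&` V t.2) y -> (V t'.1 `&` V t'.2) y -> t = t'.
Proof.
case: t t' => [k l] [k' l'] /andP[/= kl /eqP <-] /andP[/= kl' /eqP ee] [yk yl] [yk' yl'].
have : (u k').1 \in [set (u k).1; (u l).1]%SET by rewrite -ee !inE eqxx.
have : (u l').1 \in [set (u k).1; (u l).1]%SET by rewrite -ee !inE eqxx orbT.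
have eqv a a' : V a y -> V a' y -> (u a).1 = (u a').1 -> a = a'.
  by move=> ya ya' aa'; exact: vertex_set_disjoint aa' ya ya'.
rewrite !inE => /orP[] /eqP lc /orP[] /eqP kc.
- by have lk := eqv _ _ yl' yk lc; have kk := eqv _ _ yk' yk kc;
    move: kl'; rewrite lk kk ltnn.
- by have lk := eqv _ _ yl' yk lc; have kk := eqv _ _ yk' yl kc;
    move: kl kl'; rewrite lk kk => /ltnW; rewrite leqNgt => /negPf ->.
- by have lk := eqv _ _ yl' yl lc; have kk := eqv _ _ yk' yk kc; rewrite lk kk.
- by have lk := eqv _ _ yl' yl lc; have kk := eqv _ _ yk' yl kc;
    move: kl'; rewrite lk kk ltnn.
Qed.

Lemma L_event_prob (e : {set 'I_n}) : #|e| = 2%N -> P (L_event e) = (\prod_(t | D e t) F t)%E.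
Proof.
move=> e2; have [_ PL _] := HL.
apply: (@poisson_counts _ _ _ _ P _ (L e) _ (D e) (fun t => V t.1 `&` V t.2) (fun t => m t.1 t.2) (PL e e2)).
  by move=> t; apply: measurableI; exact: vertex_set_measurable.
by move=> t t' y; exact: D_inj.
Qed.

Lemma L_event_sigma (e : {set 'I_n}) : #|e| = 2%N -> sigma_process (L e) (L_event e).
Proof.
move=> e2; have [_ PL _] := HL; have [fL _ _ _] := PL e e2.
pose C : set (@cfgT R beta) := \bigcap_(t in [set t | D e t])
  (fun h => npts (pts h `&` (V t.1 `&` V t.2))) @^-1` [set m t.1 t.2].
rewrite (_ : L_event e = cfg_of (L e) @^-1` C).
  apply: sigma_process_preimage => //.
  apply: fin_bigcap_measurable => [|t _]; first exact: finite_finset.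
  have mV : measurable (V t.1 `&` V t.2 : set (borel (circle beta))).
    by apply: measurableI; exact: vertex_set_measurable.
  by have := npts_measurable mV measurableT (I : measurable [set m t.1 t.2]); rewrite setTI.
by apply/seteqP; split => w /= hw t Dt; have := hw t Dt; rewrite /= pts_cfg_of.
Qed.

(** Independence has two sources: for one pair of circles the points are counted in disjoint sets,
    and different pairs of circles carry independent links. Two vertices of the same circle have
    disjoint point sets, so their factor is [Po 0], in agreement with the absence of edges between
    them. *)
Lemma edges_fixed_holes :
  P [set w2 | forall k l : 'I_N, (k < l)%N -> E w2 k l = m k l] =
  (\prod_(k < N) \prod_(l < N | (k < l)%N)
     Po (kappa ((u k).2, (u l).2) / n%:R) [set m k l])%E.
Proof.
have -> : (\prod_(k < N) \prod_(l < N | (k < l)%N)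
    Po (kappa ((u k).2, (u l).2) / n%:R) [set m k l] = \prod_(t : 'I_N * 'I_N | (t.1 < t.2)%N) F t)%E.
  rewrite pair_big_dep /=; apply: eq_bigr => -[k l] _ /=.
  by rewrite /F kappa_vertex_set mulrC.
have F0 (t : 'I_N * 'I_N) : (t.1 < t.2)%N -> (u t.1).1 = (u t.2).1 -> F t = Po 0 [set m t.1 t.2].
  move=> kl uu; rewrite /F (_ : _ `&` _ = set0).
    by rewrite circle_lengthE measure0 mulr0.
  apply/seteqP; split => // y [yk yl].
  by have kl' := vertex_set_disjoint uu yk yl; rewrite kl' ltnn in kl.
(* If [m] prescribes an edge between two vertices of the same circle, both sides are 0. *)
have [same|] := pselect (forall t : 'I_N * 'I_N, (t.1 < t.2)%N ->
    (u t.1).1 = (u t.2).1 -> m t.1 t.2 = 0%N); last first.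
  move=> /existsNP[t /not_implyP[kl /not_implyP[uu mt]]].
  rewrite (_ : [set w2 | _] = set0); last first.
    apply/seteqP; split => // w2 /(_ t.1 t.2 kl); rewrite /E uu eqxx => mt'.
    by apply: mt.
  rewrite measure0 (bigD1 t) //= F0 // PoE // expr0n.
  by move/eqP/negPf: mt => ->; rewrite mul0r mul0r mul0e.
pose J : {set index} := (@inr 'I_n {set 'I_n}) @: [set e : {set 'I_n} | #|e| == 2%N]%SET.
have mJ z : z \in J -> exists2 e, z = inr e & #|e| = 2%N.
  by move=> /imsetP[e]; rewrite inE => /eqP e2 ->; exists e.
pose EE (z : index) := if z is inr e then L_event e else setT.
have -> : [set w2 | forall k l : 'I_N, (k < l)%N -> E w2 k l = m k l] =
    \bigcap_(z in [set` J]) EE z.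
  apply/seteqP; split => w2 /= h.
    move=> z /= /mJ[e -> e2] t /andP[kl /eqP te]; rewrite -(h _ _ kl) /E -te.
    case: eqP => // uu; move: e2; rewrite -te uu finset.setUid cards1 //.
  move=> k l kl; rewrite /E; case: eqP => [uu|/eqP uu].
    by rewrite (same (k, l) kl uu).
  have eJ : inr [set (u k).1; (u l).1]%SET \in J.
    by rewrite imset_f // inE cards2 uu.
  by have := h _ eJ (k, l); rewrite /D /= kl eqxx => /(_ isT).
have [_ _ indep] := HL.
rewrite (indep J EE); last 2 first.
- by apply/fintype.subsetP => z /mJ[e -> e2]; rewrite inE e2.
- by move=> z /mJ[e -> e2] /=; exact: L_event_sigma.
rewrite big_imset /=; last by move=> e e' _ _ [].
transitivity (\prod_(e : {set 'I_n} | #|e| == 2%N) \prod_(t | D e t) F t)%E.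
  by apply: eq_big => [e|e]; rewrite inE // => /eqP e2; exact: L_event_prob.
(* The pairs of vertices are grouped by the set of their circles. Two vertices of one circle give a
   set of cardinality 1, absent from the left side; their factors are 1 by [same]. *)
rewrite [RHS](partition_big (fun t : 'I_N * 'I_N => [set (u t.1).1; (u t.2).1]%SET) xpredT) //=.
rewrite [LHS]big_mkcond; apply: eq_bigr => e _; case: ifPn => // e2.
rewrite big1 // => t /andP[kl /eqP te].
have uu : (u t.1).1 = (u t.2).1.
  by apply/eqP; apply: contraNT e2 => uu; rewrite -te cards2 uu.
by rewrite F0 // same // PoE // expr0 fact0 divr1 oppr0 expR0 mulr1.
Qed.

End fixed_holes.
End quantum_graph_law.

(** * Conditional law of the edges given the vertex types *)

Section quantum_is_GV.
Context {R : realType} {beta : {posnum R}} {d} {T : measurableType d}.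
Variables (P : probability T R) (lambda : R) (n : nat).
Variables (H : 'I_n -> T -> set (circle beta)).
Variables (L : {set 'I_n} -> T -> set (circle beta)).
Hypothesis HL : quantum_processes P lambda H L.
Hypothesis n0 : (0 < n)%N.
Local Notation index := ('I_n + {set 'I_n})%type.
Local Notation S := (borel (arc_space beta)).

Let fH i w : finite_set (H i w). Proof. exact: holes_finite HL i w. Qed.
Let mH i : measurable_fun setT (cfg_of (H i)).
Proof. exact: cfg_holes_measurable HL i. Qed.
Let fL (e : {set 'I_n}) : #|e| = 2%N -> forall w, finite_set (L e w).
Proof. by move=> e2; case: HL => _ + _ => /(_ e e2)[]. Qed.
Let mL (e : {set 'I_n}) : #|e| = 2%N -> measurable_fun setT (cfg_of (L e)).
Proof.
by move=> e2; case: HL => _ + _ => /(_ e e2)[? ? _ _]; exact: cfg_of_measurable.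
Qed.

(* T with the sigma-algebra of the holes, resp. of the links: P is mapped to a
   product measure by w |-> (w, w). *)
Let JH : {set index} := (@inl 'I_n {set 'I_n}) @: [set: 'I_n]%SET.
Let JL : {set index} := (@inr 'I_n {set 'I_n}) @: [set e : {set 'I_n} | #|e| == 2%N]%SET.
Let GH := block_events (process_algebra H L) JH.
Let GL := block_events (process_algebra H L) JL.
Let TH : measurableType _ := g_sigma_algebraType GH.
Let TL : measurableType _ := g_sigma_algebraType GL.

Let block_measurable (J : {set index}) : J \subset process_index n ->
  block_events (process_algebra H L) J `<=` measurable.
Proof.
move=> JD _ [E FE ->]; apply: fin_bigcap_measurable => [|z /= zJ].
  exact: finite_finset.
have := fintype.subsetP JD z zJ; move: (FE z zJ); case: z {zJ} => [i|e]; rewrite inE.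
  move=> Ei _; move: Ei; apply: sigma_process_measurable.
  by case: HL => /(_ i)[].
move=> Ee /eqP e2; move: Ee; apply: sigma_process_measurable.
by case: HL => _ /(_ e e2)[].
Qed.

Let JHD : JH \subset process_index n.
Proof. by apply/fintype.subsetP => z /imsetP[i _ ->]; rewrite inE. Qed.

Let JLD : JL \subset process_index n.
Proof. by apply/fintype.subsetP => z /imsetP[e]; rewrite inE => e2 ->; rewrite inE. Qed.

Let idH_measurable : measurable_fun setT (idfun : T -> TH).
Proof.
move=> _ A sA; rewrite setTI; move: sA.
by apply: smallest_sub; [exact: sigma_algebra_measurable|exact: block_measurable].
Qed.

Let idL_measurable : measurable_fun setT (idfun : T -> TL).
Proof.
move=> _ A sA; rewrite setTI; move: sA.
by apply: smallest_sub; [exact: sigma_algebra_measurable|exact: block_measurable].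
Qed.

Let indepHL (A : set TH) (B : set TL) : measurable A -> measurable B ->
  P (idfun @^-1` A `&` idfun @^-1` B) = (P (idfun @^-1` A) * P (idfun @^-1` B))%E.
Proof.
move=> sA sB; apply: (process_blocks_indep HL JHD JLD) => //.
by move=> z /imsetP[i _ ->]; apply/negP => /imsetP[].
Qed.

Let mHTH i : measurable_fun setT (cfg_of (H i) : TH -> cfgT).
Proof.
move=> _ E mE; rewrite setTI; apply: sub_sigma_algebra.
apply: (@block_event1 _ _ _ _ _ _ _ _ (inl i)); first by rewrite imset_f ?inE.
exact: sigma_process_preimage.
Qed.

Let mLTL (e : {set 'I_n}) : #|e| = 2%N -> measurable_fun setT (cfg_of (L e) : TL -> cfgT).
Proof.
move=> e2 _ E mE; rewrite setTI; apply: sub_sigma_algebra.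
apply: (@block_event1 _ _ _ _ _ _ _ _ (inr e)); first by rewrite imset_f ?inE ?e2.
by apply: sigma_process_preimage => //; exact: fL.
Qed.

(** On the product space the holes are read on the first coordinate and the links on the second;
    along the diagonal this is the original graph. *)
Let H' i (p : TH * TL) := H i p.1.
Let L' e (p : TH * TL) := L e p.2.

Lemma quantum_edges_product_measurable k l :
  measurable_fun setT (fun p : TH * TL => quantum_edges H' L' p k l).
Proof.
have fH' i p : finite_set (H' i p) by exact: fH.
have mH' i : measurable_fun setT (cfg_of (H' i)).
  exact: (measurableT_comp (mHTH i) measurable_fst).
have fL' (e : {set 'I_n}) : #|e| = 2%N -> forall p, finite_set (L' e p).
  by move=> e2 p; exact: fL.
have mL' (e : {set 'I_n}) : #|e| = 2%N -> measurable_fun setT (cfg_of (L' e)).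
  by move=> e2; exact: (measurableT_comp (mLTL e2) measurable_snd).
exact: (quantum_edges_measurable fH' mH' fL' mL').
Qed.

Let types_random_seq : random_seq (vertex_types H : TH -> seq (arc_space beta)).
Proof. by apply: vertex_types_random_seq => //; exact: fH. Qed.

(** The types of the vertices are functions of the holes alone; hence the conditioning event [B] can
    be imposed on the first factor of the product. *)
Let sigma_seq_TH (B : set T) : sigma_seq (vertex_types H) B -> measurable (B : set TH).
Proof.
have [ms mx] := types_random_seq.
apply: smallest_sub; first exact: sigma_algebra_measurable.
have msize k : measurable ([set w : TH | (k < size (vertex_types H w))%N]).
  by have := ms measurableT [set j | (k < j)%N] I; rewrite setTI.
move=> E [[N ->]|[i [A [mA ->]]]].
  by have := ms measurableT [set N] I; rewrite setTI.
exact: (mx i (msize i) A mA).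
Qed.

(** The event is the trace of [Phi] on the diagonal, so by [joint_law] its probability is the
    product measure of [Phi]. For holes [w] compatible with [B] and [N], the section of [Phi] is the
    event of [edges_fixed_holes]; for the other [w] it is empty. *)
Lemma quantum_is_GV : is_GV P (vertex_types H) n (@kappa R beta) (quantum_edges H L).
Proof.
split.
  move=> i j k.
  have ms := size_vertex_types_measurable fH mH.
  have me := quantum_edges_measurable fH mH fL mL i j.
  rewrite (_ : [set w | _] = [set w | (i < j < size (vertex_types H w))%N] `&`
     [set w | quantum_edges H L w i j = k]) //.
  apply: measurableI.
    by have := ms measurableT [set s | (i < j < s)%N] I; rewrite setTI.
  by have := me measurableT [set k] I; rewrite setTI.
move=> B N m sB.
pose Phi : set (TH * TL) := [set p | (B p.1 /\ size (vertex_types H p.1) = N) /\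
  forall i j, (i < j < N)%N -> quantum_edges H' L' p i j = m i j].
have mB := sigma_seq_TH sB.
have mBN : measurable (B `&` [set w | size (vertex_types H w) = N] : set TH).
  apply: measurableI => //.
  by have [ms _] := types_random_seq; have := ms measurableT [set N] I; rewrite setTI.
have mPhi : measurable Phi.
  rewrite (_ : Phi = ((B `&` [set w | size (vertex_types H w) = N]) `*` setT) `&`
     \bigcap_(t in [set t : nat * nat | (t.1 < t.2 < N)%N])
       (fun p => quantum_edges H' L' p t.1 t.2) @^-1` [set m t.1 t.2]).
    apply: measurableI; first exact: measurableX.
    rewrite -[X in measurable X]setCK setC_bigcap; apply: measurableC.
    apply: countable_bigcup_measurable => [|[i j] _]; first exact: countableP.
    apply: measurableC.
    by have := quantum_edges_product_measurable i j measurableT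
      (Logic.I : measurable [set m i j]); rewrite setTI.
  apply/seteqP; split => p /=.
    by move=> [[Bp sp] hp]; split => // -[i j] /= ij; exact: hp.
  by move=> [[[Bp sp] _] hp]; split => // i j ij; exact: (hp (i, j)).
have -> : B `&` [set w | size (vertex_types H w) = N /\
    (forall i j, (i < j < N)%N -> quantum_edges H L w i j = m i j)] =
    [set w | Phi (idfun w, idfun w)].
  by apply/seteqP; split => w /=; [move=> [Bw [sw hw]]|move=> [[Bw sw] hw]].
rewrite (joint_law idH_measurable idL_measurable indepHL mPhi).
transitivity (\int[P]_w (law P idL_measurable (xsection Phi w)))%E.
  apply: (ge0_integral_law P idH_measurable (f := fun x => law P idL_measurable (xsection Phi x))) => //.
  exact: measurable_fun_xsection.
rewrite [RHS]integral_mkcond; apply: eq_integral => w _; rewrite patchE /=.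
case: ifPn => [|/negP wB]; last first.
  rewrite lawE (_ : _ @^-1` _ = set0) ?measure0 //.
  apply/seteqP; split => // w2 /=; rewrite /xsection /= inE => -[[Bw sw] _].
  by apply: wB; rewrite inE.
rewrite inE => -[Bw /= sw]; rewrite lawE.
have sv : size (vertices H w) = N by rewrite -sw size_map.
subst N.
have nthv (k : 'I_(size (vertices H w))) :
    nth point (vertex_types H w) k = (tnth (in_tuple (vertices H w)) k).2.
  by rewrite (nth_map (Ordinal n0, None)) // (tnth_nth (Ordinal n0, None)).
rewrite -sv.
under eq_bigr => k _ do under eq_bigr => l _ do rewrite !nthv.
rewrite -(edges_fixed_holes HL n0 w m); congr (P _).
have onthv (k : 'I_(size (vertices H w))) :
    onth (vertices H w) k = Some (tnth (in_tuple (vertices H w)) k).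
  case onthk : (onth (vertices H w) k) => [x|].
    by congr Some; rewrite (tnth_nth (Ordinal n0, None)); exact/esym/onth_nth.
  by have := onthTE (vertices H w) k; rewrite onthk ltn_ord.
have qe w2 (k l : 'I_(size (vertices H w))) : quantum_edges H' L' (w, w2) k l =
    edges_between H' L' (w, w2) (tnth (in_tuple (vertices H w)) k)
      (tnth (in_tuple (vertices H w)) l).
  by rewrite /quantum_edges -[vertices H' (w, w2)]/(vertices H w) !onthv.
apply/seteqP; split => w2 /=; rewrite /xsection /= inE.
  move=> [_ hw] k l kl; have := hw k l; rewrite kl -sv ltn_ord => /(_ isT) <-.
  by rewrite qe /edges_between; case: ifP => // _; rewrite setIA.
move=> hw; split => // i j /andP[ij jN]; rewrite -sv in jN.
rewrite -(hw (Ordinal (ltn_trans ij jN)) (Ordinal jN) ij).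
rewrite (qe w2 (Ordinal (ltn_trans ij jN)) (Ordinal jN)) /edges_between.
by case: ifP => // _; rewrite setIA.
Qed.

End quantum_is_GV.

Lemma Po_measurable {R : realType} {d} {T : measurableType d} (D : set T)
    (f : T -> R) (k : nat) : measurable_fun D f -> (forall w, D w -> 0 <= f w) ->
  measurable_fun D (fun w => Po (f w) [set k]).
Proof.
move=> mf f0.
apply: (eq_measurable_fun (fun w => (f w ^+ k / k`!%:R * expR (- f w))%:E)).
  by move=> w; rewrite inE => Dw; rewrite PoE // f0.
apply/measurable_EFinP; apply: measurable_funM.
  by apply: measurable_funM => //; exact: measurable_funX.
by apply: measurableT_comp => //; exact: measurableT_comp.
Qed.

Lemma eq_integral_split {d} {T : measurableType d} {R : realType}
    (P : {measure set T -> \bar R}) (N : T -> nat) (f g : T -> \bar R) :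
  measurable_fun setT N -> measurable_fun setT f -> measurable_fun setT g ->
  (forall w, 0 <= f w)%E -> (forall w, 0 <= g w)%E ->
  (forall k, \int[P]_(w in [set w | N w = k]) f w = \int[P]_(w in [set w | N w = k]) g w)%E ->
  (\int[P]_w f w = \int[P]_w g w)%E.
Proof.
move=> mN mf mg f0 g0 fg.
have TE : [set: T] = \bigcup_k [set w | N w = k] by apply/seteqP; split=> // w _; exists (N w).
have mk k : measurable [set w | N w = k].
  by have := mN measurableT [set k] I; rewrite setTI.
have tN : trivIset setT (fun k => [set w | N w = k]).
  by move=> i j _ _ [w [/= <- <-]].
rewrite TE !ge0_integral_bigcup //; last 2 first.
- by rewrite -TE.
- by rewrite -TE.
by apply: eq_eseriesr => k _.
Qed.

(** * The expected number of edges *)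

Section expected_edges.
Context {R : realType} {S : pmetricType R} {d} {T : measurableType d}.
Variables (P : probability T R) (x : T -> seq S) (n : nat) (kappa : S * S -> R).
Variable E : T -> nat -> nat -> nat.
Hypothesis rx : random_seq x.
Hypothesis kappa0 : forall p, 0 <= kappa p.
Hypothesis mkappa : measurable_fun [set: borel S * borel S] kappa.
Hypothesis GV : is_GV P x n kappa E.

Let A N := [set w | size (x w) = N].

Let mA N : measurable (A N).
Proof. by have := rx.1 measurableT [set N] I; rewrite setTI. Qed.

Let F w i j : R := kappa (nth point (x w) i, nth point (x w) j) / n%:R.

Let F0 w i j : 0 <= F w i j.
Proof. by rewrite divr_ge0. Qed.

(** [random_seq] controls the point of rank [k] only where it exists; elsewhere [nth] returns the
    constant [point]. *)
Let mnth k : measurable_fun setT (fun w => nth point (x w) k : borel S).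
Proof.
have ms : measurable [set w | (k < size (x w))%N].
  by have := rx.1 measurableT [set s | (k < s)%N] I; rewrite setTI.
move=> _ Y mY; rewrite setTI.
rewrite (_ : _ @^-1` Y = ([set w | (k < size (x w))%N] `&` (fun w => nth point (x w) k) @^-1` Y) `|`
    (~` [set w | (k < size (x w))%N] `&` [set _ | Y point])).
  apply: measurableU; first exact: rx.2.
  apply: measurableI; first exact: measurableC.
  have [Yp|Yp] := pselect (Y point).
    by rewrite (_ : [set _ | _] = setT) //; apply/seteqP; split.
  by rewrite (_ : [set _ | _] = set0) //; apply/seteqP; split.
apply/seteqP; split => w /=.
  have [kw Yk|kw] := ltnP k (size (x w)); first by left.
  by rewrite nth_default // => Yp; right; split => //; apply/negP; rewrite -leqNgt.
by move=> [[]//|[/negP]]; rewrite -leqNgt => kw Yp; rewrite nth_default.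
Qed.

Let mF i j : measurable_fun setT (fun w => F w i j).
Proof.
apply: measurable_funM => //; apply: (measurableT_comp mkappa).
by apply: measurable_fun_pair; exact: mnth.
Qed.

Section fixed_size.
Variable N : nat.
Local Notation pairs := ('I_N * 'I_N)%type.

Let mE (t : pairs) k : (t.1 < t.2)%N -> measurable (A N `&` [set w | E w t.1 t.2 = k]).
Proof.
move=> tt; rewrite (_ : _ `&` _ = A N `&` [set w | (t.1 < t.2 < size (x w))%N /\ E w t.1 t.2 = k]).
  by apply: measurableI => //; exact: GV.1.
apply/seteqP; split => w /= [sw]; first by move=> Ew; rewrite sw tt ltn_ord.
by move=> [_ Ew].
Qed.

Let event (Q : pred pairs) (m : pairs -> nat) :=
  A N `&` [set w | forall t, Q t -> E w t.1 t.2 = m t].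

Let mevent (Q : pred pairs) m : (forall t, Q t -> (t.1 < t.2)%N) -> measurable (event Q m).
Proof.
move=> Qlt.
rewrite (_ : event Q m = A N `&` \bigcap_(t in [set t | Q t]) (A N `&` [set w | E w t.1 t.2 = m t])).
  apply: measurableI => //; apply: fin_bigcap_measurable => [|t Qt]; first exact: finite_finset.
  by apply: mE; exact: Qlt.
apply/seteqP; split => w /= [sw h]; split => // t Qt; first by split => //; exact: h.
by have [] := h t Qt.
Qed.

Let dens (Q : pred pairs) (m : pairs -> nat) w : \bar R :=
  (\prod_(t | Q t) Po (F w t.1 t.2) [set m t])%E.

Let mdens (Q : pred pairs) m : measurable_fun setT (dens Q m).
Proof.
rewrite /dens; elim: (index_enum _) => [|t s IHs].
  by under eq_fun do rewrite big_nil; exact: measurable_cst.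
under eq_fun do rewrite big_cons.
case: (Q t) => //; apply: emeasurable_funM => //.
by apply: Po_measurable.
Qed.

Let dens0 Q m w : (0 <= dens Q m w)%E.
Proof. by apply: prode_ge0. Qed.

Let dens_fin Q m w : dens Q m w \is a fin_num.
Proof. by apply: prode_fin_num => t _; exact: fin_num_measure. Qed.

Let marginal_all (Q : pred pairs) (m : pairs -> nat) :
  (forall t, Q t = (t.1 < t.2)%N) ->
  P (event Q m) = (\int[P]_(w in A N) dens Q m w)%E.
Proof.
move=> QE; have [_ GV2] := GV.
(* [is_GV] prescribes counts by a function on [nat], whereas [m] lives on pairs of ordinals: it is
   extended by 0. *)
pose m' i j := if insub i is Some i' then if insub j is Some j' then m (i', j') else 0%N else 0%N.
have m'E (i j : 'I_N) : m' i j = m (i, j) by rewrite /m' !valK.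
have sT : sigma_seq x setT.
  by rewrite /sigma_seq; set G := (X in <<s X >>); exact: (@measurableT _ (g_sigma_algebraType G)).
have := GV2 setT N m' sT; rewrite !setTI => h.
transitivity (P [set w | size (x w) = N /\ (forall i j, (i < j < N)%N -> E w i j = m' i j)]).
  congr (P _); apply/seteqP; split => w /= [sw hw]; split => //.
    move=> i j /andP[ij jN]; have iN := ltn_trans ij jN.
    have := hw (Ordinal iN, Ordinal jN); rewrite QE => /(_ ij) /= ->.
    by rewrite -(m'E (Ordinal iN) (Ordinal jN)).
  by move=> [i j]; rewrite QE /= => ij; rewrite -m'E; apply: hw; rewrite ij ltn_ord.
rewrite h; apply: eq_integral => w _; rewrite /dens pair_big_dep /=.
by apply: eq_big => [[i j]|[i j] _] /=; rewrite ?QE ?m'E.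
Qed.

(* The laws of the pairs of s are summed out one by one. *)
Let marginal (s : seq pairs) (Q : pred pairs) (m : pairs -> nat) :
  (forall t, Q t = (t.1 < t.2)%N && (t \notin s)) ->
  P (event Q m) = (\int[P]_(w in A N) dens Q m w)%E.
Proof.
elim: s Q m => [|t0 s IHs] Q m Qs_def.
  by apply: marginal_all => t; rewrite Qs_def andbT.
pose Qs (t : pairs) := (t.1 < t.2)%N && (t \notin s).
have QE t : Q t = Qs t && (t != t0).
  by rewrite Qs_def /Qs inE negb_or andbCA andbC.
(* If [t0] is not an increasing pair, or occurs again in [s], then [Q] already excludes exactly the
   pairs of [s] and there is nothing to sum. *)
have [Qt0|nQt0] := boolP (Qs t0); last first.
  apply: IHs => t; rewrite QE; case: eqP => [->|]; last by rewrite andbT.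
  by rewrite andbF -/(Qs t0) (negPf nQt0).
pose mk k t := if t == t0 then k else m t.
have eE : event Q m = \bigcup_k event Qs (mk k).
  apply/seteqP; split => w.
    move=> [sw hw]; exists (E w t0.1 t0.2) => //; split => // t Qst.
    by rewrite /mk; case: eqP => [->//|/eqP tt0]; apply: hw; rewrite QE Qst.
  move=> [k _ [sw hw]]; split => // t; rewrite QE => /andP[Qst tt0].
  by rewrite (hw t Qst) /mk (negPf tt0).
have Qs_lt t : Qs t -> (t.1 < t.2)%N by move=> /andP[].
have densE k w : dens Qs (mk k) w = (Po (F w t0.1 t0.2) [set k] * dens Q m w)%E.
  rewrite /dens (bigD1 t0) //= /mk eqxx; congr (_ * _)%E.
  by apply: eq_big => [t|t /andP[_ /negPf ->]] //; rewrite QE.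
rewrite eE measure_semi_bigcup; last 3 first.
- by move=> k; exact: mevent.
- move=> i j _ _ [w [[_ hi] [_ hj]]].
  by have := hi t0 Qt0; have := hj t0 Qt0; rewrite /mk eqxx => -> ->.
- by apply: bigcupT_measurable => k; exact: mevent.
rewrite (eq_eseriesr (g := fun k => \int[P]_(w in A N) dens Qs (mk k) w)%E); last first.
  by move=> k _; exact: IHs.
rewrite -integral_nneseries //; last first.
  by move=> k; apply: measurable_funTS; exact: mdens.
apply: eq_integral => w _; under eq_eseriesr do rewrite densE muleC.
by rewrite -(fineK (dens_fin Q m w)) nneseriesZl // sum_Po mule1.
Qed.

(** This is [marginal] for the list of all pairs other than [t]. *)
Lemma edge_prob (t : pairs) k : (t.1 < t.2)%N ->
  P (A N `&` [set w | E w t.1 t.2 = k]) =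
  (\int[P]_(w in A N) Po (F w t.1 t.2) [set k])%E.
Proof.
move=> tt.
pose Q : pred pairs := fun t' => t' == t.
have QE t' : Q t' = (t'.1 < t'.2)%N && (t' \notin [seq t' <- enum {: pairs} | t' != t]).
  rewrite /Q mem_filter mem_enum andbT negbK.
  by case: eqP => [->|]; rewrite ?tt ?andbF.
have := marginal (fun=> k) QE.
rewrite (_ : event _ _ = A N `&` [set w | E w t.1 t.2 = k]) => [->|].
  apply: eq_integral => w _; by rewrite /dens (big_pred1 t).
apply/seteqP; split => w [sw h]; split => //.
  by apply: h; rewrite /Q.
by move=> t' /eqP ->.
Qed.

Lemma edge_mean (t : pairs) : (t.1 < t.2)%N ->
  (\int[P]_(w in A N) ((E w t.1 t.2)%:R)%:E = \int[P]_(w in A N) (F w t.1 t.2)%:E)%E.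
Proof.
move=> tt.
rewrite (ge0_integral_nat P (g := fun k => (k%:R)%:E)) //; last by move=> k; exact: mE.
transitivity (\sum_(0 <= k <oo) \int[P]_(w in A N) (k%:R%:E * Po (F w t.1 t.2) [set k]))%E.
  apply: eq_eseriesr => k _; rewrite ge0_integralZl //; last first.
    by apply: measurable_funTS; apply: Po_measurable.
  by congr (_ * _)%E; exact: edge_prob.
rewrite -integral_nneseries //; last 2 first.
- move=> k; apply: emeasurable_funM => //; apply: measurable_funTS.
  by apply: Po_measurable.
- by move=> k w _; rewrite mule_ge0 // lee_fin.
by apply: eq_integral => w _; rewrite Po_mean.
Qed.

Let edge (t : pairs) w : \bar R :=
  if (t.1 < t.2)%N then ((E w t.1 t.2)%:R)%:E else 0%E.

Let edge_measurable (t : pairs) : measurable_fun (A N) (edge t).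
Proof.
rewrite /edge; case tt: (t.1 < t.2)%N => // _ Y mY.
rewrite (_ : _ `&` _ = \bigcup_(k in [set k : nat | Y (k%:R)%:E])
    (A N `&` [set w | E w t.1 t.2 = k])).
  by apply: bigcup_measurable => k _; exact: mE.
apply/seteqP; split => [w [sw Yw]|w [k Yk [sw Ew]]]; first by exists (E w t.1 t.2).
by split => //=; rewrite Ew.
Qed.

Let num_edgesE w : A N w ->
  ((num_edges (size (x w)) (E w))%:R : R)%:E = (\sum_t edge t w)%E.
Proof.
move=> ->; rewrite /num_edges pair_big_dep /= natr_sum -sumEFin big_mkcond.
by apply: eq_bigr => -[].
Qed.

Lemma num_edges_measurable :
  measurable_fun (A N) (fun w => ((num_edges (size (x w)) (E w))%:R : R)%:E).
Proof.
have ms : measurable_fun (A N) (fun w => (\sum_t edge t w)%E).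
  by apply: emeasurable_sum => t; exact: edge_measurable.
apply: eq_measurable_fun ms => w; rewrite inE => sw.
by rewrite num_edgesE.
Qed.

Lemma num_edges_mean (c : R) :
  (forall w, A N w -> \sum_(i < N) \sum_(j < N | (i < j)%N)
     kappa (nth point (x w) i, nth point (x w) j) = c) ->
  (\int[P]_(w in A N) ((num_edges (size (x w)) (E w))%:R)%:E =
   \int[P]_(w in A N) (c / n%:R)%:E)%E.
Proof.
move=> sumc.
transitivity (\int[P]_(w in A N) \sum_t edge t w)%E.
  by apply: eq_integral => w; rewrite inE => sw; rewrite num_edgesE.
pose f (t : pairs) w : \bar R := if (t.1 < t.2)%N then (F w t.1 t.2)%:E else 0%E.
transitivity (\int[P]_(w in A N) \sum_t f t w)%E; last first.
  apply: eq_integral => w; rewrite inE => sw.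
  rewrite -(sumc w sw) mulr_suml -sumEFin.
  under [RHS]eq_bigr do rewrite mulr_suml -sumEFin.
  by rewrite pair_big_dep /= [RHS]big_mkcond; apply: eq_bigr => -[].
rewrite !ge0_integral_sum //.
- apply: eq_bigr => t _; rewrite /edge /f; case tt: (t.1 < t.2)%N; last by rewrite !integral0.
  exact: edge_mean.
- move=> t; rewrite /f; case: (t.1 < t.2)%N => //.
  by apply/measurable_EFinP; apply: measurable_funTS.
- by move=> t w _; rewrite /f; case: ifP => // _; rewrite lee_fin.
- by move=> t w _; rewrite /edge; case: ifP => // _; rewrite lee_fin.
Qed.

End fixed_size.

(** Given [x], the mean number of edges is the sum of [kappa] over the pairs of vertices, divided by
    [n]. This sum being the constant [c], the contributions of the different sizes reassemble into
    the integral of a constant. *)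
Lemma expected_num_edges (c : R) : 0 <= c ->
  (forall w, \sum_(i < size (x w)) \sum_(j < size (x w) | (i < j)%N)
     kappa (nth point (x w) i, nth point (x w) j) = c) ->
  'E_P[fun w => (num_edges (size (x w)) (E w))%:R]%E = (c / n%:R)%:E.
Proof.
move=> c0 sumc; rewrite unlock.
transitivity (\int[P]_w (c / n%:R)%:E)%E; last first.
  rewrite integral_cst // [X in (_ * X)%E](_ : _ = 1%E) ?mule1 //.
  exact: probability_setT.
apply: (eq_integral_split (N := fun w => size (x w))) => //.
- exact: rx.1.
- move=> _ Y mY; rewrite setTI.
  apply: (measurable_countable_split (f := fun w => size (x w))) => N.
  exact: (num_edges_measurable (mA N) mY).
- by move=> w; rewrite lee_fin divr_ge0.
- move=> N; apply: num_edges_mean => w /= sw.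
  by rewrite -(sumc w) sw.
Qed.

End expected_edges.

(** * Sums and integral of the kernel *)

Lemma sum_pairs_sym {R : realType} N (k : 'I_N -> 'I_N -> R) :
  (forall i j, k i j = k j i) ->
  \sum_i \sum_j k i j = 2 * (\sum_(i < N) \sum_(j < N | (i < j)%N) k i j) + \sum_i k i i.
Proof.
move=> kC.
have split_row i : \sum_j k i j =
    \sum_(j < N | (i < j)%N) k i j + \sum_(j < N | (j < i)%N) k i j + k i i.
  rewrite (bigD1 i) //= addrC; congr (_ + _).
  rewrite (bigID (fun j : 'I_N => (i < j)%N)) /=; congr (_ + _); apply: eq_bigl => j.
    by rewrite -(inj_eq val_inj) /=; case: ltngtP.
  by rewrite -(inj_eq val_inj) /=; case: ltngtP.
rewrite (eq_bigr _ (fun i _ => split_row i)) !big_split /=; congr (_ + _).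
rewrite mulr_natl mulr2n; congr (_ + _).
rewrite (exchange_big_dep xpredT) //=; apply: eq_bigr => i _.
by apply: eq_bigr => j _.
Qed.

Section kappa_sums.
Context {R : realType} {beta : {posnum R}}.
Local Notation b := (beta%:num).
Local Notation S := (borel (arc_space beta)).

Lemma kappa_diag (I : arc_space beta) : kappa (I, I) = kappa (None, I).
Proof. by rewrite /kappa /= setIid setTI. Qed.

(** Measurability is for the product of the two Borel sigma-algebras, whereas continuity concerns
    the open sets of the product topology. The Lipschitz bound in the first variable bridges the
    two, and continuity is used only in the second variable. *)
Lemma kappa_measurable : measurable_fun [set: S * S] (@kappa R beta).
Proof.
have [D cD dD] := @arc_dense R beta.
apply: (lipschitz_measurable cD dD (C := 16)) => //; first exact: kappa_lipschitz.
move=> s.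
have ks : continuous (fun t : arc_space beta => kappa (s, t)).
  move=> t; apply: (@continuous_comp _ _ _ (fun t : arc_space beta => (s, t)) (@kappa R beta) t).
    move=> B [[C D'] /= [Cs Dt] CDB]; apply: filterS Dt => t' Dt'.
    by apply: CDB; split => //; exact: nbhs_singleton Cs.
  exact: kappa_continuous.
exact: continuous_measurable_borel ks.
Qed.

Section pairs.
Context {d} {T : measurableType d}.
Variables (P : probability T R) (lambda : R) (n : nat).
Variables (H : 'I_n -> T -> set (circle beta)).
Variables (L : {set 'I_n} -> T -> set (circle beta)).
Hypothesis HL : quantum_processes P lambda H L.

(** Each of the [n] circles, that of [I] included, contributes |I| to the row of [I], so the sum
    over all ordered pairs is n^2 beta. The diagonal contributes n beta, since kappa(I, I) = |I|,
    and half of the difference is the sum over [i < j]. *)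
Lemma sum_kappa_vertices w :
  \sum_(i < size (vertex_types H w)) \sum_(j < size (vertex_types H w) | (i < j)%N)
     kappa (nth point (vertex_types H w) i, nth point (vertex_types H w) j) =
  n%:R * (n%:R - 1) / 2 * b.
Proof.
set x := vertex_types H w.
have := @sum_pairs_sym R (size x)
  (fun i j => kappa (nth point x i, nth point x j)) (fun i j => kappaC _ _).
have sum1 : \sum_(i < size x) \sum_(j < size x) kappa (nth point x i, nth point x j) =
    n%:R * (n%:R * b).
  rewrite -(big_mkord xpredT (fun i => \sum_(j < size x) kappa (nth point x i, nth point x j))).
  rewrite -(big_nth point xpredT (fun I => \sum_(j < size x) kappa (I, nth point x j))).
  rewrite exchange_big /= -(big_mkord xpredT (fun j => \sum_(I <- x) kappa (I, nth point x j))).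
  rewrite -(big_nth point xpredT (fun J => \sum_(I <- x) kappa (I, J))).
  have sumI J : \sum_(I <- x) kappa (I, J) = n%:R * kappa (None, J).
    rewrite (big_vertex_types HL).
    under eq_bigr do rewrite /ivl (sum_kappa_intervals _ (pts_finite _)).
    by rewrite sumr_const card_ord mulr_natl.
  under eq_bigr do rewrite sumI.
  rewrite -mulr_sumr (big_vertex_types HL).
  under eq_bigr do rewrite /ivl (sum_kappaT_intervals (pts_finite _)).
  by rewrite sumr_const card_ord (mulr_natl b n).
have sum2 : \sum_(i < size x) kappa (nth point x i, nth point x i) = n%:R * b.
  rewrite -(big_mkord xpredT (fun i => kappa (nth point x i, nth point x i))).
  rewrite -(big_nth point xpredT (fun I => kappa (I, I))).
  under eq_bigr do rewrite kappa_diag.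
  rewrite (big_vertex_types HL).
  under eq_bigr do rewrite /ivl (sum_kappaT_intervals (pts_finite _)).
  by rewrite sumr_const card_ord mulr_natl.
rewrite sum1 sum2 => h; lra.
Qed.

End pairs.

Variable Q : probability (@cfgT R beta) R.
Variable mu : {finite_measure set S -> \bar R}.
Hypothesis muE : forall A, measurable A -> mu A = ivl_measure Q A.

Let integral_mu (f : S -> \bar R) : measurable_fun setT f -> (forall I, 0 <= f I)%E ->
  (\int[mu]_I f I = \int[Q]_h \sum_(I <- ivl h) f I)%E.
Proof.
move=> mf f0; rewrite (eq_measure_integral (ivl_measure Q)) => [|A mA _]; last exact: muE.
exact: ge0_integral_ivl_measure.
Qed.

Let mkappa1 s : measurable_fun setT (fun t : S => (kappa (s, t))%:E).
Proof.
apply/measurable_EFinP; apply: (measurableT_comp kappa_measurable).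
exact: pair1_measurable.
Qed.

Let integral_Q_cst (c : R) : (\int[Q]_h c%:E = c%:E)%E.
Proof.
rewrite integral_cst // [X in (_ * X)%E](_ : _ = 1%E) ?mule1 //.
exact: probability_setT.
Qed.

Lemma integral_kappa : (\int[mu \x mu]_p (kappa p)%:E = b%:E)%E.
Proof.
have mk : measurable_fun setT (fun p : S * S => (kappa p)%:E).
  by apply/measurable_EFinP; exact: kappa_measurable.
rewrite fubini_tonelli1 //; last by move=> p; rewrite lee_fin kappa_nonneg.
rewrite /fubini_F.
transitivity (\int[mu]_s (kappa (None, s))%:E)%E.
  apply: eq_integral => s _; rewrite integral_mu //; last first.
    by move=> t; rewrite lee_fin kappa_nonneg.
  rewrite -[RHS]integral_Q_cst; apply: eq_integral => h _; rewrite sumEFin.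
  congr EFin; rewrite -(sum_kappa_intervals s (pts_finite h)).
  by apply: eq_bigr => I _; exact: kappaC.
rewrite integral_mu //; last by move=> t; rewrite lee_fin kappa_nonneg.
rewrite -[RHS]integral_Q_cst; apply: eq_integral => h _; rewrite sumEFin.
by rewrite (sum_kappaT_intervals (pts_finite h)).
Qed.

Lemma kappa_integrable : (mu \x mu)%E.-integrable setT (EFin \o @kappa R beta).
Proof.
apply/integrableP; split; first by apply/measurable_EFinP; exact: kappa_measurable.
under eq_integral do rewrite /= ger0_norm ?kappa_nonneg //.
by rewrite integral_kappa ltry.
Qed.

End kappa_sums.

Lemma cvg_half_pairs {R : realType} (b : R) :
  ((n%:R^-1)%:E * (n%:R * (n%:R - 1) / 2 * b / n%:R)%:E)%E @[n --> \oo] -->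
  ((2^-1)%:E * b%:E)%E.
Proof.
apply: (@cvg_trans _ ((fun n : nat => (2^-1 * b - 2^-1 * b * n%:R^-1)%:E) @ \oo)).
  apply: near_eq_cvg; exists 1%N => // n /= n0.
  rewrite -EFinM; congr EFin.
  have : (n%:R : R) != 0 by rewrite pnatr_eq0 -lt0n.
  by move=> ?; field.
rewrite -EFinM; apply: cvg_EFin; first exact: nearW.
rewrite -[X in _ --> X]subr0 -[X in _ --> _ - X](mulr0 (2^-1 * b)).
apply: cvgB; first exact: cvg_cst.
apply: cvgMr; apply/gtr0_cvgV0; last exact: cvgr_idn.
by exists 1%N => // n /= n0; rewrite ltr0n.
Qed.

(** * Identification of the intensity measure and verification of the conditions *)

Lemma ivl_measure_law {R : realType} {beta : {posnum R}} {d}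
    {T : measurableType d} (P : probability T R) (X : T -> set (circle beta))
    (fX : forall w, finite_set (X w)) (mX : measurable_fun setT (cfg_of X))
    (A : set (borel (arc_space beta))) : measurable A ->
  ivl_measure (law P mX) A =
  'E_P[fun w => (count (fun J => J \in A) (intervals (X w)))%:R]%E.
Proof.
move=> mA; rewrite ivl_measureE//.
rewrite (ge0_integral_law _ _ (f := fun h => (((count (fun J => J \in A) (ivl h))%:R : R)%:E))).
- rewrite unlock; apply: eq_integral => w _.
  by rewrite /ivl pts_cfg_of.
- apply: (eq_measurable_fun
    (fun h : cfgT => \sum_(I <- ivl h) (\1_A I)%:E)%E).
    move=> h _; rewrite sumEFin; congr EFin.
    elim: (ivl h) => [|I s IH] /=; first by rewrite big_nil.
    by rewrite big_cons natrD IH indicE.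
  by apply: sum_ivl_measurable; apply/measurable_EFinP; exact: measurable_indic.
- by move=> h; rewrite lee_fin.
Qed.
Theorem mainTheorem2 (R : realType) (beta : {posnum R}) (lambda : R)
    (lambda_ge0 : 0 <= lambda)
    (* the holes on a single circle, which define mu *)
    (d0 : measure_display) (T0 : measurableType d0) (P0 : probability T0 R)
    (H0 : T0 -> set (circle beta))
    (H0_poisson : poisson_process P0 lambda H0)
    (* the holes and links of the quantum random graphs *)
    (d : nat -> measure_display) (T : forall n, measurableType (d n))
    (P : forall n, probability (T n) R)
    (H : forall n, 'I_n -> T n -> set (circle beta))
    (L : forall n, {set 'I_n} -> T n -> set (circle beta))
    (HL : forall n, (0 < n)%N -> quantum_processes (P n) lambda (H n) (L n)) :
  exists mu : {finite_measure set (borel (arc_space beta)) -> \bar R},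
    [/\ forall A : set (borel (arc_space beta)), measurable A ->
          mu A = 'E_P0[fun w => (count (fun J => J \in A)
                                   (intervals (H0 w)))%:R]%E,
        forall n w, (0 < n)%N ->
          size (vertex_types (H n) w) =
          (\sum_(i < n) maxn (npts (H n i w)) 1)%N,
        GV_conditions mu P (fun n => vertex_types (H n)) (@kappa R beta)
      & forall n, (0 < n)%N ->
          is_GV (P n) (vertex_types (H n)) n (@kappa R beta)
            (quantum_edges (H n) (L n))].
Proof.
have [fH0 mH0 _ _] := H0_poisson.
pose mX := cfg_of_measurable fH0 mH0.
pose Q := law P0 mX.
have Q_size2 := poisson_ivl_size2 lambda_ge0 H0_poisson mX.
have /andP[Q_gt0 Q_lty] := ivl_measureT_fin Q_size2.
(* Restricting to the whole space changes no value; it only packages [ivl_measure Q] as a finite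
   measure by means of [Q_lty]. *)
pose mu : {finite_measure set (borel (arc_space beta)) -> \bar R} :=
  mfrestr measurableT Q_lty.
have muE (A : set (borel (arc_space beta))) : measurable A ->
    mu A = ivl_measure Q A.
  by move=> mA; rewrite /mu /= /mfrestr /mrestr setIT.
have HP n : (0 < n)%N -> forall i, poisson_process (P n) lambda (H n i).
  by move=> n0; have [] := HL n n0.
have lawH n : (0 < n)%N -> forall (i : 'I_n) (E : set cfgT), measurable E ->
    P n (cfg_of (H n i) @^-1` E) = Q E.
  move=> n0 i E mE; rewrite [RHS]lawE.
  exact: poisson_process_law (HP n n0 i) H0_poisson mE.
have rx n : (0 < n)%N -> random_seq (vertex_types (H n)).
  move=> n0; apply: vertex_types_random_seq => i; last first.
    exact: cfg_holes_measurable (HL n n0) i.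
  by have [] := HP n n0 i.
exists mu; split.
- by move=> A mA; rewrite muE// /Q ivl_measure_law.
- by move=> n w n0; exact: size_vertex_types (HL n n0) w.
- split.
  + exact: kappaC.
  + exact: kappa_nonneg.
  + exact: kappa_measurable.
  + exact: arc_dense.
  + by rewrite muE// Q_gt0 Q_lty.
  + exact: rx.
  + exact: empirical_weak HL Q Q_size2 lawH mu muE.
  + exact: empirical_sets HL Q Q_size2 lawH mu muE.
  + by apply: aeW => p; exact: kappa_continuous.
  + exact: kappa_integrable muE.
  + move=> E GE; rewrite (integral_kappa muE).
    apply: cvg_trans; last exact: cvg_half_pairs.
    apply: near_eq_cvg; exists 1%N => // n /= n0.
    congr (_ * _)%E; apply/esym.
    apply: (expected_num_edges (rx n n0) _ _ (GE n n0)).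
    * exact: kappa_nonneg.
    * exact: kappa_measurable.
    * by rewrite !mulr_ge0// subr_ge0 ler1n.
    * by move=> w; exact: sum_kappa_vertices (HL n n0) w.
- by move=> n n0; exact: quantum_is_GV (HL n n0) n0.
Qed.
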